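(* There are three connected cubic graphs on $16$ vertices with the same values of $$n,\ m,\ \ell,\ \gamma,\ g_{\max},\ \operatorname{diam},\ \kappa,\ \lambda,\ |\operatorname{Aut}(G)|,$$ the same cycle counts $c_3,\dots,c_{10}$, and the same adjacency spectrum (hence, being cubic, the same Laplacian spectrum and the same number of spanning trees) but pairwise distinct orientable genus polynomials. No smaller such triple exists: for $n<16$ there are no three connected cubic graphs on $n$ vertices agreeing on all of these invariants and having pairwise distinct orientable genus polynomials.
   Context: All graphs are finite and simple; cubic means $3$-regular. For a graph $G$: $n$ and $m$ are the numbers of vertices and edges, $\ell$ is the girth, $\operatorname{diam}$ the diameter, $\kappa$ and $\lambda$ the vertex and edge connectivity, and $c_k(G)$ is the number of cycles of length $k$ (unoriented, as subgraphs). A dart of $G$ is an ordered pair $(u,v)$ with $uv\in E(G)$. A rotation system $\rho$ of $G$ assigns to each vertex $v$ a cyclic ordering of its neighbours; $\sigma_v(u)$ denotes the neighbour of $v$ following $u$. The face permutation on darts is $\phi_\rho(u,v)=(v,\sigma_v(u))$; its cycles are the faces of $\rho$, and $F(\rho)$ is their number. For a connected cubic graph on $n$ vertices the genus of $\rho$ is given by Euler's formula, $g(\rho)=1+\frac n4-\frac12F(\rho)$. The orientable genus polynomial is $\Gamma_G(x)=\sum_\rho x^{g(\rho)}$ over all $2^n$ rotation systems; $\gamma(G)=\min_\rho g(\rho)$ and $g_{\max}(G)=\max_\rho g(\rho)$ are the minimum and maximum genus. *)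

(* Defs.v *)
From HB Require Import structures.
From mathcomp Require Import all_boot all_order all_fingroup all_algebra all_field.

Set Implicit Arguments.
Unset Strict Implicit.
Unset Printing Implicit Defensive.

Import GRing.Theory Num.Theory.

Local Open Scope ring_scope.

Record sgraph := SGraph {
  vertex :> finType;
  adj : rel vertex;
  adj_sym : symmetric adj;
  adj_irr : irreflexive adj }.

Section Graph.
Variable G : sgraph.

Definition nbhd (v : G) : {set G} := [set u | adj v u].

Definition cubic : bool := [forall v : G, #|nbhd v| == 3%N].

(* The graph without vertices is not connected. *)
Definition connected : bool :=
  (0 < #|G|)%N && [forall x : G, forall y : G, connect (@adj G) x y].

Definition edges : {set {set G}} :=
  [set [set p.1; p.2] | p : G * G & adj p.1 p.2].

Section Induced.
Variable S : {set G}.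
Definition induced_adj : rel {x : G | x \in S} :=
  fun x y => adj (val x) (val y).
Lemma induced_sym : symmetric induced_adj.
Proof. by move=> x y; apply: adj_sym. Qed.
Lemma induced_irr : irreflexive induced_adj.
Proof. by move=> x; apply: adj_irr. Qed.
Definition induced : sgraph := SGraph induced_sym induced_irr.
End Induced.

Section Spanning.
Variable F : {set {set G}}.
Definition spanning_adj : rel G := fun x y => adj x y && ([set x; y] \in F).
Lemma spanning_sym : symmetric spanning_adj.
Proof. by move=> x y; rewrite /spanning_adj adj_sym setUC. Qed.
Lemma spanning_irr : irreflexive spanning_adj.
Proof. by move=> x; rewrite /spanning_adj adj_irr. Qed.
(* The spanning subgraph with edge set [F :&: edges]. *)
Definition spanning_subgraph : sgraph := SGraph spanning_sym spanning_irr.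
End Spanning.

Definition cycle_edges (s : seq G) : {set {set G}} :=
  [set [set x; next s x] | x in s].

(* Cycles of length [k] as subgraphs, a cycle being identified with its set of
   edges; meaningful for [k >= 3] only. *)
Definition kcycles (k : nat) : {set {set {set G}}} :=
  [set cycle_edges t | t : k.-tuple G & ucycleb (@adj G) t].

Definition num_cycles (k : nat) : nat := #|kcycles k|.

(* [None] is the infinite girth of a forest. *)
Definition girth : option nat :=
  ohead [seq k <- iota 3 (#|G| - 2) | (0 < num_cycles k)%N].

Definition walk (k : nat) (x y : G) : bool :=
  [exists t : k.-tuple G, path (@adj G) x t && (last x t == y)].

(* The value is [#|G|.+1] when [x] and [y] are not connected. *)
Definition dist (x y : G) : nat :=
  find (fun k => walk k x y) (iota 0 #|G|.+1).

Definition diam : nat := (\max_(x : G) \max_(y : G) dist x y)%N.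

End Graph.

Section Invariants.
Variable G : sgraph.

(* Minimum number of vertices whose deletion leaves a disconnected graph or a
   single vertex, so that the complete graph K_n has connectivity n-1. *)
Definition vertex_connectivity : nat :=
  \big[minn/#|G|]_(S : {set G} |
      ~~ connected (induced (~: S)) || (#|~: S| == 1%N)) #|S|.

Definition edge_connectivity : nat :=
  \big[minn/#|edges G|]_(F : {set {set G}} |
      (F \subset edges G) && ~~ connected (spanning_subgraph (~: F))) #|F|.

Definition Aut_graph : {set {perm G}} :=
  [set s : {perm G} | [forall x, forall y, adj (s x) (s y) == adj x y]].

Definition acyclic (H : sgraph) : bool :=
  [forall k : 'I_#|H|.+1, (2 < k)%N ==> (num_cycles H k == 0%N)].

Definition spanning_trees : {set {set {set G}}} :=
  [set F : {set {set G}} | [&& F \subset edges G,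
     connected (spanning_subgraph F) & acyclic (spanning_subgraph F)]].

Definition adjacency_mx : 'M[algC]_#|G| :=
  \matrix_(i, j) (adj (enum_val i) (enum_val j))%:R.

Definition degree_mx : 'M[algC]_#|G| :=
  diag_mx (\row_i #|nbhd (enum_val i)|%:R).

Definition laplacian_mx : 'M[algC]_#|G| := degree_mx - adjacency_mx.

(* A cyclic ordering of the neighbours of [v] is encoded by its successor
   function [rho v], a permutation that fixes every non-neighbour and has the
   neighbours of [v] as a single cycle. *)
Definition rotation_system (rho : {ffun G -> {perm G}}) : bool :=
  [forall v : G, perm_on (nbhd v) (rho v) &&
     [forall u in nbhd v, porbit (rho v) u == nbhd v]].

Definition darts : {pred G * G} := [pred d | adj d.1 d.2].

(* Defined on all pairs of vertices, this map restricts to the face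
   permutation of the darts. *)
Definition face_map (rho : {ffun G -> {perm G}}) (d : G * G) : G * G :=
  (d.2, rho d.2 d.1).

Definition num_faces (rho : {ffun G -> {perm G}}) : nat :=
  fcard (face_map rho) darts.

(* When G is connected and cubic and [rho] is a rotation system, the rational
   is a natural number and the truncation does not change it. *)
Definition genus (rho : {ffun G -> {perm G}}) : nat :=
  Num.truncn (1 + #|G|%:R / 4%:R - (num_faces rho)%:R / 2%:R : rat).

Definition genus_poly : {poly int} :=
  \sum_(rho : {ffun G -> {perm G}} | rotation_system rho) 'X^(genus rho).

Definition max_genus : nat :=
  (\max_(rho : {ffun G -> {perm G}} | rotation_system rho) genus rho)%N.

(* [max_genus] only serves as a neutral element: rotation systems exist. *)
Definition min_genus : nat :=
  \big[minn/max_genus]_(rho : {ffun G -> {perm G}} | rotation_system rho)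
    genus rho.

Lemma face_map_inj (rho : {ffun G -> {perm G}}) : injective (face_map rho).
Proof. by move=> [a b] [c d] [-> /perm_inj ->]. Qed.

Lemma darts_closed (rho : {ffun G -> {perm G}}) :
  rotation_system rho -> fclosed (face_map rho) darts.
Proof.
move=> /forallP rhoP [u v] _ /eqP <-; have /andP[on_v _] := rhoP v.
by have := perm_closed u on_v; rewrite !inE /= [adj u v]adj_sym.
Qed.

End Invariants.

(* The eigenvalues of a square matrix with their algebraic multiplicities, in
   an unspecified order. *)
Definition spectrum (n : nat) (A : 'M[algC]_n) : seq algC :=
  sval (closed_field_poly_normal (char_poly A)).

Definition cospectral (G H : sgraph) : bool :=
  perm_eq (spectrum (adjacency_mx G)) (spectrum (adjacency_mx H)).

Definition laplacian_cospectral (G H : sgraph) : bool :=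
  perm_eq (spectrum (laplacian_mx G)) (spectrum (laplacian_mx H)).

Definition same_invariants (G H : sgraph) : Prop :=
  [/\ [/\ #|G| = #|H|, #|edges G| = #|edges H| & girth G = girth H],
      [/\ min_genus G = min_genus H & max_genus G = max_genus H],
      [/\ diam G = diam H,
          vertex_connectivity G = vertex_connectivity H,
          edge_connectivity G = edge_connectivity H
        & #|Aut_graph G| = #|Aut_graph H|],
      forall k : nat, (3 <= k <= 10)%N -> num_cycles G k = num_cycles H k
    & cospectral G H].

Definition genus_triple (n : nat) (G1 G2 G3 : sgraph) : Prop :=
  [/\ [/\ connected G1 && cubic G1, connected G2 && cubic G2
        & connected G3 && cubic G3],
      [/\ #|G1| = n, #|G2| = n & #|G3| = n],
      [/\ same_invariants G1 G2, same_invariants G1 G3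
        & same_invariants G2 G3]
    & [/\ genus_poly G1 <> genus_poly G2, genus_poly G1 <> genus_poly G3
        & genus_poly G2 <> genus_poly G3]].

(* Main.v *)
From Stdlib Require Import NArith.
Require Import Defs.
From mathcomp Require Import all_boot all_order all_fingroup all_algebra all_field.
From mathcomp Require Import zify.

Set Implicit Arguments.
Unset Strict Implicit.
Unset Printing Implicit Defensive.

Import GRing.Theory Num.Theory.

(** The theorem has an existential half, settled by three explicit graphs on 16
    vertices, and a universal half, settled by an enumeration of the cubic graphs
    on at most 14 vertices (no cubic graph has an odd number of vertices).

    Spectra are compared through closed walks. The number of closed walks of
    length [k] is the trace of the [k]-th power of the adjacency matrix, hence a
    power sum of the eigenvalues, and finitely many power sums determine a
    multiset ([closed_walks_cospectral]). Being integers, the counts of closed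
    walks can be computed. For cubic graphs they also determine the power sums of
    the Laplacian spectrum ([cospectral_laplacian]). The linear coefficient of
    the characteristic polynomial of the Laplacian determines the number of
    spanning trees ([matrix_tree]): the determinant is expanded over all ways to
    give each vertex a parent or make it a root, and only forests contribute.

    The universal half rests on the spectrum: among the cubic graphs on fewer
    than 16 vertices, no three pairwise non-isomorphic ones agree in their closed
    walks of lengths 3 to 9, and isomorphic graphs have the same genus polynomial.
    Graphs are represented by tables of neighbours. Every non-empty cubic graph
    has an edge whose deletion, followed by suppression of its ends, leaves a cubic
    graph without loops and double edges, or a diamond that shrinks to an edge, or
    a [K_4] component ([reduce_cubic]). Reversing these steps and removing isomorphic
    copies after each round gives complete lists ([cubic_tables_complete]); a copy
    is removed only after an isomorphism has been verified. Deletions may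
    disconnect a graph, hence the lists are not restricted to connected graphs.

    The genus polynomial of a 16-vertex graph has [2 ^ 16] terms. Its coefficients
    are found by choosing the rotations at one vertex after the other. Each choice
    adds three arcs to the face permutation. The arcs added so far form paths and
    closed cycles, and only the ends of the paths matter for the cycles still to be
    closed, so choices that lead to the same paths are counted together
    ([face_distribution]). That closing paths counts the cycles of the final
    permutation rests on the effect of a transposition on the number of cycles
    ([arcs_addedS]). The three graphs have respectively 2028, 2148 and 2036
    rotation systems of genus 2.

    The other invariants of the three graphs are computed as well: cycles as sets
    of edges, distances from walk counts, both connectivities by searching the
    graph after every deletion of at most two vertices or edges (deleting the three
    neighbours of a vertex, or its three edges, separates it). The automorphism
    groups are trivial because the numbers of short closed walks at the vertices
    are pairwise distinct. *)

(** * Spectra and closed walks *)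

Section PowerSums.
Local Open Scope ring_scope.

Lemma sum_horner (F : numFieldType) (s t : seq F) (p : {poly F}) :
  (forall k, (k < size p)%N -> \sum_(x <- s) x ^+ k = \sum_(x <- t) x ^+ k) ->
  \sum_(x <- s) p.[x] = \sum_(x <- t) p.[x].
Proof.
have E (r : seq F) : \sum_(x <- r) p.[x] = \sum_(i < size p) p`_i * \sum_(x <- r) x ^+ i.
  under eq_bigr => x _ do rewrite horner_coef.
  by rewrite exchange_big; apply: eq_bigr => i _; rewrite mulr_sumr.
by move=> H; rewrite !E; apply: eq_bigr => i _; rewrite H.
Qed.

(** A polynomial vanishing at every listed point but [z] turns the power sums
    into the multiplicity of [z]. *)
Lemma perm_eq_power_sums (F : numFieldType) (s t : seq F) :
  (forall k, (k <= size s + size t)%N ->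
     \sum_(x <- s) x ^+ k = \sum_(x <- t) x ^+ k) ->
  perm_eq s t.
Proof.
move=> H; apply/allP => z _; apply/eqP.
pose r := [seq w <- s ++ t | w != z].
pose p := \prod_(w <- r) ('X - w%:P).
have pz : p.[z] != 0.
  rewrite /p horner_prod prodf_seq_neq0; apply/allP => w.
  by rewrite mem_filter hornerXsubC subr_eq0 eq_sym => /andP[-> _].
have cnt (u : seq F) : {subset u <= s ++ t} ->
    \sum_(x <- u) p.[x] = (count_mem z u)%:R * p.[z].
  elim: u => [|x u IH] sub; first by rewrite big_nil mul0r.
  rewrite big_cons IH => [|y yu]; last by rewrite sub // inE yu orbT.
  rewrite /= natrD mulrDl; congr (_ + _).
  have [->|xz] := eqVneq x z; first by rewrite mul1r.
  rewrite mul0r; apply/eqP; rewrite -/(root p x) root_prod_XsubC mem_filter xz.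
  by rewrite sub // mem_head.
have := @sum_horner F s t p; rewrite cnt => [|x xs]; last by rewrite mem_cat xs.
rewrite cnt => [|x xt]; last by rewrite mem_cat xt orbT.
move=> /(_ _)/(mulIf pz)/eqP; rewrite eqr_nat => E; apply/eqP/E => k.
rewrite size_prod_XsubC ltnS => le_k; apply: H; apply: leq_trans le_k _.
by rewrite size_filter -size_cat count_size.
Qed.

End PowerSums.

Section Traces.
Local Open Scope ring_scope.
Variables (n : nat).
Implicit Types A B : 'M[algC]_n.

Lemma real_symmetric_normal A :
  (forall i j, A i j = A j i) -> (forall i j, A i j \is Num.real) ->
  A \is normalmx.
Proof.
move=> sym re; apply/hermitian_normalmx/realsym_hermsym.
  by apply/is_hermitianmxP; rewrite expr0 scale1r; apply/matrixP=> i j; rewrite !mxE sym.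
by apply/mxOverP => i j; apply: re.
Qed.

Lemma char_poly_similar A B P :
  P \in unitmx -> A = invmx P *m B *m P -> char_poly A = char_poly B.
Proof.
move=> uP ->; rewrite /char_poly /char_poly_mx !map_mxM.
have E : map_mx (@polyC _) (invmx P) *m map_mx polyC P = 1%:M.
  by rewrite -map_mxM mulVmx // map_mx1.
have -> : 'X%:M - map_mx polyC (invmx P) *m map_mx polyC B *m map_mx polyC P =
    map_mx polyC (invmx P) *m ('X%:M - map_mx polyC B) *m map_mx polyC P.
  rewrite mulmxBr mulmxBl; congr (_ - _).
  by rewrite scalar_mxC -mulmxA E mulmx1.
by rewrite !det_mulmx mulrAC -det_mulmx E det1 mul1r.
Qed.

Lemma spectrumE A : char_poly A = \prod_(x <- spectrum A) ('X - x%:P).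
Proof.
rewrite /spectrum; case: closed_field_poly_normal => r /= ->.
by rewrite (monicP (char_poly_monic A)) scale1r.
Qed.

Lemma size_spectrum A : size (spectrum A) = n.
Proof.
by have := size_char_poly A; rewrite spectrumE size_prod_XsubC => -[].
Qed.

(** A real symmetric matrix is unitarily diagonalizable, and its diagonal form
    lists the spectrum. *)
Lemma trace_spectrum A k :
  (forall i j, A i j = A j i) -> (forall i j, A i j \is Num.real) ->
  \tr (A ^+ k) = \sum_(x <- spectrum A) x ^+ k.
Proof.
move=> sym re; have /orthomx_spectralP := real_symmetric_normal sym re.
set P := spectralmx A; set d := spectral_diag A => defA.
have uP : P \in unitmx := spectral_unit A.
have defs : perm_eq (spectrum A) [seq d 0 i | i <- enum 'I_n].
  apply: prod_XsubC_eq; rewrite -spectrumE (char_poly_similar uP defA).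
  rewrite char_poly_trig ?diag_mx_is_trig // big_map big_enum /=.
  by apply: eq_bigr => i _; rewrite mxE eqxx mulr1n.
rewrite (perm_big _ defs) big_map big_enum /=.
have -> : A ^+ k = invmx P *m diag_mx (\row_i d 0 i ^+ k) *m P.
  elim: k => [|k IH].
    rewrite expr0 (_ : \row_i _ = const_mx 1); last first.
      by apply/rowP=> i; rewrite !mxE expr0.
    by rewrite diag_const_mx mulmx1 mulVmx.
  rewrite exprSr IH {1}defA; rewrite -[_ * _]/(_ *m _) !mulmxA mulmxK //.
  rewrite -[_ *m diag_mx d]mulmxA.
  rewrite mulmx_diag; congr (_ *m diag_mx _ *m _).
  by apply/rowP => i; rewrite !mxE exprSr.
rewrite mxtrace_mulC mulmxA mulmxV // mul1mx mxtrace_diag.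
by apply: eq_bigr => i _; rewrite mxE.
Qed.

End Traces.

Section Walks.
Variable G : sgraph.

Fixpoint walks (k : nat) (x y : G) : nat :=
  if k is k'.+1 then \sum_(z | adj x z) walks k' z y else (x == y).

Definition closed_walks (k : nat) : nat := \sum_(x : G) walks k x x.

Lemma walk_walks k x y : walk k x y = (0 < walks k x y)%N.
Proof.
elim: k x => [|k IH] x /=.
  rewrite /walk; apply/existsP/idP => [[t]|]; first by rewrite tuple0 /= lt0b.
  by rewrite lt0b => xy; exists [tuple]; rewrite /= xy.
rewrite lt0n sum_nat_eq0 negb_forall; apply/existsP/existsP => -[].
  move=> t; rewrite (tuple_eta t) /= -andbA => /and3P[xz pt lt].
  exists (thead t); rewrite xz /= -lt0n -IH; apply/existsP.
  by exists (behead_tuple t); rewrite pt.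
move=> z; rewrite negb_imply -lt0n -IH => /andP[xz /existsP[t /andP[pt lt]]].
by exists (cons_tuple z t); rewrite /= xz pt.
Qed.

Local Open Scope ring_scope.

Lemma adjacency_mx_expE k i j :
  (adjacency_mx G ^+ k) i j = (walks k (enum_val i) (enum_val j))%:R.
Proof.
elim: k i => [|k IH] i; first by rewrite expr0 /= (inj_eq enum_val_inj) mxE.
rewrite exprS mxE /= natr_sum [RHS]big_mkcond [RHS](reindex_onto enum_val enum_rank) /=.
  rewrite [RHS](eq_bigl predT) => [|l]; last by rewrite enum_valK eqxx.
  apply: eq_bigr => l _; rewrite mxE IH; case: adj; first by rewrite mul1r.
  by rewrite mul0r.
by move=> x _; rewrite enum_rankK.
Qed.

Lemma adjacency_mx_sym i j : adjacency_mx G i j = adjacency_mx G j i.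
Proof. by rewrite !mxE adj_sym. Qed.

Lemma adjacency_mx_real i j : adjacency_mx G i j \is Num.real.
Proof. by rewrite mxE; apply: realn. Qed.

Lemma trace_closed_walks k : \tr (adjacency_mx G ^+ k) = (closed_walks k)%:R.
Proof.
rewrite /mxtrace natr_sum [RHS](reindex_onto enum_val enum_rank) /=.
  rewrite [RHS](eq_bigl predT) => [|l]; last by rewrite enum_valK eqxx.
  by apply: eq_bigr => l _; rewrite adjacency_mx_expE.
by move=> x _; rewrite enum_rankK.
Qed.

End Walks.

Section Cospectral.
Variables G H : sgraph.
Local Open Scope ring_scope.

Lemma cospectral_closed_walks k :
  cospectral G H -> closed_walks G k = closed_walks H k.
Proof.
move=> GH; apply/eqP; rewrite -(eqr_nat algC) -!trace_closed_walks.
rewrite !trace_spectrum; last 4 first.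
- exact: adjacency_mx_sym.
- exact: adjacency_mx_real.
- exact: adjacency_mx_sym.
- exact: adjacency_mx_real.
by rewrite (perm_big _ GH).
Qed.

(** The closed walks of length [k] number the [k]-th power sum of the
    eigenvalues, so that finitely many of these counts fix the spectrum. *)
Lemma closed_walks_cospectral :
  (forall k, (k <= #|G| + #|H|)%N -> closed_walks G k = closed_walks H k) ->
  cospectral G H.
Proof.
move=> GH; apply: perm_eq_power_sums => k; rewrite !size_spectrum => /GH E.
rewrite -!trace_spectrum; first by rewrite !trace_closed_walks E.
- exact: adjacency_mx_sym.
- exact: adjacency_mx_real.
- exact: adjacency_mx_sym.
exact: adjacency_mx_real.
Qed.

Lemma cubic_laplacian (K : sgraph) :
  cubic K -> laplacian_mx K = 3%:R%:M - adjacency_mx K.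
Proof.
move=> /forallP cK; congr (_ - _); apply/matrixP => i j; rewrite !mxE.
by have /eqP -> := cK (enum_val i).
Qed.

Lemma laplacian_mx_sym (K : sgraph) i j : laplacian_mx K i j = laplacian_mx K j i.
Proof.
rewrite !mxE (adj_sym (enum_val i)) eq_sym; congr (_ - _).
by have [->|] := eqVneq j i.
Qed.

Lemma laplacian_mx_real (K : sgraph) i j : laplacian_mx K i j \is Num.real.
Proof.
rewrite !mxE; apply: rpredB; last exact: realn.
by case: (i == j); rewrite ?mulr0n ?mulr1n ?rpred0 ?realn.
Qed.

(** The Laplacian of a cubic graph is [3 - A] for the adjacency matrix [A], so
    the traces of its powers follow from those of the powers of [A]. *)
Lemma trace_laplacian (K : sgraph) k : cubic K ->
  \tr (laplacian_mx K ^+ k) =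
  \sum_(i < k.+1) ((-1) ^+ i * 3%:R ^+ (k - i) * (closed_walks K i)%:R) *+ 'C(k, i).
Proof.
move=> cK; rewrite (cubic_laplacian cK) exprBn_comm; last first.
  change (3%:R%:M *m adjacency_mx K = adjacency_mx K *m 3%:R%:M).
  by rewrite scalar_mxC.
rewrite raddf_sum; apply: eq_bigr => i _; rewrite raddfMn /=; congr (_ *+ _).
have -> : (3%:R%:M : 'M[algC]_#|K|) ^+ (k - i) = (3%:R ^+ (k - i))%:M.
  by elim: (k - i)%N => [|m IH]; rewrite ?expr0 // !exprS IH -[_ * _]/(_ *m _) -scalar_mxM.
have -> : ((-1) ^+ i : 'M[algC]_#|K|) = ((-1) ^+ i)%:M.
  elim: (i : nat) => [|m IH]; rewrite ?expr0 // !exprS IH mulN1r mulN1r.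
  by rewrite raddfN.
rewrite -[_ * _ * _]/(_ *m _ *m _) -scalar_mxM mul_scalar_mx linearZ /=.
by rewrite trace_closed_walks.
Qed.

Lemma cospectral_laplacian :
  cubic G -> cubic H -> cospectral G H -> laplacian_cospectral G H.
Proof.
move=> cG cH GH; apply: perm_eq_power_sums => k _; rewrite -!trace_spectrum.
- rewrite !trace_laplacian //; apply: eq_bigr => i _.
  by rewrite (cospectral_closed_walks i GH).
- exact: laplacian_mx_sym.
- exact: laplacian_mx_real.
- exact: laplacian_mx_sym.
exact: laplacian_mx_real.
Qed.

End Cospectral.

(** * Spanning trees *)

Section Parents.
Variable T : finType.
Implicit Types (f : {ffun T -> option T}) (e : rel T) (r x y : T).

(** A rooted forest is the partial function that sends each vertex to its
    parent; the roots have none. *)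
Definition parent f x : T := odflt x (f x).

Definition reaches_root f x : bool :=
  [exists r, fconnect (parent f) x r && (f r == None)].

Definition forest e f : bool :=
  [forall x, reaches_root f x && (if f x is Some y then e x y else true)].

Definition forest_roots f : {set T} := [set r | f r == None].

Definition arborescence e r f : bool :=
  forest e f && (forest_roots f == [set r]).

Lemma reaches_root_parent f x : reaches_root f (parent f x) = reaches_root f x.
Proof.
case fx: (f x) => [y|]; last by rewrite /parent fx.
apply/existsP/existsP => -[r /andP[xr fr]]; exists r; rewrite fr andbT.
  exact: connect_trans (fconnect1 _ _) xr.
rewrite fconnect_eqVf in xr; case/predU1P: xr => [xr|//].
by rewrite -xr fx in fr.
Qed.

Lemma forest_edge e f x y : forest e f -> f x = Some y -> e x y.
Proof. by move=> /forallP/(_ x)/andP[_]; case: (f x) => // z ez [<-]. Qed.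

Lemma forest_iter e f x (Q : pred T) : forest e f -> Q x ->
  (forall y z, Q y -> f y = Some z -> Q z) -> exists2 r, f r = None & Q r.
Proof.
move=> /forallP/(_ x)/andP[/existsP[r /andP[xr /eqP fr]] _] Qx QS.
exists r => //; rewrite -(iter_findex xr); elim: (findex _ _ _) => //= m IH.
by rewrite {1}/parent; case E: (f _) => [z|] //=; apply: QS E.
Qed.

Section Root.
Variables (e : rel T) (r : T) (f : {ffun T -> option T}).
Hypothesis fP : arborescence e r f.

Lemma arborescence_forest : forest e f. Proof. by case/andP: fP. Qed.

Lemma arborescence_None x : (f x == None) = (x == r).
Proof. by case/andP: fP => _ /eqP/setP/(_ x); rewrite !inE. Qed.

Lemma arborescence_connect x : fconnect (parent f) x r.
Proof.
have /forallP/(_ x)/andP[/existsP[s /andP[xs fs]] _] := arborescence_forest.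
by rewrite arborescence_None in fs; rewrite -(eqP fs).
Qed.

Lemma findex_parent x y : f x = Some y ->
  findex (parent f) x r = (findex (parent f) y r).+1.
Proof.
move=> fx; have xr : x != r by rewrite -arborescence_None fx.
have fxy : parent f x = y by rewrite /parent fx.
by rewrite (fconnect_findex (arborescence_connect x)) ?fxy // eq_sym.
Qed.

End Root.

Lemma card_arborescences e :
  \sum_r #|[set f | arborescence e r f]| =
  #|[set f | forest e f & #|forest_roots f| == 1]|.
Proof.
rewrite -sum1_card; under eq_bigr => r _ do rewrite -sum1_card big_mkcond.
rewrite exchange_big [RHS]big_mkcond /=; apply: eq_bigr => f _.
under eq_bigr => r _ do rewrite inE /arborescence.
rewrite inE; case: (forest e f) => /=; last by rewrite big1.
case: cards1P => [[r ->]|no].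
  rewrite (bigD1 r) //= eqxx big1 ?addn0 // => s /negPf sr.
  by rewrite (inj_eq set1_inj) eq_sym sr.
by rewrite big1 // => r _; case: eqP => // E; case: no; exists r.
Qed.

End Parents.

Section TreeSets.
Variable G : sgraph.
Implicit Types (f g : {ffun G -> option G}) (r x y : G).

Definition tree_of f : {set {set G}} :=
  [set [set p.1; p.2] | p : G * G & f p.1 == Some p.2].

Lemma set2_eq (T : finType) (x y z w : T) :
  [set x; y] = [set z; w] -> (x = z /\ y = w) \/ (x = w /\ y = z).
Proof.
move=> E.
have : x \in [set z; w] by rewrite -E set21.
have : y \in [set z; w] by rewrite -E set22.
have : z \in [set x; y] by rewrite E set21.
have : w \in [set x; y] by rewrite E set22.
by rewrite !inE => /pred2P[]? /pred2P[]? /pred2P[]? /pred2P[]?; subst; auto.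
Qed.

Lemma mem_tree_of f x y :
  ([set x; y] \in tree_of f) = (f x == Some y) || (f y == Some x).
Proof.
apply/imsetP/orP => [[[u v] /=]|[] H].
- by rewrite inE /= => H /set2_eq[] [-> ->]; [left|right].
- by exists (x, y); rewrite ?inE.
by exists (y, x); rewrite ?inE //= setUC.
Qed.

Lemma tree_adj f x y : forest (@adj G) f ->
  (@spanning_adj G (tree_of f) x y) = (f x == Some y) || (f y == Some x).
Proof.
move=> fF; rewrite /spanning_adj mem_tree_of andb_idl // => /orP[]/eqP/(forest_edge fF) //.
by rewrite adj_sym.
Qed.

Lemma no_kcycles k :
  reflect (forall t : seq G, size t = k -> ~ ucycle (@adj G) t)
          (num_cycles G k == 0%N).
Proof.
rewrite cards_eq0; apply: (iffP eqP) => [E t tk ut|no].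
  have : cycle_edges t \in kcycles G k.
    by apply/imsetP; exists (tcast tk (in_tuple t)); rewrite ?inE ?val_tcast.
  by rewrite E inE.
apply/setP => X; rewrite inE; apply/imsetP => -[t]; rewrite inE => ut _.
by apply: (no t) ut; rewrite size_tuple.
Qed.

Lemma connect_walk x y : connect (@adj G) x y ->
  exists2 k, (k < #|G|)%N & walk k x y.
Proof.
case/connectP => p; case/shortenP => q xq uq _ ->; exists (size q).
  by have := max_card (mem (x :: q)); rewrite (card_uniqP uq).
by apply/existsP; exists (in_tuple q); rewrite /= xq eqxx.
Qed.

Lemma dist_leP k x y : (k <= #|G|)%N ->
  reflect (exists2 l, (l <= k)%N & walk l x y) (dist x y <= k)%N.
Proof.
move=> kG; set w := (fun k => walk k x y).
apply: (iffP idP) => [le_k|[l le_k wl]].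
  have lt : (dist x y < size (iota 0 #|G|.+1))%N.
    by rewrite size_iota ltnS (leq_trans le_k).
  exists (dist x y) => //; have := nth_find 0 (a := w) (s := iota 0 #|G|.+1).
  by rewrite has_find => /(_ lt); rewrite size_iota in lt; rewrite nth_iota // add0n.
rewrite leqNgt; apply/negP => lt.
have := before_find 0 (a := w) (leq_ltn_trans le_k lt).
by rewrite nth_iota ?add0n /w ?wl // ltnS (leq_trans le_k).
Qed.

(** A shortest walk starts with a step that lowers the distance by one. *)
Lemma closer_neighbour x r : connected G -> x != r ->
  exists2 y, adj x y & (dist y r < dist x r)%N.
Proof.
move=> /andP[_ /forallP/(_ x)/forallP/(_ r)/connect_walk[k lt_k wk]] xr.
have le_d : (dist x r <= k)%N by apply/dist_leP; [exact: ltnW|exists k].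
have dG : (dist x r <= #|G|)%N := leq_trans le_d (ltnW lt_k).
have [l le_l] := elimT (dist_leP x r dG) (leqnn _).
rewrite walk_walks; case: l le_l => [|l] le_l; first by rewrite /= (negPf xr).
rewrite /= lt0n sum_nat_eq0 negb_forall => /existsP[y].
rewrite negb_imply -lt0n -walk_walks => /andP[xy wl]; exists y => //.
apply: (leq_ltn_trans _ (le_l)); apply/dist_leP; last by exists l.
exact: leq_trans (ltnW le_l) dG.
Qed.

End TreeSets.

Section SpanningTrees.
Variable G : sgraph.
Implicit Types (f g : {ffun G -> option G}) (r x y : G).

Lemma tree_of_connected r f : arborescence (@adj G) r f ->
  connected (spanning_subgraph (tree_of f)).
Proof.
move=> fP; have fF := arborescence_forest fP.
have sym : connect_sym (@spanning_adj G (tree_of f)).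
  exact/sym_connect_sym/spanning_sym.
have to_r x : connect (@spanning_adj G (tree_of f)) x r.
  apply: connect_sub (arborescence_connect fP x) => y z /eqP <-.
  rewrite /parent; case E: (f y) => [w|] /=; last exact: connect0.
  by apply: connect1; rewrite tree_adj // E eqxx.
apply/andP; split; first by apply/card_gt0P; exists r.
apply/forallP => x; apply/forallP => y; apply: connect_trans (to_r x) _.
by rewrite sym.
Qed.

(** On a cycle of the edges [{x, f x}], a vertex at maximal distance from the
    root would have its parent as both of its neighbours. *)
Lemma tree_of_acyclic r f : arborescence (@adj G) r f ->
  acyclic (spanning_subgraph (tree_of f)).
Proof.
move=> fP; have fF := arborescence_forest fP.
apply/forallP => k; apply/implyP => k2; apply/no_kcycles => s sk /andP[cs us].
have [x0 x0s] : exists x, x \in s.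
  by case: s sk {cs us} k2 => [<- //|x s _ _]; exists x; rewrite mem_head.
pose d x := findex (parent f) x r.
case: (arg_maxnP (P := mem s) d x0s) => x xs max_x.
case: (rot_to xs) => i s' def_s'.
have sz : size (x :: s') = k by rewrite -def_s' size_rot.
have us' : uniq (x :: s') by rewrite -def_s' rot_uniq.
have cs' : path.cycle (@adj (spanning_subgraph (tree_of f))) (x :: s').
  by rewrite -def_s' rot_cycle.
have sub z : z \in x :: s' -> (d z <= d x)%N.
  by rewrite -def_s' mem_rot => /max_x.
have up y : y \in x :: s' -> @spanning_adj G (tree_of f) x y -> f x = Some y.
  move=> ys; rewrite tree_adj // => /orP[/eqP //|/eqP/(findex_parent fP) E].
  by have := sub y ys; rewrite /d E ltnn.
case: s' => [|y [|z s']] in sz us' cs' sub up {def_s'}.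
- by rewrite -sz in k2.
- by rewrite -sz in k2.
move: cs' => /= /andP[xy /andP[_]]; rewrite rcons_path => /andP[_ lx].
have ws := mem_last z s'; set w := last z s' in ws lx.
have fy : f x = Some y by apply: up xy; rewrite !inE eqxx orbT.
have fw : f x = Some w.
  apply: up; first by rewrite inE [w \in _ :: _]inE ws !orbT.
  by rewrite spanning_sym.
move: fw us'; rewrite fy => -[->] /= /and3P[_].
by rewrite ws.
Qed.

Lemma tree_of_spanning r f : arborescence (@adj G) r f ->
  tree_of f \in spanning_trees G.
Proof.
move=> fP; rewrite inE (tree_of_connected fP) (tree_of_acyclic fP) !andbT.
apply/subsetP => X /imsetP[[x y]] /=; rewrite inE /= => /eqP fx ->.
apply/imsetP; exists (x, y) => //; rewrite inE /=.
exact: forest_edge (arborescence_forest fP) fx.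
Qed.

(** Where two parent functions with the same edges differ at a vertex, the second
    one points back from the parent to that vertex, which the first one cannot
    do; so they differ at the parent too, and eventually at the root. *)
Lemma tree_of_inj r : {in [set f | arborescence (@adj G) r f] &, injective (@tree_of G)}.
Proof.
move=> f g; rewrite !inE => fP gP E; apply/ffunP => x; apply/eqP.
apply: contraTT isT => bad.
have [|s fs] := forest_iter (arborescence_forest fP) (Q := fun x => f x != g x) bad.
  move=> y z bad_y fy.
  have : [set y; z] \in tree_of g by rewrite -E mem_tree_of fy eqxx.
  rewrite mem_tree_of -fy eq_sym (negPf bad_y) /= => /eqP gz.
  apply/eqP => fz; rewrite -fz in gz.
  have := findex_parent fP fy; rewrite (findex_parent fP gz) => /eqP.
  by rewrite -addn2 -[X in X == _]addn0 eqn_add2l.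
have: s == r by rewrite -(arborescence_None fP) fs.
by rewrite fs -(arborescence_None gP) => /eqP ->; rewrite eqxx.
Qed.

(** The parent of a vertex is a neighbour that is closer to the root. An edge left
    out would close a cycle with a path of tree edges. *)
Lemma tree_of_surj r F : F \in spanning_trees G ->
  exists2 f, arborescence (@adj G) r f & tree_of f = F.
Proof.
rewrite inE => /and3P[FE cF aF]; pose H := spanning_subgraph F.
pose f : {ffun G -> option G} := [ffun x => if x == r then None else
  [pick y | @adj H x y && (@dist H y r < @dist H x r)]].
have fN x : (f x == None) = (x == r).
  rewrite ffunE; case: (eqVneq x r) => // xr; case: pickP => // no.
  by have [y xy lt] := closer_neighbour cF xr; have := no y; rewrite xy lt.
have fS x y : f x = Some y -> @adj H x y && (@dist H y r < @dist H x r).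
  by rewrite ffunE; case: eqP => // _; case: pickP => // z zP [<-].
have fP : arborescence (@adj G) r f.
  apply/andP; split; last by apply/eqP/setP => x; rewrite !inE fN.
  apply/forallP => x; apply/andP; split; last first.
    by case E: (f x) => [y|//]; case/andP: (fS _ _ E) => /andP[].
  have [m] := ubnP (@dist H x r); elim: m x => // m IH x lt_m.
  case E: (f x) => [y|]; last first.
    by apply/existsP; exists x; rewrite connect0 E.
  rewrite -reaches_root_parent /parent E /=; apply: IH.
  by case/andP: (fS _ _ E) => _ lt; apply: leq_trans lt _; rewrite -ltnS.
have sub : tree_of f \subset F.
  apply/subsetP => X /imsetP[[x y]]; rewrite inE /= => /eqP/fS.
  by case/andP=> /andP[_ xyF] _ ->.
exists f => //; apply/eqP; rewrite eqEsubset sub; apply/subsetP => X XF.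
have /imsetP[[x y]] := subsetP FE X XF; rewrite inE /= => xy defX.
apply: contraTT aF => Xf; rewrite negb_forall.
have /andP[_ /forallP/(_ x)/forallP/(_ y)/connectP[p]] := tree_of_connected fP.
case/shortenP => q xq uq _ def_y.
have subq : path (@adj H) x q.
  by apply: sub_path xq => u v /andP[uv] /(subsetP sub) uvF; apply/andP.
have lt2 : (2 < size (x :: q))%N.
  case: q def_y xq {uq subq} => [|z [|w q]] //= def_y.
    by rewrite def_y adj_irr in xy.
  by rewrite -def_y andbT => /andP[_]; rewrite -defX (negPf Xf).
have lek : (size (x :: q) < #|H|.+1)%N 
  by rewrite ltnS; have := max_card (mem (x :: q)); rewrite (card_uniqP uq).
apply/existsP; exists (Ordinal lek); rewrite negb_imply lt2 /=.
apply/no_kcycles => /(_ (x :: q) erefl) []; apply/andP; split=> //=.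
rewrite rcons_path subq -def_y /=; apply/andP; rewrite adj_sym xy; split=> //.
by rewrite setUC -defX.
Qed.

Lemma card_rooted_trees r :
  #|[set f | arborescence (@adj G) r f]| = #|spanning_trees G|.
Proof.
rewrite -(card_in_imset (@tree_of_inj r)); congr #|pred_of_set _|.
apply/setP => F; apply/imsetP/idP => [[f]|/(tree_of_surj r)[f fP <-]].
  by rewrite inE => fP ->; apply: tree_of_spanning fP.
by exists f; rewrite ?inE.
Qed.

End SpanningTrees.

(** * The matrix-tree theorem *)

Section MatrixTree.
Local Open Scope ring_scope.

Lemma det_sum_rows (R : comNzRingType) (n : nat) (C : finType)
    (B : C -> 'I_n -> 'I_n -> R) :
  \det (\matrix_(i, j) \sum_c B c i j) =
  \sum_(f : {ffun 'I_n -> C}) \det (\matrix_(i, j) B (f i) i j).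
Proof.
rewrite /determinant exchange_big /=; apply: eq_bigr => s _.
rewrite -mulr_sumr; congr (_ * _).
under eq_bigr => i _ do rewrite mxE.
rewrite (bigA_distr_bigA (fun i c => B c i (s i))); apply: eq_bigr => f _.
by apply: eq_bigr => i _; rewrite mxE.
Qed.

Lemma det_kernel (R : idomainType) (n : nat) (M : 'M[R]_n) (v : 'cV[R]_n) j :
  M *m v = 0 -> v j 0 != 0 -> \det M = 0.
Proof.
move=> Mv vj; have := congr1 (fun w => (\adj M *m w) j 0) Mv.
rewrite mulmxA mul_adj_mx mul_scalar_mx mulmx0 !mxE => /eqP.
by rewrite mulf_eq0 (negPf vj) orbF => /eqP.
Qed.

Variable G : sgraph.
Implicit Types f : {ffun G -> option G}.

(** Row [i] of the characteristic matrix of the Laplacian is the sum of these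
    rows over all ways [c] to make vertex [i] a root or to choose its parent. *)
Definition choice_row (c : option G) (i j : 'I_#|G|) : {poly algC} :=
  if c is Some y then
    if adj (enum_val i) y then (enum_val j == y)%:R - (i == j)%:R else 0
  else 'X *+ (i == j).

Definition choice_mx f : 'M[{poly algC}]_#|G| :=
  \matrix_(i, j) choice_row (f (enum_val i)) i j.

Lemma char_laplacian_sum :
  char_poly (laplacian_mx G) = \sum_(f : {ffun G -> option G}) \det (choice_mx f).
Proof.
rewrite /char_poly; set M := char_poly_mx _.
have -> : M = \matrix_(i, j) \sum_c choice_row c i j.
  apply/matrixP => i j; rewrite [RHS]mxE (bigD1 None) //=.
  rewrite (reindex_onto (@Some G) (odflt (enum_val i))) => [|[x|]//].
  rewrite (eq_bigl predT) => [|x]; last by rewrite eqxx.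
  rewrite /= -big_mkcond /= sumrB.
  rewrite !mxE raddfB /= opprB; congr (_ + _).
  congr (_ - _).
  - rewrite big_mkcond (bigD1 (enum_val j)) //= eqxx big1 ?addr0.
      by case: adj; rewrite ?polyC1 ?polyC0.
    by move=> x /negPf; rewrite eq_sym => ->; case: adj.
  rewrite sumr_const; case: (i == j); last by rewrite mulr0n polyC0 mul0rn.
  rewrite mulr1n polyC_natr /nbhd; congr (_ *+ _).
  by apply: eq_card => x; rewrite !inE.
rewrite det_sum_rows (reindex (fun f : {ffun G -> option G} => [ffun i => f (enum_val i)])) /=.
  apply: eq_bigr => f _; congr (\det _); apply/matrixP => i j.
  by rewrite !mxE ffunE.
exists (fun f : {ffun 'I_#|G| -> option G} => [ffun x => f (enum_rank x)]).
  by move=> f _; apply/ffunP => x; rewrite !ffunE enum_rankK.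
by move=> f _; apply/ffunP => x; rewrite !ffunE enum_valK.
Qed.

Lemma choice_row_self f i : forest (@adj G) f ->
  choice_mx f i i = if f (enum_val i) == None then 'X else -1.
Proof.
move=> fF; rewrite mxE /choice_row; case E: (f _) => [y|] /=; last first.
  by rewrite !eqxx mulr1n.
rewrite (forest_edge fF E) eqxx; case: (eqVneq (enum_val i) y) => [yE|_]; last by rewrite sub0r.
by have := forest_edge fF E; rewrite -yE adj_irr.
Qed.

(** A non-identity permutation in the Leibniz formula would follow parents
    around a cycle. *)
Lemma det_forest f : forest (@adj G) f ->
  \det (choice_mx f) = 'X ^+ #|forest_roots f| * (-1) ^+ #|~: forest_roots f|.
Proof.
move=> fF; rewrite /determinant (bigD1 1%g) //= odd_perm1 expr0 mul1r.
rewrite [X in _ + X]big1 ?addr0 => [|s s1].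
  under eq_bigr => i _ do rewrite perm1 choice_row_self //.
  rewrite (reindex_onto (@enum_rank G) enum_val) => [|i _]; last exact: enum_valK.
  rewrite (eq_bigl predT) => [|x]; last by rewrite /= enum_rankK eqxx.
  rewrite (bigID (fun x => f x == None)) /= -!prodr_const; congr (_ * _).
    by apply: eq_big => x; rewrite ?inE // enum_rankK => ->.
  by apply: eq_big => x; rewrite ?inE // enum_rankK => /negPf ->.
suff [i Mi] : exists i, choice_mx f i (s i) = 0.
  by rewrite (bigD1 i) //= Mi mul0r mulr0.
have [i si] : exists i, s i != i.
  apply/existsP; apply: contraR s1; rewrite negb_exists => /forallP s1.
  by apply/eqP/permP => i; rewrite perm1; apply/eqP; have := s1 i; rewrite negbK.
have [/existsP[j /eqP Mj]|] := boolP [exists j, choice_mx f j (s j) == 0].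
  by exists j.
rewrite negb_exists => /forallP nz.
have [| |r fr Qr] := forest_iter fF (x := enum_val i)
   (Q := fun x => s (enum_rank x) != enum_rank x).
- by rewrite enum_valK.
- move=> x y Qx fx; have := nz (enum_rank x); rewrite mxE /choice_row enum_rankK fx.
  rewrite (forest_edge fF fx) [_ == s _]eq_sym (negPf Qx) subr0.
  case: (eqVneq (enum_val (s (enum_rank x))) y) => [<- _|_]; last by rewrite eqxx.
  by rewrite enum_valK (inj_eq perm_inj).
have := nz (enum_rank r); rewrite mxE /choice_row enum_rankK fr.
by rewrite [_ == s _]eq_sym (negPf Qr) eqxx.
Qed.

(** When [f] is not a forest, the indicator of the vertices that never reach a
    root is a null vector. *)
Lemma det_not_forest f : ~~ forest (@adj G) f -> \det (choice_mx f) = 0.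
Proof.
move=> nF; have [bad|] := boolP [exists x, if f x is Some y then ~~ adj x y else false].
  have [x] := existsP bad; case fx: (f x) => [y|//] xy.
  rewrite (expand_det_row _ (enum_rank x)) big1 // => j _.
  by rewrite mxE /choice_row enum_rankK fx (negPf xy) mul0r.
rewrite negb_exists => /forallP good.
have [x nx] : exists x, ~~ reaches_root f x.
  apply/existsP; apply: contraR nF; rewrite negb_exists => /forallP all_r.
  apply/forallP => x; have := all_r x; rewrite negbK => -> /=.
  by have := good x; case: (f x) => // y; rewrite negbK.
pose w y : {poly algC} := (~~ reaches_root f y)%:R.
apply: (@det_kernel _ _ _ (\col_j w (enum_val j)) (enum_rank x)); last first.
  by rewrite mxE enum_rankK /w nx oner_eq0.
apply/colP => i; rewrite !mxE; under eq_bigr => j _ do rewrite !mxE.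
case fi: (f (enum_val i)) => [y|] /=.
  have := good (enum_val i); rewrite fi negbK => -> /=.
  under eq_bigr => j _ do rewrite mulrBl.
  rewrite sumrB (bigD1 (enum_rank y)) //= enum_rankK eqxx mul1r big1 ?addr0.
    rewrite (bigD1 i) //= eqxx mul1r big1 ?addr0.
      rewrite /w -[in X in _ - X]reaches_root_parent /parent fi.
      by rewrite subrr.
    by move=> j /negPf; rewrite eq_sym => ->; rewrite mul0r.
  move=> j jy; case: (eqVneq (enum_val j) y) => [E|]; last by rewrite mul0r.
  by case/eqP: jy; rewrite -E enum_valK.
rewrite (bigD1 i) //= eqxx big1 ?addr0.
  have -> : w (enum_val i) = 0; last by rewrite mulr0.
  rewrite /w (_ : reaches_root _ _) //; apply/existsP.
  by exists (enum_val i); rewrite connect0 fi.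
by move=> j /negPf; rewrite eq_sym => ->; rewrite mul0r.
Qed.

(** A forest with [k] roots contributes ['X^k] up to sign, so the linear coefficient
    counts the forests with one root: the spanning trees with a distinguished
    vertex. *)
Theorem matrix_tree :
  (char_poly (laplacian_mx G))`_1 =
  (-1) ^+ #|G|.-1 * (#|G| * #|spanning_trees G|)%:R.
Proof.
have -> : (#|G| * #|spanning_trees G|)%N =
    #|[set f : {ffun G -> option G} | forest (@adj G) f & #|forest_roots f| == 1%N]|.
  rewrite -card_arborescences.
  under [RHS]eq_bigr => r _ do rewrite card_rooted_trees.
  by rewrite sum_nat_const.
rewrite char_laplacian_sum coef_sum -sum1_card natr_sum mulr_sumr.
rewrite [RHS]big_mkcond /=; apply: eq_bigr => f _; rewrite inE.
have [fF|nF] := boolP (forest _ f); last by rewrite det_not_forest ?coef0.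
rewrite det_forest // ['X ^+ _ * _]mulrC coefMXn /= mulr1; case: eqP => [E|ne].
  rewrite E /= subnn -(cardC (mem (forest_roots f))) E /=.
  rewrite (_ : #|~: forest_roots f| = #|[predC forest_roots f]|).
    by elim: #|_| => [|k IH]; rewrite ?expr0 ?coef1 // !exprS !mulN1r coefN IH.
  by apply: eq_card => x; rewrite !inE.
case: ltnP => // le1.
have: #|forest_roots f| = 0%N by case: #|_| le1 ne => [|[|]].
move=> r0; have [x _|G0] := pickP G.
  have [r fr _] := forest_iter fF (x := x) (Q := predT) isT (fun _ _ _ _ => isT).
  by have := cards0_eq r0 => /setP/(_ r); rewrite !inE fr.
rewrite r0 (_ : #|~: _| = 0%N) ?expr0 ?coef1 //.
by apply/eqP; rewrite cards_eq0; apply/eqP/setP => x; have := G0 x.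
Qed.

End MatrixTree.

Lemma laplacian_cospectral_trees (G H : sgraph) :
  0 < #|G| -> #|G| = #|H| -> laplacian_cospectral G H ->
  #|spanning_trees G| = #|spanning_trees H|.
Proof.
move=> G0 GH LGH.
have E : char_poly (laplacian_mx G) = char_poly (laplacian_mx H).
  by rewrite !spectrumE; apply: perm_big.
have := congr1 (fun p : {poly algC} => (p`_1)%R) E.
rewrite /= !matrix_tree -GH => /mulfI E1; have /eqP := E1 (negbT (signr_eq0 _ _)).
by rewrite eqr_nat eqn_pmul2l // => /eqP.
Qed.

(** * Isomorphism invariance of the genus polynomial *)

Section Transport.
Variables (G H : sgraph) (h : G -> H) (h' : H -> G).
Hypotheses (hK : cancel h h') (h'K : cancel h' h).
Hypothesis h_adj : forall x y, adj (h x) (h y) = adj x y.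

Lemma transport_perm_inj (s : {perm G}) : injective (fun y => h (s (h' y))).
Proof. by move=> x y /(can_inj hK)/perm_inj/(can_inj h'K). Qed.

Definition transport_perm (s : {perm G}) : {perm H} := perm (@transport_perm_inj s).

Definition transport_rot (rho : {ffun G -> {perm G}}) : {ffun H -> {perm H}} :=
  [ffun y => transport_perm (rho (h' y))].

Lemma transport_permE s x : transport_perm s (h x) = h (s x).
Proof. by rewrite permE hK. Qed.

Lemma transport_porbit s x y :
  (h y \in porbit (transport_perm s) (h x)) = (y \in porbit s x).
Proof.
have E i : (transport_perm s ^+ i)%g (h x) = h ((s ^+ i)%g x).
  by elim: i => [|i IH]; rewrite ?expg0 ?perm1 // !expgSr !permM IH transport_permE.
apply/porbitP/porbitP => -[i]; rewrite ?E; first by move/(can_inj hK); exists i.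
by move=> ->; exists i; rewrite E.
Qed.

Lemma transport_nbhd x y : (h y \in nbhd (h x)) = (y \in nbhd x).
Proof. by rewrite !inE h_adj. Qed.

Lemma transport_rotation_system rho :
  rotation_system rho -> rotation_system (transport_rot rho).
Proof.
move=> /forallP rs; apply/forallP => y; rewrite -(h'K y) ffunE hK.
move: {y}(h' y) => x; have /andP[on_x /forallP orb_x] := rs x.
apply/andP; split.
  apply/subsetP => y; rewrite -(h'K y) inE transport_permE (can_eq hK) => my.
  by rewrite transport_nbhd; apply: (subsetP on_x); rewrite inE.
apply/forallP => y; rewrite -(h'K y) transport_nbhd; apply/implyP => yx.
have /implyP/(_ yx)/eqP orb := orb_x (h' y).
apply/eqP/setP => z; rewrite -(h'K z) transport_porbit orb.
by rewrite !inE h_adj.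
Qed.

Lemma transport_num_faces rho : rotation_system rho ->
  num_faces (transport_rot rho) = num_faces rho.
Proof.
move=> rs; have rs' := transport_rotation_system rs.
pose h2 (d : G * G) : H * H := (h d.1, h d.2).
have h2_inj : injective h2 by move=> [a b] [c d] [/(can_inj hK)-> /(can_inj hK)->].
have fE d : face_map (transport_rot rho) (h2 d) = h2 (face_map rho d).
  by rewrite /face_map /h2 /= ffunE hK transport_permE.
have sym (K : sgraph) (r : {ffun K -> {perm K}}) :
    fconnect (face_map r) =2 fun x y => fconnect (face_map r) y x.
  by move=> x y; apply: fconnect_sym; apply: face_map_inj.
rewrite /num_faces (@adjunction_n_comp _ _ h2 _ (frel (face_map rho))).
- by apply: eq_n_comp_r => d; rewrite !inE /= h_adj.
- exact: sym.
- exact: sym.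
- exact: darts_closed.
apply: strict_adjunction => //.
- exact: sym.
- exact: darts_closed.
- by apply/subsetP => -[y z] _; apply/codomP; exists (h' y, h' z); rewrite /h2 /= !h'K.
by move=> d d' _; rewrite /= fE (inj_eq h2_inj).
Qed.

End Transport.

Lemma genus_poly_iso (G H : sgraph) (h : G -> H) :
  bijective h -> (forall x y, adj (h x) (h y) = adj x y) ->
  genus_poly G = genus_poly H.
Proof.
move=> [h' hK h'K] h_adj.
have h'_adj x y : adj (h' x) (h' y) = adj x y by rewrite -h_adj !h'K.
have card_GH : #|G| = #|H| := bij_eq_card (Bijective hK h'K).
have tK : cancel (transport_rot hK h'K) (transport_rot h'K hK).
  move=> rho; apply/ffunP => x; apply/permP => y; rewrite ffunE permE ffunE permE.
  by rewrite !hK.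
have t'K : cancel (transport_rot h'K hK) (transport_rot hK h'K).
  move=> rho; apply/ffunP => x; apply/permP => y; rewrite ffunE permE ffunE permE.
  by rewrite !h'K.
rewrite /genus_poly [RHS](reindex_onto _ _ (fun rho _ => t'K rho)) /=.
apply: eq_big => rho.
  rewrite tK eqxx andbT; apply/idP/idP; first exact: transport_rotation_system.
  by move=> /(transport_rotation_system h'K hK h'_adj); rewrite tK.
by move=> rs; rewrite /genus card_GH (transport_num_faces hK h'K h_adj rs).
Qed.

(** * Cubic graphs as tables of neighbours *)

Definition table := seq (seq nat).

Definition row (t : table) (i : nat) : seq nat := nth [::] t i.

Fixpoint memn (x : nat) (s : seq nat) : bool :=
  if s is y :: s' then eqn x y || memn x s' else false.

Definition adjb (t : table) (i j : nat) : bool := memn j (row t i).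

Fixpoint upd (T : Type) (i : nat) (f : T -> T) (s : seq T) : seq T :=
  match s, i with
  | x :: s', 0 => f x :: s'
  | x :: s', i'.+1 => x :: upd i' f s'
  | [::], _ => [::]
  end.

Definition repl (x y : nat) (s : seq nat) : seq nat :=
  [seq if eqn z x then y else z | z <- s].

(** The edges [a b] and [c d] are subdivided and the two new vertices joined. *)
Definition ins_edge (t : table) (a b c d : nat) : table :=
  let n := size t in
  upd d (repl c n.+1) (upd c (repl d n.+1) (upd b (repl a n) (upd a (repl b n) t)))
    ++ [:: [:: a; b; n.+1]; [:: c; d; n]].

(** The edge [e f] is replaced by a path through the two tips of a diamond
    (the complete graph on four vertices without an edge). *)
Definition ins_diamond (t : table) (e f : nat) : table :=
  let n := size t in
  upd f (repl e n.+3) (upd e (repl f n) t) ++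
    [:: [:: e; n.+1; n.+2]; [:: n; n.+2; n.+3]; [:: n; n.+1; n.+3];
        [:: f; n.+1; n.+2]].

Definition add_K4 (t : table) : table :=
  let n := size t in
  t ++ [:: [:: n.+1; n.+2; n.+3]; [:: n; n.+2; n.+3]; [:: n; n.+1; n.+3];
           [:: n; n.+1; n.+2]].

Definition edge_list (t : table) : seq (nat * nat) :=
  flatten [seq [seq (i, j) | j <- row t i & ltn i j] | i <- iota 0 (size t)].

Fixpoint pairs (T : Type) (s : seq T) : seq (T * T) :=
  if s is x :: s' then [seq (x, y) | y <- s'] ++ pairs s' else [::].

Definition edge_insertions (t : table) : seq table :=
  [seq ins_edge t q.1.1 q.1.2 q.2.1 q.2.2 | q <- pairs (edge_list t)].

Definition diamond_insertions (t : table) : seq table :=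
  add_K4 t :: [seq ins_diamond t e.1 e.2 | e <- edge_list t].

(** The arguments list the cubic graphs with two and with four vertices less. *)
Definition extensions (A B : seq table) : seq table :=
  flatten (map edge_insertions A) ++ flatten (map diamond_insertions B).

(** * Walk counts and isomorphism of tables *)

Fixpoint add3 (x y z : seq N) : seq N :=
  match x, y, z with
  | a :: x', b :: y', c :: z' => N.add a (N.add b c) :: add3 x' y' z'
  | _, _, _ => [::]
  end.

Definition walk_step (t : table) (M : seq (seq N)) : seq (seq N) :=
  [seq if r is [:: a; b; c]
       then add3 (nth [::] M a) (nth [::] M b) (nth [::] M c) else [::] | r <- t].

Definition walk_id (t : table) : seq (seq N) :=
  let n := size t in
  [seq [seq if eqn i j then 1%num else 0%num | j <- iota 0 n] | i <- iota 0 n].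

Fixpoint walk_tables (t : table) (k : nat) (M : seq (seq N)) : seq (seq (seq N)) :=
  if k is k'.+1 then M :: walk_tables t k' (walk_step t M) else [::].

Fixpoint dotN (x y : seq N) : N :=
  match x, y with
  | a :: x', b :: y' => N.add (N.mul a b) (dotN x' y')
  | _, _ => 0%num
  end.

(** The closed walks of lengths 4, 5 and 6 at each vertex, combined in one number.
    An isomorphism preserves these, which prunes the search for it. *)
Definition signatures (t : table) : seq N :=
  let M1 := walk_step t (walk_id t) in
  let M2 := walk_step t M1 in
  let M3 := walk_step t M2 in
  [seq N.add (dotN q.2 q.2) (N.mul 64%num
         (N.add (dotN q.1 q.2) (N.mul 64%num (dotN q.1 q.1)))) | q <- zip M2 M3].

Definition signature_key (s : seq N) : N :=
  foldr (fun x a => N.add (N.mul x x) a) 0%num s.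

Definition orders3 (s : seq nat) : seq (seq nat) :=
  if s is [:: a; b; c] then
    [:: [:: a; b; c]; [:: a; c; b]; [:: b; a; c]; [:: b; c; a]; [:: c; a; b];
        [:: c; b; a]]
  else [::].

Fixpoint first_some (S T : Type) (f : S -> option T) (s : seq S) : option T :=
  if s is x :: s' then if f x is Some y then Some y else first_some f s'
  else None.

Fixpoint find0 (m : seq nat) : option nat :=
  match m with
  | [::] => None
  | 0 :: _ => Some 0
  | _ :: m' => if find0 m' is Some i then Some i.+1 else None
  end.

(** Without this early comparison the search would follow a wrong match of one
    neighbour to its end before it looks at the next. *)
Fixpoint fits (s1 s2 : seq N) (m xs ys : seq nat) : bool :=
  match xs, ys with
  | x :: xs', y :: ys' =>
      if (if nth 0 m x is z.+1 then eqn z y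
          else N.eqb (nth 0%num s1 x) (nth 0%num s2 y))
      then fits s1 s2 m xs' ys' else false
  | _, _ => true
  end.

(** Backtracking search for an isomorphism from [t1] to [t2]. The list [m]
    holds the successors of the images found so far, and 0 elsewhere; the
    pairs in [todo] remain to be matched. *)
Fixpoint iso_search (t1 t2 : table) (s1 s2 : seq N) (fuel : nat)
    (todo : seq (nat * nat)) (m : seq nat) : option (seq nat) :=
  if fuel is k.+1 then
    match todo with
    | [::] =>
        if find0 m is Some x then
          first_some (fun y => iso_search t1 t2 s1 s2 k [:: (x, y)] m)
            (iota 0 (size t1))
        else Some (map predn m)
    | (x, y) :: todo' =>
        if nth 0 m x is z.+1 then
          if eqn z y then iso_search t1 t2 s1 s2 k todo' m else None
        else if memn y.+1 m then None
        else if N.eqb (nth 0%num s1 x) (nth 0%num s2 y) then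
          let m' := upd x (fun=> y.+1) m in
          first_some (fun r =>
              iso_search t1 t2 s1 s2 k (zip (row t1 x) r ++ todo') m')
            [seq r <- orders3 (row t2 y) | fits s1 s2 m' (row t1 x) r]
        else None
    end
  else None.

(** Verifies the outcome of the search; [q] lists the images in [c] of the vertices
    of [g]. *)
Definition iso_check (q : seq nat) (g c : table) : bool :=
  let n := size c in
  [&& eqn (size g) n, eqn (size q) n, all (memn^~ q) (iota 0 n) &
   all (fun k =>
      let r := row c (nth 0 q k) in let m := map (nth 0 q) (row g k) in
      [&& eqn (size m) (size r), all (memn^~ m) r & all (fun j => ltn j n) (row g k)])
     (iota 0 n)].

Definition keyed := (N * (seq N * table))%type.

Definition keyed_iso (g c : keyed) : bool :=
  if N.eqb g.1 c.1 then
    if iso_search g.2.2 c.2.2 g.2.1 c.2.1 (16 * size c.2.2) [::] (nseq (size c.2.2) 0)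
      is Some q then iso_check q g.2.2 c.2.2 else false
  else false.

Definition insert_table (t : table) (L : seq keyed) : seq keyed :=
  let s := signatures t in let c := (signature_key s, (s, t)) in
  if has (keyed_iso^~ c) L then L else c :: L.

Definition remove_copies (s : seq table) : seq table :=
  [seq c.2.2 | c <- foldr insert_table [::] s].

(** The cubic graphs on [2 * m] and on [2 * m - 2] vertices. *)
Fixpoint cubic_tables (m : nat) : seq table * seq table :=
  if m is k.+1 then
    let: (A, B) := cubic_tables k in (remove_copies (extensions A B), A)
  else ([:: [::]], [::]).

Lemma memnE x s : memn x s = (x \in s).
Proof. by elim: s => //= y s ->; rewrite inE eqnE. Qed.

Lemma adjbE t i j : adjb t i j = (j \in row t i).
Proof. exact: memnE. Qed.

(** The test for the vertex is part of the substitution, so that one map rewires the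
    neighbourhoods of all vertices [x]. *)
Definition swap_if (T : eqType) (k a y x z : T) : T :=
  if (x == k) && (z == a) then y else z.

Section SwapIf.
Variable T : eqType.
Implicit Types (k a y x z : T) (L : seq T).

Lemma swap_if_hit k a y : swap_if k a y k a = y.
Proof. by rewrite /swap_if !eqxx. Qed.

Lemma swap_if_key k a y x z : x != k -> swap_if k a y x z = z.
Proof. by rewrite /swap_if => /negPf ->. Qed.

Lemma swap_if_val k a y x z : z != a -> swap_if k a y x z = z.
Proof. by rewrite /swap_if andbC => /negPf ->. Qed.

Lemma swap_ifK k a y x L : (x == k -> y \notin L) ->
  map (swap_if k y a x) (map (swap_if k a y x) L) = L.
Proof.
move=> yL; rewrite -map_comp -[RHS]map_id; apply/eq_in_map => z zL.
rewrite /swap_if /=; case: (eqVneq x k) yL => //= _ /(_ isT) yL.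
case: (eqVneq z a) => [->|_]; first by rewrite eqxx.
by case: eqP zL yL => // -> ->.
Qed.

Lemma swap_if_uniq k a y x L : (x == k -> y \notin L) ->
  uniq (map (swap_if k a y x) L) = uniq L.
Proof.
move=> yL; apply/idP/idP => [/map_uniq //|uL].
rewrite map_inj_in_uniq // => z w zL wL; rewrite /swap_if.
case: (eqVneq x k) yL => //= _ /(_ isT) yL.
case: (eqVneq z a) => [->|_]; case: (eqVneq w a) => [->|_] // E.
  by rewrite E wL in yL.
by rewrite -E zL in yL.
Qed.

Lemma mem_swap_if k a y x L z :
  (z \in map (swap_if k a y x) L) =
  if (x == k) && (a \in L) then (z == y) || (z \in L) && (z != a) else z \in L.
Proof.
rewrite /swap_if; case: (eqVneq x k) => /= _; last by rewrite map_id.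
case: ifP => [aL|aL]; last first.
  rewrite -[in RHS](map_id L); congr (_ \in _); apply/eq_in_map => w wL.
  by case: eqP => // wa; rewrite -wa wL in aL.
apply/mapP/orP => [[w wL ->]|[/eqP->|/andP[zL /negPf za]]].
- by case: (eqVneq w a) => [_|wa]; [left|right; rewrite wL wa].
- by exists a; rewrite ?eqxx.
by exists z; rewrite ?za.
Qed.

End SwapIf.

Lemma row_upd_repl k a y t i :
  row (upd k (repl a y) t) i = map (swap_if k a y i) (row t i).
Proof.
have id_map c z0 L : (c == z0) = false -> map (swap_if z0 a y c) L = L.
  by move=> E; rewrite -[RHS]map_id; apply: eq_map => z; rewrite /swap_if E.
rewrite /row; elim: t k i => [|r t IH] [|k] [|i] //=.
- by rewrite id_map.
- by rewrite id_map.
by rewrite IH; apply: eq_map => z; rewrite /swap_if eqSS.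
Qed.

Lemma size_upd (T : Type) k (f : T -> T) s : size (upd k f s) = size s.
Proof. by elim: s k => [|x s IH] [|k] //=; rewrite IH. Qed.

Section Realize.
Variables (V : eqType) (x0 : V).
Implicit Types (S p : seq V) (N M : V -> seq V) (t : table).

(** A cubic graph with vertex list [S] and neighbour lists [N]. The reductions
    remove vertices and rewire others; on lists this changes only values. *)
Record cubic_on S N : Prop := CubicOn {
  cubic_uniq : uniq S;
  cubic_size : forall x, x \in S -> size (N x) = 3;
  cubic_nbr_uniq : forall x, x \in S -> uniq (N x);
  cubic_irr : forall x, x \in S -> x \notin N x;
  cubic_sub : forall x y, x \in S -> y \in N x -> y \in S;
  cubic_sym : forall x y, x \in S -> y \in N x -> x \in N y }.

(** The vertex with label [i] is the [i]-th entry of [p]. *)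
Record labels t S N p : Prop := Labels {
  labels_perm : perm_eq p S;
  labels_size : size p = size t;
  labels_bound : forall i, i < size t -> all (gtn (size t)) (row t i);
  labels_row : forall i, i < size t ->
    perm_eq (map (nth x0 p) (row t i)) (N (nth x0 p i)) }.

Definition realizes t S N : Prop := exists p, labels t S N p.

Section Labelled.
Variables (t : table) (S : seq V) (N : V -> seq V) (p : seq V).
Hypotheses (cN : cubic_on S N) (lp : labels t S N p).

Lemma labels_uniq : uniq p.
Proof. by rewrite (perm_uniq (labels_perm lp)) (cubic_uniq cN). Qed.

Lemma labels_mem x : (x \in p) = (x \in S).
Proof. exact: perm_mem (labels_perm lp) x. Qed.

Lemma labels_nth i : i < size t -> nth x0 p i \in S.
Proof. by move=> lti; rewrite -labels_mem mem_nth // (labels_size lp). Qed.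

Lemma labels_index x : x \in S -> index x p < size t.
Proof. by rewrite -labels_mem -index_mem (labels_size lp). Qed.

Lemma labels_nthK x : x \in S -> nth x0 p (index x p) = x.
Proof. by rewrite -labels_mem; apply: nth_index. Qed.

Lemma row_bound i j : i < size t -> j \in row t i -> j < size t.
Proof. by move=> lti; move/allP: (labels_bound lp lti) => /[apply]. Qed.

Lemma mem_row_index x y : x \in S -> y \in S ->
  (index y p \in row t (index x p)) = (y \in N x).
Proof.
move=> xS yS; have := perm_mem (labels_row lp (labels_index xS)) y.
rewrite labels_nthK // => <-; apply/idP/mapP => [yr|[j jr ->]].
  by exists (index y p); rewrite ?labels_nthK.
have ltj := row_bound (labels_index xS) jr.
by rewrite index_uniq ?labels_uniq ?(labels_size lp).
Qed.

Lemma index_inj_on x y : x \in S -> y \in S -> (index x p == index y p) = (x == y).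
Proof.
move=> xS yS; apply/eqP/eqP => [E|-> //].
by rewrite -(labels_nthK xS) E labels_nthK.
Qed.

Lemma labels_row_uniq i : i < size t -> uniq (row t i).
Proof.
move=> lti; apply: (@map_uniq _ _ (nth x0 p)).
by rewrite (perm_uniq (labels_row lp lti)) (cubic_nbr_uniq cN) ?labels_nth.
Qed.

Lemma labels_row_size i : i < size t -> size (row t i) = 3.
Proof.
move=> lti; rewrite -(size_map (nth x0 p)) (perm_size (labels_row lp lti)).
by rewrite (cubic_size cN) ?labels_nth.
Qed.

Lemma mem_edge_list i j :
  ((i, j) \in edge_list t) = [&& i < size t, j \in row t i & i < j].
Proof.
apply/flatten_mapP/and3P => [[k]|[lti jr ltij]].
  rewrite mem_iota /= => ltk /mapP[l]; rewrite mem_filter => /andP[lt lr] [-> ->].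
  by [].
exists i; first by rewrite mem_iota.
by apply/mapP; exists j; rewrite // mem_filter /= ltij.
Qed.

End Labelled.

Lemma labels_eq t S N M p : (forall x, x \in S -> perm_eq (N x) (M x)) ->
  labels t S N p -> labels t S M p.
Proof.
move=> NM [pp sp bp rp]; split=> // i lti; apply: perm_trans (rp i lti) (NM _ _).
by rewrite -(perm_mem pp) mem_nth ?sp.
Qed.

End Realize.

(** * Reducing a cubic graph by two vertices *)

Lemma last_two n i : n <= i -> i < n.+2 -> i = n \/ i = n.+1.
Proof. by move=> *; lia. Qed.

Section EdgeReduction.
Variables (V : eqType) (x0 : V) (S : seq V) (N : V -> seq V).
Hypothesis cN : cubic_on S N.

(** The edge [u v] can be deleted, with [u] and [v] suppressed, without
    creating a loop or a double edge. *)
Record reducible (u v a b c d : V) : Prop := Reducible {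
  red_u : u \in S;
  red_v : v \in S;
  red_Nu : perm_eq (N u) [:: a; b; v];
  red_Nv : perm_eq (N v) [:: c; d; u];
  red_ab : b \notin N a;
  red_cd : d \notin N c;
  red_ac : ~~ ((a == c) && (b == d));
  red_ad : ~~ ((a == d) && (b == c)) }.

Lemma cubic_symE x y : x \in S -> y \in S -> (x \in N y) = (y \in N x).
Proof. by move=> xS yS; apply/idP/idP; apply: (cubic_sym cN). Qed.

Lemma nbrs3 x a b c : x \in S -> perm_eq (N x) [:: a; b; c] ->
  [/\ [/\ a \in S, b \in S & c \in S], [/\ a != b, a != c & b != c],
      [/\ x != a, x != b & x != c] & forall y, (y \in N x) = [|| y == a, y == b | y == c]].
Proof.
move=> xS pN; have E y : (y \in N x) = [|| y == a, y == b | y == c].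
  by rewrite (perm_mem pN) !inE.
have sub y : y \in N x -> y \in S := cubic_sub cN xS.
have irr y : y \in N x -> x != y.
  by apply: contraTneq => <-; apply: (cubic_irr cN).
have := cubic_nbr_uniq cN xS; rewrite (perm_uniq pN) /= !inE negb_or andbT.
move=> /andP[/andP[ab ac] bc].
by split=> //; split=> //; first [apply: sub|apply: irr]; rewrite E eqxx ?orbT.
Qed.

Lemma reducible_swap_l u v a b c d : reducible u v a b c d -> reducible u v b a c d.
Proof.
case=> uS vS Nu Nv ab cd ac ad.
have [[aS bS _] _ _ _] := nbrs3 uS Nu.
split=> //; try by rewrite andbC.
  by apply: perm_trans Nu _; apply/seq.permP => P; rewrite /= addnCA.
by rewrite cubic_symE.
Qed.

Lemma reducible_swap_r u v a b c d : reducible u v a b c d -> reducible u v a b d c.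
Proof.
case=> uS vS Nu Nv ab cd ac ad.
have [[cS dS _] _ _ _] := nbrs3 vS Nv.
split=> //.
  by apply: perm_trans Nv _; apply/seq.permP => P; rewrite /= addnCA.
by rewrite cubic_symE.
Qed.

Lemma reducible_swap u v a b c d : reducible u v a b c d -> reducible v u c d a b.
Proof.
by case=> uS vS Nu Nv ab cd ac ad; split=> //; rewrite ![c == _]eq_sym ![d == _]eq_sym // andbC.
Qed.

Section Smooth.
Variables u v a b c d : V.
Hypothesis red : reducible u v a b c d.

Definition smooth_support : seq V := [seq x <- S | x \notin [:: u; v]].

(** The substitutions that [ins_edge] makes in the rows, undone in reverse order. *)
Definition smooth_nbrs (x : V) : seq V :=
  map (swap_if a u b x) (map (swap_if b u a x)
    (map (swap_if c v d x) (map (swap_if d v c x) (N x)))).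

Let uS := red_u red.
Let vS := red_v red.
Let factsu := nbrs3 uS (red_Nu red).
Let factsv := nbrs3 vS (red_Nv red).

Lemma mem_support x : (x \in smooth_support) = [&& x \in S, x != u & x != v].
Proof. by rewrite mem_filter !inE negb_or andbC. Qed.

Lemma mem_smooth_nbrs x z : x \in smooth_support ->
  (z \in smooth_nbrs x) =
  [|| [&& z \in N x, z != u & z != v], (x == a) && (z == b), (x == b) && (z == a),
      (x == c) && (z == d) | (x == d) && (z == c)].
Proof.
rewrite mem_support => /and3P[xS xu xv].
have [[aS bS _] [ab av bv] [ua ub uv] Nu] := factsu.
have [[cS dS _] [cd cu du] [vc vd vu] Nv] := factsv.
have uN : (u \in N x) = (x == a) || (x == b).
  by rewrite cubic_symE // Nu (negPf xv) orbF.
have vN : (v \in N x) = (x == c) || (x == d).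
  by rewrite cubic_symE // Nv (negPf xu) orbF.
rewrite /smooth_nbrs -!map_comp.
pose sg y := if y == u then if x == a then b else if x == b then a else y
  else if y == v then if x == c then d else if x == d then c else y else y.
have -> : z \in map (swap_if a u b x \o swap_if b u a x \o swap_if c v d x \o
   swap_if d v c x) (N x) = (z \in map sg (N x)).
  have ba : b != a by rewrite eq_sym.
  have dc : d != c by rewrite eq_sym.
  congr (_ \in _); apply/eq_in_map => y yN; rewrite /sg /=.
  case: (eqVneq y u) => [->|yu].
    rewrite (swap_if_val d) // (swap_if_val c) //.
    have [->|xb] := eqVneq x b; first by rewrite swap_if_hit swap_if_key ?(negPf ba).
    rewrite (swap_if_key _ _ _ xb); have [->|xa] := eqVneq x a.
      by rewrite swap_if_hit.
    by rewrite swap_if_key.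
  case: (eqVneq y v) => [->|yv]; last by rewrite !swap_if_val.
  have [->|xd] := eqVneq x d.
    rewrite swap_if_hit (swap_if_key _ _ _ dc) (negPf dc).
    by rewrite !swap_if_val // eq_sym.
  rewrite (swap_if_key _ _ _ xd); have [->|xc] := eqVneq x c.
    by rewrite swap_if_hit !swap_if_val // eq_sym.
  by rewrite (swap_if_key _ _ _ xc) !swap_if_val // eq_sym.
apply/mapP/idP => [[y yN ->{z}]|].
  rewrite /sg; case: (eqVneq y u) yN => [->|yu].
    rewrite uN => /orP[]/eqP->; rewrite !eqxx ?orbT //.
    by rewrite [b == a]eq_sym (negPf ab) eqxx !orbT.
  case: (eqVneq y v) => [->|yv yN]; last by rewrite yN yu yv.
  rewrite vN => /orP[]/eqP->; rewrite !eqxx ?orbT //.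
  by rewrite [d == c]eq_sym (negPf cd) eqxx !orbT.
case/or4P=> [/and3P[zN zu zv]|||/orP[]].
- by exists z => //; rewrite /sg (negPf zu) (negPf zv).
- case/andP=> /eqP xa /eqP ->; exists u; first by rewrite uN xa eqxx.
  by rewrite /sg xa !eqxx.
- case/andP=> /eqP xb /eqP ->; exists u; first by rewrite uN xb eqxx orbT.
  by rewrite /sg xb eqxx [b == a]eq_sym (negPf ab) eqxx.
- case/andP=> /eqP xc /eqP ->; exists v; first by rewrite vN xc eqxx.
  by rewrite /sg xc [v == u]eq_sym (negPf uv) !eqxx.
case/andP=> /eqP xd /eqP ->; exists v; first by rewrite vN xd eqxx orbT.
by rewrite /sg xd [v == u]eq_sym (negPf uv) eqxx [d == c]eq_sym (negPf cd) eqxx.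
Qed.

(** No substitution meets a vertex that it would bring in, which makes each of
    them invertible. This uses that [reducible] excludes double edges. *)
Lemma smooth_fresh x : x \in smooth_support ->
  [/\ x == d -> c \notin N x, x == c -> d \notin map (swap_if d v c x) (N x),
      x == b -> a \notin map (swap_if c v d x) (map (swap_if d v c x) (N x))
    & x == a -> b \notin map (swap_if b u a x)
                  (map (swap_if c v d x) (map (swap_if d v c x) (N x)))].
Proof.
rewrite mem_support => /and3P[xS xu xv].
have [[aS bS _] [ab av bv] [ua ub uv] Nu] := factsu.
have [[cS dS _] [cd cu du] [vc vd vu] Nv] := factsv.
have cdN : c \notin N d by rewrite cubic_symE // (red_cd red).
have abN : a \notin N b by rewrite cubic_symE // (red_ab red).
have := red_ac red; have := red_ad red; have := red_ab red; have := red_cd red.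
move=> dcN baN ad ac.
have Ec y : y \notin N x -> (x == d -> y != c) -> (x == c -> y != d) ->
    y \notin map (swap_if c v d x) (map (swap_if d v c x) (N x)).
  move=> yN ydc ycd.
  have yI : y \notin map (swap_if d v c x) (N x).
    rewrite mem_swap_if; case: ifP => // /andP[/ydc/negPf -> _].
    by rewrite (negPf yN).
  rewrite mem_swap_if; case: ifP => // /andP[/ycd/negPf -> _].
  by rewrite (negPf yI).
split=> [/eqP xd|/eqP xc|/eqP xb|/eqP xa].
- by rewrite xd.
- by rewrite xc mem_swap_if (negPf cd).
- apply: Ec; rewrite xb // => E; first by apply: contraNneq ac => ->; rewrite eqxx.
  by apply: contraNneq ad => ->; rewrite eqxx.
rewrite mem_swap_if {1}xa (negPf ab) /=; apply: Ec; rewrite xa // => E.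
  by apply: contraNneq ad => ->; rewrite E eqxx.
by apply: contraNneq ac => ->; rewrite E eqxx.
Qed.

Lemma smooth_uniq x : x \in smooth_support -> uniq (smooth_nbrs x).
Proof.
move=> xS'; have [f1 f2 f3 f4] := smooth_fresh xS'.
rewrite !swap_if_uniq //; apply: (cubic_nbr_uniq cN).
by move: xS'; rewrite mem_support => /andP[].
Qed.

Lemma smooth_cubic : cubic_on smooth_support smooth_nbrs.
Proof.
have [[aS bS _] [ab av bv] [ua ub uv] Nu] := factsu.
have [[cS dS _] [cd cu du] [vc vd vu] Nv] := factsv.
have memS x : x \in smooth_support -> x \in S by rewrite mem_support => /andP[].
have sub x y : x \in smooth_support -> y \in smooth_nbrs x -> y \in smooth_support.
  move=> xS'; rewrite mem_smooth_nbrs // mem_support.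
  case/or4P=> [/and3P[yN -> ->]|/andP[_ /eqP->]|/andP[_ /eqP->]|/orP[]/andP[_ /eqP->]].
  + by rewrite andbT (cubic_sub cN (memS _ xS') yN).
  + by rewrite bS eq_sym ub.
  + by rewrite aS eq_sym ua.
  + by rewrite dS du eq_sym vd.
  by rewrite cS cu eq_sym vc.
split.
- exact/filter_uniq/(cubic_uniq cN).
- by move=> x xS'; rewrite !size_map (cubic_size cN) ?memS.
- exact: smooth_uniq.
- move=> x xS'; rewrite mem_smooth_nbrs // (negPf (cubic_irr cN (memS _ xS'))) /=.
  apply/negP => /or3P[||/orP[]] /andP[/eqP-> E].
  + by rewrite E in ab.
  + by rewrite eq_sym E in ab.
  + by rewrite E in cd.
  by rewrite eq_sym E in cd.
- exact: sub.
move=> x y xS' yN.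
have yS' := sub _ _ xS' yN.
rewrite mem_smooth_nbrs // in yN; rewrite mem_smooth_nbrs //.
move: (xS'); rewrite mem_support => /and3P[_ -> ->].
case/or4P: yN => [/and3P[yN _ _]|/andP[-> ->]|/andP[-> ->]|/orP[]/andP[-> ->]]; rewrite ?orbT //.
by rewrite (cubic_sym cN (memS _ xS') yN).
Qed.

Lemma size_ins_edge t i j k l : size (ins_edge t i j k l) = (size t).+2.
Proof. by rewrite /ins_edge size_cat !size_upd addn2. Qed.

Lemma map_nth_swap p L k i y m :
  uniq p -> [&& k < size p, i < size p, y < size p & m < size p] ->
  all (gtn (size p)) L ->
  map (nth x0 p) (map (swap_if k i y m) L) =
    map (swap_if (nth x0 p k) (nth x0 p i) (nth x0 p y) (nth x0 p m)) (map (nth x0 p) L)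
  /\ all (gtn (size p)) (map (swap_if k i y m) L).
Proof.
move=> up /and4P[ltk lti lty ltm] /allP bL; split.
  rewrite -!map_comp; apply/eq_in_map => j /bL ltj.
  by rewrite /swap_if /= !nth_uniq //; case: ifP.
rewrite all_map; apply/allP => j /bL ltj.
by rewrite /swap_if /=; case: ifP.
Qed.

Lemma ins_edge_labels t p : labels x0 t smooth_support smooth_nbrs p ->
  labels x0 (ins_edge t (index a p) (index b p) (index c p) (index d p)) S N
    (p ++ [:: u; v]).
Proof.
move=> lp; have cM := smooth_cubic; have sp := labels_size lp.
have [[aS bS _] [ab av bv] [ua ub uv] Nu] := factsu.
have [[cS dS _] [cd cu du] [vc vd vu] Nv] := factsv.
set n := size t in sp; set p' := p ++ _.
have sp' : size p' = n.+2 by rewrite size_cat sp addn2.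
have inS x : x \in S -> x != u -> x != v -> x \in smooth_support.
  by move=> *; rewrite mem_support; apply/and3P.
have aS' : a \in smooth_support by rewrite inS // eq_sym.
have bS' : b \in smooth_support by rewrite inS // eq_sym.
have cS' : c \in smooth_support by rewrite inS // eq_sym.
have dS' : d \in smooth_support by rewrite inS // eq_sym.
have up' : uniq p'.
  rewrite cat_uniq (labels_uniq cM lp) /= !(labels_mem lp) !mem_support.
  by rewrite !eqxx /= !andbF /= inE uv.
have nthp i : i < n -> nth x0 p' i = nth x0 p i by rewrite nth_cat sp => ->.
have nthu : nth x0 p' n = u by rewrite nth_cat sp ltnn subnn.
have nthv : nth x0 p' n.+1 = v by rewrite nth_cat sp ltnNge leqnSn subSnn.
have idx x : x \in smooth_support -> index x p < n /\ nth x0 p' (index x p) = x.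
  by move=> xS'; have lt := labels_index lp xS'; rewrite nthp // (labels_nthK lp).
have [lta na] := idx a aS'; have [ltb nb] := idx b bS'.
have [ltc nc] := idx c cS'; have [ltd nd] := idx d dS'.
have lt2 i : i < n -> i < n.+2 by move=> lti; rewrite ltnW // ltnW.
set g := ins_edge _ _ _ _ _; have sg : size g = n.+2 by apply: size_ins_edge.
have stages i : i < n -> let x := nth x0 p' i in
    map (nth x0 p') (row g i) = map (swap_if d c v x) (map (swap_if c d v x)
      (map (swap_if b a u x) (map (swap_if a b u x) (map (nth x0 p') (row t i)))))
    /\ all (gtn n.+2) (row g i).
  move=> lti x; rewrite /row /g /ins_edge nth_cat !size_upd lti -/(row _ i) !row_upd_repl.
  have b0 : all (gtn (size p')) (row t i).
    by apply: sub_all (labels_bound lp lti) => j /=; rewrite sp'; apply: lt2.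
  have cond k j y : k < n -> j < n -> y < n.+2 ->
      [&& k < size p', j < size p', y < size p' & i < size p'].
    by move=> ltk ltj lty; rewrite sp' lty (lt2 _ ltk) (lt2 _ ltj) (lt2 _ lti).
  have [e1 b1] := map_nth_swap up' (cond _ _ _ lta ltb (ltnW (ltnSn n.+1))) b0.
  have [e2 b2] := map_nth_swap up' (cond _ _ _ ltb lta (ltnW (ltnSn n.+1))) b1.
  have [e3 b3] := map_nth_swap up' (cond _ _ _ ltc ltd (ltnSn n.+1)) b2.
  have [e4 b4] := map_nth_swap up' (cond _ _ _ ltd ltc (ltnSn n.+1)) b3.
  by rewrite sp' in b4; rewrite e4 e3 e2 e1 na nb nc nd nthu nthv.
have new_row k : row g (n + k) =
    nth [::] [:: [:: index a p; index b p; n.+1]; [:: index c p; index d p; n]] k.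
  by rewrite /row /g /ins_edge nth_cat !size_upd ltnNge leq_addr addKn.
split.
- apply: uniq_perm up' (cubic_uniq cN) _ => x.
  rewrite mem_cat (labels_mem lp) mem_support !inE.
  have [->|_] := eqVneq x u; first by rewrite orbT uS.
  have [->|_] := eqVneq x v; first by rewrite orbT vS.
  by rewrite /= !andbT orbF.
- by rewrite sp' sg.
- move=> i; rewrite sg => lti; case: (ltnP i n) => [lti'|gei].
    by case: (stages i lti').
  have [->|->] := last_two gei lti.
    by rewrite -[in row _ _](addn0 n) new_row /= (lt2 _ lta) (lt2 _ ltb) ltnSn.
  by rewrite -[in row _ _](addn1 n) new_row /= (lt2 _ ltc) (lt2 _ ltd) leqnSn.
move=> i; rewrite sg => lti; case: (ltnP i n) => [lti'|gei].
  have [-> _] := stages i lti'; set x := nth x0 p' i.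
  have -> : map (nth x0 p') (row t i) = map (nth x0 p) (row t i).
    by apply/eq_in_map => j jr; rewrite nthp // (row_bound lp lti' jr).
  have xS' : x \in smooth_support by rewrite /x nthp // (labels_nth lp).
  have [f1 f2 f3 f4] := smooth_fresh xS'.
  have := labels_row lp lti'; rewrite -nthp // -/x => pM.
  have := perm_map (swap_if d c v x) (perm_map (swap_if c d v x)
    (perm_map (swap_if b a u x) (perm_map (swap_if a b u x) pM))).
  by rewrite /smooth_nbrs !swap_ifK.
have [->|->] := last_two gei lti.
  by rewrite -[in row _ _](addn0 n) new_row nthu /= na nb nthv perm_sym (red_Nu red).
by rewrite -[in row _ _](addn1 n) new_row nthv /= nc nd nthu perm_sym (red_Nv red).
Qed.

End Smooth.
End EdgeReduction.

(** * Finding an edge insertion in the list *)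

Lemma mem_pairs (T : eqType) (s : seq T) x y :
  x \in s -> y \in s -> x != y -> ((x, y) \in pairs s) || ((y, x) \in pairs s).
Proof.
elim: s => //= z s IH; rewrite !inE !mem_cat.
case/predU1P=> [->|xs] /predU1P[->|ys] xy.
- by rewrite eqxx in xy.
- by rewrite map_f.
- by rewrite [X in _ || (X || _)]map_f ?orbT.
by case/orP: (IH xs ys xy) => ->; rewrite !orbT.
Qed.

Section EdgeInsertions.
Variables (V : eqType) (x0 : V) (S : seq V) (N : V -> seq V).
Hypothesis cN : cubic_on S N.
Implicit Types (t : table) (p : seq V).

Definition smooth_adj (u v a b c d x z : V) : bool :=
  [|| [&& z \in N x, z != u & z != v], (x == a) && (z == b), (x == b) && (z == a),
      (x == c) && (z == d) | (x == d) && (z == c)].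

Lemma smooth_adj_swap_l u v a b c d : smooth_adj u v b a c d =2 smooth_adj u v a b c d.
Proof. by move=> x z; rewrite /smooth_adj; congr (_ || _); rewrite orbCA. Qed.

Lemma smooth_adj_swap_r u v a b c d : smooth_adj u v a b d c =2 smooth_adj u v a b c d.
Proof.
move=> x z; rewrite /smooth_adj; congr (_ || _); congr (_ || _); congr (_ || _).
by rewrite orbC.
Qed.

Lemma smooth_adj_swap u v a b c d : smooth_adj v u c d a b =2 smooth_adj u v a b c d.
Proof.
move=> x z; rewrite /smooth_adj [in X in X || _](andbC (z != v)); congr (_ || _).
by case: (_ && _); case: (_ && _); case: (_ && _); case: (_ && _).
Qed.

Section Labels.
Variables (u v a b c d : V) (t : table) (p : seq V).
Hypothesis red : reducible S N u v a b c d.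
Hypothesis lp : labels x0 t (smooth_support S u v) (smooth_nbrs N u v a b c d) p.

Let S' := smooth_support S u v.
Let cM : cubic_on S' (smooth_nbrs N u v a b c d) := smooth_cubic cN red.

Lemma smooth_row_index x y : x \in S' -> y \in S' ->
  (index y p \in row t (index x p)) = smooth_adj u v a b c d x y.
Proof.
by move=> xS yS; rewrite (mem_row_index cM lp) //; apply: (mem_smooth_nbrs cN red).
Qed.

Lemma reducible_support : [/\ a \in S', b \in S', c \in S' & d \in S'].
Proof.
have [[aS bS _] [ab av bv] [ua ub uv] Nu] := nbrs3 cN (red_u red) (red_Nu red).
have [[cS dS _] [cd cu du] [vc vd vu] Nv] := nbrs3 cN (red_v red) (red_Nv red).
split; rewrite mem_support.
- by rewrite aS eq_sym ua.
- by rewrite bS eq_sym ub.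
- by rewrite cS cu eq_sym vc.
by rewrite dS du eq_sym vd.
Qed.

End Labels.

(** The edges of the smaller graph are listed with increasing labels and its pairs
    of edges in one order only; the symmetries of the deletion, which exchange
    the roles of [a] and [b], of [c] and [d], and of [u] and [v], bring every
    deletion into that form. *)
Lemma edge_insertion_found u v a b c d t :
  reducible S N u v a b c d ->
  realizes x0 t (smooth_support S u v) (smooth_nbrs N u v a b c d) ->
  exists2 t', t' \in edge_insertions t & realizes x0 t' S N.
Proof.
move=> red [p lp].
have supE u' v' : smooth_support S v' u' = smooth_support S u' v'.
  by apply: eq_filter => x; rewrite !inE orbC.
have tr u' v' a' b' c' d' u1 v1 a1 b1 c1 d1 :
    reducible S N u' v' a' b' c' d' -> reducible S N u1 v1 a1 b1 c1 d1 ->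
    smooth_adj u1 v1 a1 b1 c1 d1 =2 smooth_adj u' v' a' b' c' d' ->
    smooth_support S u1 v1 = smooth_support S u' v' ->
    labels x0 t (smooth_support S u' v') (smooth_nbrs N u' v' a' b' c' d') p ->
    labels x0 t (smooth_support S u1 v1) (smooth_nbrs N u1 v1 a1 b1 c1 d1) p.
  move=> r r1 E ES; rewrite ES; apply: labels_eq => x xS.
  have xS1 : x \in smooth_support S u1 v1 by rewrite ES.
  apply: uniq_perm; [exact: (smooth_uniq cN r xS)|exact: (smooth_uniq cN r1 xS1)|].
  by move=> z; rewrite (mem_smooth_nbrs cN r) // (mem_smooth_nbrs cN r1) //; apply/esym/E.
have tr_l u1 v1 a1 b1 c1 d1 (r : reducible S N u1 v1 a1 b1 c1 d1) :=
  tr _ _ _ _ _ _ _ _ _ _ _ _ r (reducible_swap_l cN r) (smooth_adj_swap_l _ _ _ _ _ _) erefl.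
have tr_r u1 v1 a1 b1 c1 d1 (r : reducible S N u1 v1 a1 b1 c1 d1) :=
  tr _ _ _ _ _ _ _ _ _ _ _ _ r (reducible_swap_r cN r) (smooth_adj_swap_r _ _ _ _ _ _) erefl.
have tr_s u1 v1 a1 b1 c1 d1 (r : reducible S N u1 v1 a1 b1 c1 d1) :=
  tr _ _ _ _ _ _ _ _ _ _ _ _ r (reducible_swap r) (smooth_adj_swap _ _ _ _ _ _) (supE _ _).
(* The order of the labels decides in which form the insertion is listed. *)
wlog lt_ab : a b red lp / index a p < index b p.
  move=> IH; case: (ltngtP (index a p) (index b p)) => [|lt|E]; first exact: IH red lp.
    exact: IH (reducible_swap_l cN red) (tr_l _ _ _ _ _ _ red lp) lt.
  have [[aS bS _] [/negP[]]] := nbrs3 cN (red_u red) (red_Nu red).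
  have [aS' bS' _ _] := reducible_support red.
  by rewrite -(index_inj_on lp) // E.
wlog lt_cd : c d red lp / index c p < index d p.
  move=> IH; case: (ltngtP (index c p) (index d p)) => [|lt|E]; first exact: IH red lp.
    exact: IH (reducible_swap_r cN red) (tr_r _ _ _ _ _ _ red lp) lt.
  have [[cS dS _] [/negP[]]] := nbrs3 cN (red_v red) (red_Nv red).
  have [_ _ cS' dS'] := reducible_support red.
  by rewrite -(index_inj_on lp) // E.
have [aS bS cS dS] := reducible_support red.
have cM := smooth_cubic cN red.
have ab : (index a p, index b p) \in edge_list t.
  rewrite mem_edge_list lt_ab (labels_index lp) // (smooth_row_index red lp) //.
  by rewrite /smooth_adj !eqxx !orbT.
have cd : (index c p, index d p) \in edge_list t.
  rewrite mem_edge_list lt_cd (labels_index lp) // (smooth_row_index red lp) //.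
  by rewrite /smooth_adj !eqxx !orbT.
have ne : (index a p, index b p) != (index c p, index d p).
  rewrite xpair_eqE !(index_inj_on lp) //; exact: red_ac red.
have found u1 v1 a1 b1 c1 d1 : reducible S N u1 v1 a1 b1 c1 d1 ->
    labels x0 t (smooth_support S u1 v1) (smooth_nbrs N u1 v1 a1 b1 c1 d1) p ->
    ((index a1 p, index b1 p), (index c1 p, index d1 p)) \in pairs (edge_list t) ->
    exists2 t', t' \in edge_insertions t & realizes x0 t' S N.
  move=> r1 l1 mp; eexists; last by eexists; exact: (ins_edge_labels cN r1 l1).
  by apply/mapP; exists ((index a1 p, index b1 p), (index c1 p, index d1 p)).
case/orP: (mem_pairs ab cd ne); first exact: found red lp.
exact: found (reducible_swap red) (tr_s _ _ _ _ _ _ red lp).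
Qed.

End EdgeInsertions.

(** * Reducing a cubic graph by four vertices *)

Section FourVertices.
Variables (V : eqType) (x0 : V) (S : seq V) (N : V -> seq V).
Hypothesis cN : cubic_on S N.

Definition support4 (x y z w : V) : seq V := [seq s <- S | s \notin [:: x; y; z; w]].

Section K4.
Variables x y z w : V.
Hypotheses (xS : x \in S) (yS : y \in S) (zS : z \in S) (wS : w \in S).
Hypotheses (Nx : perm_eq (N x) [:: y; z; w]) (Ny : perm_eq (N y) [:: x; z; w]).
Hypotheses (Nz : perm_eq (N z) [:: x; y; w]) (Nw : perm_eq (N w) [:: x; y; z]).

Lemma K4_outside s r : s \in S -> s \notin [:: x; y; z; w] -> r \in N s ->
  r \notin [:: x; y; z; w].
Proof.
move=> sS sQ rs; apply: contra sQ => rQ; move: rs.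
have rS : r \in S by move: rQ; rewrite !inE => /or4P[]/eqP->.
rewrite (cubic_symE cN) // !inE; move: rQ; rewrite !inE => /or4P[]/eqP->.
- by rewrite (perm_mem Nx) !inE => ->; rewrite orbT.
- by rewrite (perm_mem Ny) !inE; do 4![case: (_ == _)].
- by rewrite (perm_mem Nz) !inE; do 4![case: (_ == _)].
by rewrite (perm_mem Nw) !inE; do 4![case: (_ == _)].
Qed.

Lemma K4_cubic : cubic_on (support4 x y z w) N.
Proof.
have sub s : s \in support4 x y z w -> s \in S by rewrite mem_filter => /andP[].
split.
- exact/filter_uniq/(cubic_uniq cN).
- by move=> s /sub; apply: (cubic_size cN).
- by move=> s /sub; apply: (cubic_nbr_uniq cN).
- by move=> s /sub; apply: (cubic_irr cN).
- move=> s r; rewrite !mem_filter => /andP[sQ sS] rs.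
  by rewrite (K4_outside sS sQ rs) (cubic_sub cN sS rs).
by move=> s r /sub; apply: (cubic_sym cN).
Qed.

Lemma perm_support4 p : uniq [:: x; y; z; w] -> perm_eq p (support4 x y z w) ->
  forall q, perm_eq q [:: x; y; z; w] -> perm_eq (p ++ q) S.
Proof.
move=> uQ pp q pq; apply: perm_trans (perm_cat pp pq) _.
apply: uniq_perm (cubic_uniq cN) _ => [|s].
  rewrite cat_uniq uQ andbT (filter_uniq _ (cubic_uniq cN)) andTb.
  by apply/hasPn => s sQ; rewrite mem_filter sQ.
rewrite mem_cat mem_filter; case: (boolP (s \in _)) => //= sQ; rewrite ?orbF //.
by move: sQ; rewrite !inE => /or4P[]/eqP->; rewrite ?xS ?yS ?zS ?wS.
Qed.

Lemma add_K4_labels t p : uniq [:: x; y; z; w] ->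
  labels x0 t (support4 x y z w) N p -> labels x0 (add_K4 t) S N (p ++ [:: x; y; z; w]).
Proof.
move=> uQ lp; have sp := labels_size lp; set p' := p ++ _.
set n := size t in sp.
have nthp i : i < n -> nth x0 p' i = nth x0 p i by rewrite nth_cat sp => ->.
have nth4 k : nth x0 p' (n + k) = nth x0 [:: x; y; z; w] k.
  by rewrite nth_cat sp ltnNge leq_addr addKn.
have row4 k : row (add_K4 t) (n + k) =
    nth [::] [:: [:: n.+1; n.+2; n.+3]; [:: n; n.+2; n.+3]; [:: n; n.+1; n.+3];
           [:: n; n.+1; n.+2]] k.
  by rewrite /row nth_cat ltnNge leq_addr addKn.
have [n0 n1 n2 n3] : [/\ nth x0 p' n = x, nth x0 p' n.+1 = y, nth x0 p' n.+2 = z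
    & nth x0 p' n.+3 = w].
  have := (nth4 0, nth4 1, nth4 2, nth4 3).
  by rewrite addn0 addn1 addn2 addn3 => -[[[-> ->] ->] ->].
have rowp i : i < n -> row (add_K4 t) i = row t i by rewrite /row nth_cat => ->.
have sz : size (add_K4 t) = n + 4 by rewrite size_cat.
have four i : n <= i -> i < n + 4 -> exists2 k, i = n + k & k < 4.
  by move=> le lt; exists (i - n); rewrite ?subnKC // ltn_subLR.
split.
- exact: perm_support4 uQ (labels_perm lp) _ (perm_refl _).
- by rewrite size_cat sp sz.
- move=> i; rewrite sz; case: (ltnP i n) => [lti _|/four f /f[k -> k4]].
    rewrite rowp //; apply: sub_all (labels_bound lp lti) => j /= ltj.
    by rewrite (leq_trans ltj) ?leq_addr.
  have l3 : n.+3 < n + 4 by rewrite addn4.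
  have l2 := ltnW l3; have l1 := ltnW l2; have l0 := ltnW l1.
  by rewrite row4; case: k k4 => [|[|[|[|k]]]] // _; rewrite /= ?l0 ?l1 ?l2 ?l3.
move=> i; rewrite sz; case: (ltnP i n) => [lti _|/four f /f[k -> k4]].
  rewrite rowp // nthp //.
  have -> : map (nth x0 p') (row t i) = map (nth x0 p) (row t i).
    by apply/eq_in_map => j jr; rewrite nthp // (row_bound lp lti jr).
  exact: labels_row lp i lti.
rewrite row4 nth4; case: k k4 => [|[|[|[|k]]]] //= _; by rewrite ?n0 ?n1 ?n2 ?n3 perm_sym.
Qed.

End K4.

(** [x] and [y] are the inner vertices of a diamond, [z] and [w] its tips, and [e]
    and [f] the outer neighbours of the tips. *)
Section Diamond.
Variables x y z w e f : V.
Hypotheses (xS : x \in S) (yS : y \in S) (zS : z \in S) (wS : w \in S).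
Hypotheses (Nx : perm_eq (N x) [:: y; z; w]) (Ny : perm_eq (N y) [:: x; z; w]).
Hypotheses (Nz : perm_eq (N z) [:: x; y; e]) (Nw : perm_eq (N w) [:: x; y; f]).
Hypotheses (ef : e != f) (fe : f \notin N e).

Definition diamond_nbrs (s : V) : seq V :=
  map (swap_if e z f s) (map (swap_if f w e s) (N s)).

Let factsx := nbrs3 cN xS Nx.
Let factsy := nbrs3 cN yS Ny.
Let factsz := nbrs3 cN zS Nz.
Let factsw := nbrs3 cN wS Nw.

Lemma diamond_uniq : uniq [:: x; y; z; w].
Proof.
have [_ [yz yw zw] [xy xz xw] _] := factsx.
by rewrite /= !inE !negb_or xy xz xw yz yw zw.
Qed.

(** [e = w] would force [f = z], making [e] and [f] adjacent. *)
Lemma diamond_ends : (e \in support4 x y z w) && (f \in support4 x y z w).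
Proof.
have [_ [yz yw zw] [xy xz xw] _] := factsx.
have [[_ _ eS] [_ xe ye] [_ _ ze] Nz'] := factsz.
have [[_ _ fS] [_ xf yf] [_ _ wf] Nw'] := factsw.
have ew : e != w.
  apply: contraNneq fe => ew; have : w \in N z by rewrite Nz' ew eqxx !orbT.
  rewrite (cubic_symE cN) // Nw' eq_sym (negPf xz) eq_sym (negPf yz) /= => /eqP <-.
  by rewrite ew (cubic_symE cN) // Nz' ew eqxx !orbT.
have fz : f != z.
  apply: contraNneq fe => fz; have : z \in N w by rewrite Nw' fz eqxx !orbT.
  rewrite (cubic_symE cN) // Nz' ![w == _]eq_sym (negPf xw) (negPf yw) /= => /eqP ->.
  by rewrite Nw' eqxx !orbT.
rewrite !mem_filter !inE eS fS !andbT !negb_or ew fz.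
by rewrite ![e == _]eq_sym xe ye ze ![f == _]eq_sym xf yf wf.
Qed.

Let e4 : e \in support4 x y z w. Proof. by case/andP: diamond_ends. Qed.
Let f4 : f \in support4 x y z w. Proof. by case/andP: diamond_ends. Qed.

Lemma diamond_outside s : s \in support4 x y z w ->
  [/\ s \in S, x \notin N s, y \notin N s, (z \in N s) = (s == e) & (w \in N s) = (s == f)].
Proof.
have [_ _ _ Nx'] := factsx; have [_ _ _ Ny'] := factsy.
have [_ _ _ Nz'] := factsz; have [_ _ _ Nw'] := factsw.
rewrite mem_filter !inE !negb_or => /andP[/and4P[sx sy sz sw] sS].
rewrite !(cubic_symE cN _ sS) // Nx' Ny' Nz' Nw'.
by rewrite (negPf sx) (negPf sy) (negPf sz) (negPf sw).
Qed.

Lemma diamond_fresh s : s \in support4 x y z w ->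
  (s == f -> e \notin N s) /\ (s == e -> f \notin map (swap_if f w e s) (N s)).
Proof.
have [[_ _ eS] _ _ _] := factsz; have [[_ _ fS] _ _ _] := factsw.
move=> s4; split=> /eqP->; first by rewrite (cubic_symE cN).
by rewrite mem_swap_if (negPf ef).
Qed.

Lemma mem_diamond_nbrs s r : s \in support4 x y z w ->
  (r \in diamond_nbrs s) = [|| [&& r \in N s, r != z & r != w],
    (s == e) && (r == f) | (s == f) && (r == e)].
Proof.
move=> s4; have [sS _ _ zE wE] := diamond_outside s4.
have [_ [yz yw zw] _ _] := factsx.
have notin q : q \notin N s -> (r \in N s) = (r \in N s) && (r != q).
  by case: (eqVneq r q) => [->|_]; rewrite ?andbT ?andbF // => /negPf.
rewrite /diamond_nbrs !mem_swap_if zE wE.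
have [E|se] := eqVneq s e.
  subst s; rewrite (negPf ef) /= orbF orbC andbA; congr (_ || _).
  by rewrite andbAC -(notin w) // wE (negPf ef).
have [E|sf] := eqVneq s f.
  subst s; rewrite /= orbC andbA; congr (_ || _); congr (_ && _); apply: notin.
  by rewrite zE (negPf se).
by rewrite /= orbF andbA -(notin z) ?zE // -(notin w) ?wE.
Qed.

Lemma diamond_nbrs_uniq s : s \in support4 x y z w -> uniq (diamond_nbrs s).
Proof.
move=> s4; have [f1 f2] := diamond_fresh s4; have [sS _ _ _ _] := diamond_outside s4.
by rewrite !swap_if_uniq // (cubic_nbr_uniq cN).
Qed.

Lemma diamond_cubic : cubic_on (support4 x y z w) diamond_nbrs.
Proof.
have sub s r : s \in support4 x y z w -> r \in diamond_nbrs s -> r \in support4 x y z w.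
  move=> s4; have [sS sx sy zE wE] := diamond_outside s4.
  rewrite mem_diamond_nbrs //; case/or3P=> [/and3P[rN rz rw]|/andP[_ /eqP-> //]|/andP[_ /eqP-> //]].
  rewrite mem_filter (cubic_sub cN sS rN) andbT !inE !negb_or rz rw !andbT.
  by apply/andP; split; apply: contraTneq rN => ->.
split.
- exact/filter_uniq/(cubic_uniq cN).
- by move=> s /diamond_outside[sS _ _ _ _]; rewrite !size_map (cubic_size cN).
- exact: diamond_nbrs_uniq.
- move=> s s4; have [sS _ _ _ _] := diamond_outside s4.
  rewrite mem_diamond_nbrs // (negPf (cubic_irr cN sS)) /=.
  by apply/negP => /orP[]/andP[/eqP-> E]; [move: E|move: E; rewrite eq_sym]; rewrite (negPf ef).
- exact: sub.
move=> s r s4 rs; have r4 := sub s r s4 rs; move: rs.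
have [sS _ _ _ _] := diamond_outside s4; have [rS _ _ _ _] := diamond_outside r4.
rewrite !mem_diamond_nbrs //; case/or3P=> [/and3P[rN _ _]|/andP[-> ->]|/andP[-> ->]]; rewrite ?orbT //.
rewrite (cubic_sym cN sS rN); move: s4; rewrite mem_filter !inE !negb_or.
by case/andP=> /and4P[_ _ -> ->].
Qed.

Lemma ins_diamond_labels t p : labels x0 t (support4 x y z w) diamond_nbrs p ->
  labels x0 (ins_diamond t (index e p) (index f p)) S N (p ++ [:: z; x; y; w]).
Proof.
move=> lp; have cM := diamond_cubic; have sp := labels_size lp; set p' := p ++ _.
set n := size t in sp.
have uQ := diamond_uniq.
have pQ : perm_eq p' S.
  apply: (perm_support4 xS yS zS wS uQ (labels_perm lp)).
  by rewrite (perm_catCA [:: z] [:: x; y] [:: w]).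
have up' : uniq p' by rewrite (perm_uniq pQ) (cubic_uniq cN).
have nthp i : i < n -> nth x0 p' i = nth x0 p i by rewrite nth_cat sp => ->.
have nth4 k : nth x0 p' (n + k) = nth x0 [:: z; x; y; w] k.
  by rewrite nth_cat sp ltnNge leq_addr addKn.
have [lte ltf] := (labels_index lp e4, labels_index lp f4); rewrite -/n in lte ltf.
have ne : nth x0 p' (index e p) = e by rewrite nthp // (labels_nthK lp).
have nf : nth x0 p' (index f p) = f by rewrite nthp // (labels_nthK lp).
set g := ins_diamond _ _ _.
have row4 k : row g (n + k) =
    nth [::] [:: [:: index e p; n.+1; n.+2]; [:: n; n.+2; n.+3]; [:: n; n.+1; n.+3];
           [:: index f p; n.+1; n.+2]] k.
  by rewrite /row nth_cat !size_upd ltnNge leq_addr addKn.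
have [n0 n1 n2 n3] : [/\ nth x0 p' n = z, nth x0 p' n.+1 = x, nth x0 p' n.+2 = y
    & nth x0 p' n.+3 = w].
  have := (nth4 0, nth4 1, nth4 2, nth4 3).
  by rewrite addn0 addn1 addn2 addn3 => -[[[-> ->] ->] ->].
have rowp i : i < n -> row g i =
    map (swap_if (index f p) (index e p) n.+3 i)
      (map (swap_if (index e p) (index f p) n i) (row t i)).
  by move=> lti; rewrite -!row_upd_repl /row nth_cat !size_upd lti.
have sz : size g = n + 4 by rewrite size_cat !size_upd.
have sp' : size p' = n + 4 by rewrite size_cat sp.
have lt4 i k : i < n -> i < n + k by move=> lt; rewrite (leq_trans lt) ?leq_addr.
have four i : n <= i -> i < n + 4 -> exists2 k, i = n + k & k < 4.
  by move=> le lt; exists (i - n); rewrite ?subnKC // ltn_subLR.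
have stages i : i < n ->
    map (nth x0 p') (row g i) = map (swap_if f e w (nth x0 p' i))
      (map (swap_if e f z (nth x0 p' i)) (map (nth x0 p') (row t i)))
    /\ all (gtn (n + 4)) (row g i).
  move=> lti; rewrite rowp //.
  have cond k j q : k < n -> j < n -> q < n + 4 ->
      [&& k < size p', j < size p', q < size p' & i < size p'].
    by move=> ltk ltj ltq; rewrite sp' ltq !lt4.
  have b0 : all (gtn (size p')) (row t i).
    by apply: sub_all (labels_bound lp lti) => j /=; rewrite sp'; apply: lt4.
  have ltn4 k : k < 4 -> n + k < n + 4 by rewrite ltn_add2l.
  have [e1 b1] := map_nth_swap x0 up' (cond _ _ _ lte ltf (ltn4 0 isT)) b0.
  have [e2 b2] := map_nth_swap x0 up' (cond _ _ _ ltf lte (ltn4 3 isT)) b1.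
  rewrite addn0 in e1 b1 e2 b2; rewrite addn3 in e2 b2.
  by rewrite e2 e1 ne nf n0 n3 -sp'.
split=> //; first by rewrite sp' sz.
  move=> i; rewrite sz; case: (ltnP i n) => [lti _|/four h /h[k -> k4]].
    by case: (stages i lti).
  have l3 : n.+3 < n + 4 by rewrite addn4.
  have l2 := ltnW l3; have l1 := ltnW l2; have l0 := ltnW l1.
  rewrite row4; case: k k4 => [|[|[|[|k]]]] // _.
  - by rewrite /= lt4 // l1 l2.
  - by rewrite /= l0 l2 l3.
  - by rewrite /= l0 l1 l3.
  by rewrite /= lt4 // l1 l2.
move=> i; rewrite sz; case: (ltnP i n) => [lti _|/four h /h[k -> k4]].
  have [-> _] := stages i lti; set s := nth x0 p' i.
  have -> : map (nth x0 p') (row t i) = map (nth x0 p) (row t i).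
    by apply/eq_in_map => j jr; rewrite nthp // (row_bound lp lti jr).
  have s4 : s \in support4 x y z w by rewrite /s nthp // (labels_nth lp).
  have [f1 f2] := diamond_fresh s4.
  have := labels_row lp lti; rewrite -nthp // -/s => pM.
  have := perm_map (swap_if f e w s) (perm_map (swap_if e f z s) pM).
  by rewrite /diamond_nbrs !swap_ifK.
have p3 (a b c : V) (q : seq V) : perm_eq q [:: a; b; c] -> perm_eq [:: c; a; b] q.
  by move=> pq; rewrite perm_sym (perm_trans pq) // (perm_catC [:: a; b] [:: c]).
have p3' (a b c : V) (q : seq V) : perm_eq q [:: a; b; c] -> perm_eq [:: b; a; c] q.
  move=> pq; rewrite perm_sym (perm_trans pq) //.
  by rewrite (perm_catCA [:: a] [:: b] [:: c]).
rewrite row4 nth4; case: k k4 => [|[|[|[|k]]]] //= _; rewrite ?ne ?nf ?n0 ?n1 ?n2 ?n3.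
- exact: p3.
- exact: p3'.
- exact: p3'.
exact: p3.
Qed.

End Diamond.
End FourVertices.

(** * Every cubic graph can be reduced *)

Section Reduce.
Variables (V : eqType) (x0 : V).

(** From any table of the smaller graph, the extension [ext] produces a table of the
    given one. *)
Definition reduces_by (k : nat) (ext : table -> seq table) (S : seq V) (N : V -> seq V) :=
  exists S' N', [/\ cubic_on S' N', size S' + k = size S &
    forall t, realizes x0 t S' N' -> exists2 t', t' \in ext t & realizes x0 t' S N].

Variables (S : seq V) (N : V -> seq V).
Hypothesis cN : cubic_on S N.

Lemma size_outside (Q : seq V) : uniq Q -> {subset Q <= S} ->
  size [seq s <- S | s \notin Q] + size Q = size S.
Proof.
move=> uQ QS; have -> : size Q = count (mem Q) S.
  rewrite -size_filter; apply/perm_size/uniq_perm => //.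
    exact/filter_uniq/(cubic_uniq cN).
  by move=> s; rewrite mem_filter andb_idr //; apply: QS.
by rewrite size_filter addnC; apply: count_predC.
Qed.

Lemma reduce_edge u v a b c d : reducible S N u v a b c d -> reduces_by 2 edge_insertions S N.
Proof.
move=> red; exists (smooth_support S u v), (smooth_nbrs N u v a b c d).
split; first exact: smooth_cubic.
  have [_ _ [_ _ uv] _] := nbrs3 cN (red_u red) (red_Nu red).
  rewrite (@size_outside [:: u; v]) //= ?inE ?uv //.
  by move=> s; rewrite !inE => /orP[]/eqP->; [exact: red_u red|exact: red_v red].
by move=> t; apply: edge_insertion_found.
Qed.

Lemma perm3_swap12 (q : seq V) a b c : perm_eq q [:: a; b; c] -> perm_eq q [:: b; a; c].
Proof. by move=> /perm_trans-> //; rewrite (perm_catCA [:: a] [:: b] [:: c]). Qed.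

Lemma perm3_swap23 (q : seq V) a b c : perm_eq q [:: a; b; c] -> perm_eq q [:: a; c; b].
Proof. by move=> /perm_trans-> //; rewrite perm_cons (perm_catC [:: b] [:: c]). Qed.

Lemma diamond_insertion_found x y z w e f t p :
  x \in S -> y \in S -> z \in S -> w \in S ->
  perm_eq (N x) [:: y; z; w] -> perm_eq (N y) [:: x; z; w] ->
  perm_eq (N z) [:: x; y; e] -> perm_eq (N w) [:: x; y; f] ->
  e != f -> f \notin N e -> index e p < index f p ->
  labels x0 t (support4 S x y z w) (diamond_nbrs N z w e f) p ->
  exists2 t', t' \in diamond_insertions t & realizes x0 t' S N.
Proof.
move=> xS yS zS wS Nx Ny Nz Nw ef fe lt lp.
have /andP[e4 f4] := diamond_ends cN xS zS wS Nx Nz Nw fe.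
exists (ins_diamond t (index e p) (index f p)); last first.
  by eexists; apply: (ins_diamond_labels cN xS yS zS wS Nx Ny Nz Nw ef fe lp).
rewrite inE; apply/orP; right; apply/mapP; exists (index e p, index f p) => //.
have cM := diamond_cubic cN xS yS zS wS Nx Ny Nz Nw ef fe.
rewrite mem_edge_list lt (labels_index lp) // (mem_row_index cM lp) //.
by rewrite (mem_diamond_nbrs cN xS yS zS wS Nx Ny Nz Nw ef) // !eqxx orbT.
Qed.

Lemma reduce_diamond x y z w e f :
  x \in S -> y \in S -> z \in S -> w \in S ->
  perm_eq (N x) [:: y; z; w] -> perm_eq (N y) [:: x; z; w] ->
  perm_eq (N z) [:: x; y; e] -> perm_eq (N w) [:: x; y; f] ->
  e != f -> f \notin N e -> reduces_by 4 diamond_insertions S N.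
Proof.
move=> xS yS zS wS Nx Ny Nz Nw ef fe.
have [[_ _ eS] _ _ _] := nbrs3 cN zS Nz; have [[_ _ fS] _ _ _] := nbrs3 cN wS Nw.
have uQ := diamond_uniq cN xS Nx.
have sub : {subset [:: x; y; z; w] <= S} by move=> s; rewrite !inE => /or4P[]/eqP->.
exists (support4 S x y z w), (diamond_nbrs N z w e f); split.
- exact: (diamond_cubic cN xS yS zS wS Nx Ny Nz Nw ef fe).
- exact: (size_outside uQ sub).
move=> t [p lp]; case: (ltngtP (index e p) (index f p)) => [lt|lt|E].
- exact: (diamond_insertion_found xS yS zS wS Nx Ny Nz Nw ef fe lt lp).
- have fe' : f != e by rewrite eq_sym.
  have ef' : e \notin N f by rewrite (cubic_symE cN).
  have Nx' := perm3_swap23 Nx; have Ny' := perm3_swap23 Ny.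
  apply: (diamond_insertion_found xS yS wS zS Nx' Ny' Nw Nz fe' ef' lt).
  have ES : support4 S x y w z = support4 S x y z w.
    by apply: eq_filter => s; rewrite !inE (orbC (s == w)).
  rewrite ES; apply: labels_eq lp => s s4.
  have s4' : s \in support4 S x y w z by rewrite ES.
  apply: uniq_perm.
  + exact: (diamond_nbrs_uniq cN xS yS zS wS Nx Ny Nz Nw ef fe s4).
  + exact: (diamond_nbrs_uniq cN xS yS wS zS Nx' Ny' Nw Nz fe' ef' s4').
  move=> r; rewrite (mem_diamond_nbrs cN xS yS zS wS Nx Ny Nz Nw ef r s4).
  rewrite (mem_diamond_nbrs cN xS yS wS zS Nx' Ny' Nw Nz fe' r s4').
  by rewrite (andbC (r != w)) [in RHS](orbC (_ && (r == e))).
have /andP[e4 f4] := diamond_ends cN xS zS wS Nx Nz Nw fe.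
by move/eqP: E; rewrite (index_inj_on lp) // (negPf ef).
Qed.

Lemma reduce_K4 x y z w :
  x \in S -> y \in S -> z \in S -> w \in S ->
  perm_eq (N x) [:: y; z; w] -> perm_eq (N y) [:: x; z; w] ->
  perm_eq (N z) [:: x; y; w] -> perm_eq (N w) [:: x; y; z] ->
  reduces_by 4 diamond_insertions S N.
Proof.
move=> xS yS zS wS Nx Ny Nz Nw.
have sub : {subset [:: x; y; z; w] <= S} by move=> s; rewrite !inE => /or4P[]/eqP->.
have uQ := diamond_uniq cN xS Nx.
exists (support4 S x y z w), N; split.
- exact: (K4_cubic cN xS yS zS wS Nx Ny Nz Nw).
- exact: (size_outside uQ sub).
move=> t [p lp]; exists (add_K4 t); first by rewrite inE eqxx.
by eexists; apply: (add_K4_labels cN xS yS zS wS Nx Ny Nz Nw uQ lp).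
Qed.

Lemma other_nbrs x y : x \in S -> y \in N x -> exists a b, perm_eq (N x) [:: y; a; b].
Proof.
move=> xS yx; have p1 := perm_to_rem yx; have : size (rem y (N x)) = 2.
  by rewrite size_rem // (cubic_size cN).
by case E: (rem y (N x)) p1 => [|a [|b []]] // p1 _; exists a, b.
Qed.

Lemma third_nbr x y z : x \in S -> y \in N x -> z \in N x -> y != z ->
  exists r, perm_eq (N x) [:: y; z; r].
Proof.
move=> xS yx + yz; have [a [b Nx]] := other_nbrs xS yx.
rewrite (perm_mem Nx) !inE eq_sym (negPf yz) /= => /orP[]/eqP->; first by exists b.
by exists a; apply: perm3_swap23.
Qed.

(** When the outer neighbours of a triangle are distinct, deleting one of its edges
    contracts the triangle. *)
Lemma reduce_triangle x y z x' y' z' :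
  x \in S -> y \in S -> z \in S ->
  perm_eq (N x) [:: y; z; x'] -> perm_eq (N y) [:: x; z; y'] ->
  perm_eq (N z) [:: x; y; z'] -> x' != y' -> x' != z' -> y' != z' ->
  reduces_by 2 edge_insertions S N.
Proof.
move=> xS yS zS Nx Ny Nz xy' xz' yz'.
have [_ [yz yx' zx'] [xy xz xx'] _] := nbrs3 cN xS Nx.
have [_ [_ xy'' zy'] [_ _ yy'] _] := nbrs3 cN yS Ny.
have [_ _ _ Nz'] := nbrs3 cN zS Nz.
apply: (@reduce_edge x y z x' z y').
split=> //.
- exact/perm3_swap23/perm3_swap12.
- exact/perm3_swap23/perm3_swap12.
- by rewrite Nz' !negb_or eq_sym xx' eq_sym yx' xz'.
- by rewrite Nz' !negb_or eq_sym xy'' eq_sym yy' yz'.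
- by rewrite eqxx.
by rewrite negb_and zy'.
Qed.

Definition reducible_graph : Prop :=
  reduces_by 2 edge_insertions S N \/ reduces_by 4 diamond_insertions S N.

(** The tips [z] and [w] of a diamond have outer neighbours [e] and [f]. When these
    are adjacent, shrinking the diamond to an edge would double the edge [e f];
    that edge is deleted instead. *)
Lemma reduce_diamond_adjacent x y z w e f :
  x \in S -> y \in S -> z \in S -> w \in S ->
  perm_eq (N x) [:: y; z; w] -> perm_eq (N y) [:: x; z; w] ->
  perm_eq (N z) [:: x; y; e] -> perm_eq (N w) [:: x; y; f] ->
  e != f -> f \in N e -> e != w -> f != z -> reduces_by 2 edge_insertions S N.
Proof.
move=> xS yS zS wS Nx Ny Nz Nw ef fe ew fz.
have [_ [yz yw zw] [xy xz xw] Nx'] := nbrs3 cN xS Nx.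
have [_ _ _ Ny'] := nbrs3 cN yS Ny.
have [[_ _ eS] [_ xe ye] [_ _ ze] Nz'] := nbrs3 cN zS Nz.
have [[_ _ fS] [_ xf yf] [_ _ wf] Nw'] := nbrs3 cN wS Nw.
have zNe : z \in N e by rewrite (cubic_symE cN) // Nz' eqxx !orbT.
have wNf : w \in N f by rewrite (cubic_symE cN) // Nw' eqxx !orbT.
have ef' : e \in N f by rewrite (cubic_symE cN).
have [|g Ne] := third_nbr eS zNe fe; first by rewrite eq_sym.
have [|h Nf] := third_nbr fS wNf ef'; first by rewrite eq_sym.
have [[_ _ gS] [_ zg fg] [_ _ eg] Ne'] := nbrs3 cN eS Ne.
have [[_ _ hS] [_ wh eh] [_ _ fh] Nf'] := nbrs3 cN fS Nf.
have outx s : s \in S -> s != y -> s != z -> s != w -> x \notin N s.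
  by move=> sS *; rewrite (cubic_symE cN) // Nx' !negb_or; apply/and3P.
have outy s : s \in S -> s != x -> s != z -> s != w -> y \notin N s.
  by move=> sS *; rewrite (cubic_symE cN) // Ny' !negb_or; apply/and3P.
have xNe : x \notin N e by apply: outx => //; rewrite eq_sym.
have yNe : y \notin N e by apply: outy => //; rewrite eq_sym.
have xNf : x \notin N f by apply: outx => //; rewrite eq_sym.
have yNf : y \notin N f by apply: outy => //; rewrite eq_sym.
have gx : x != g by apply: contraNneq xNe => ->; rewrite Ne' eqxx !orbT.
have gy : y != g by apply: contraNneq yNe => ->; rewrite Ne' eqxx !orbT.
have hx : x != h by apply: contraNneq xNf => ->; rewrite Nf' eqxx !orbT.
have hy : y != h by apply: contraNneq yNf => ->; rewrite Nf' eqxx !orbT.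
have zh : z != h.
  apply: contraTneq (fz) => zh; have : f \in N z by rewrite (cubic_symE cN) // Nf' zh eqxx !orbT.
  by rewrite Nz' ![f == _]eq_sym (negPf xf) (negPf yf) (negPf ef).
have red : reducible S N e f z g w h.
  split=> //.
  - exact: perm3_swap23.
  - exact: perm3_swap23.
  - by rewrite Nz' ![g == _]eq_sym !negb_or gx gy.
  - by rewrite Nw' ![h == _]eq_sym !negb_or hx hy.
  - by rewrite (negPf zw).
  by rewrite (negPf zh).
exact: reduce_edge red.
Qed.

(** Two adjacent vertices with the same other neighbours [z] and [w] span a [K_4]
    component or a diamond with tips [z] and [w]. If the tips share their
    outer neighbour [e], the third edge [e g] of [e] is a bridge. It can be
    deleted unless the other neighbours [h] and [i] of [g] are adjacent; in
    that case [g h i] is a triangle, which either contracts or lies in a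
    second diamond whose tip is [g]. *)
Lemma reduce_shared_pair x y z w : x \in S -> y \in S ->
  perm_eq (N x) [:: y; z; w] -> perm_eq (N y) [:: x; z; w] -> reducible_graph.
Proof.
move=> xS yS Nx Ny.
have [[_ zS wS] [yz yw zw] [xy xz xw] Nx'] := nbrs3 cN xS Nx.
have [_ _ _ Ny'] := nbrs3 cN yS Ny.
have xNz : x \in N z by rewrite (cubic_symE cN) // Nx' eqxx !orbT.
have yNz : y \in N z by rewrite (cubic_symE cN) // Ny' eqxx !orbT.
have xNw : x \in N w by rewrite (cubic_symE cN) // Nx' eqxx !orbT.
have yNw : y \in N w by rewrite (cubic_symE cN) // Ny' eqxx !orbT.
have [e Nz] := third_nbr zS xNz yNz xy.
have [f Nw] := third_nbr wS xNw yNw xy.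
have [[_ _ eS] [_ xe ye] [_ _ ze] Nz'] := nbrs3 cN zS Nz.
have [[_ _ fS] [_ xf yf] [_ _ wf] Nw'] := nbrs3 cN wS Nw.
have [ew|ew] := eqVneq e w.
  have : z \in N w by rewrite (cubic_symE cN) // Nz' ew eqxx !orbT.
  rewrite Nw' ![z == _]eq_sym (negPf xz) (negPf yz) /= => /eqP fz.
  have Nz1 : perm_eq (N z) [:: x; y; w] by rewrite -ew.
  have Nw1 : perm_eq (N w) [:: x; y; z] by rewrite -fz.
  by right; apply: (reduce_K4 xS yS zS wS Nx Ny Nz1 Nw1).
have fz : f != z.
  apply: contraNneq ew => fz; have : w \in N z by rewrite (cubic_symE cN) // Nw' fz eqxx !orbT.
  by rewrite Nz' ![w == _]eq_sym (negPf xw) (negPf yw).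
have [ef|ef] := eqVneq e f; last first.
  have [fe|fe] := boolP (f \in N e).
    by left; apply: (reduce_diamond_adjacent xS yS zS wS Nx Ny Nz Nw).
  by right; apply: (reduce_diamond xS yS zS wS Nx Ny Nz Nw).
subst f; have zNe : z \in N e by rewrite (cubic_symE cN) // Nz' eqxx !orbT.
have wNe : w \in N e by rewrite (cubic_symE cN) // Nw' eqxx !orbT.
have [g Ne] := third_nbr eS zNe wNe zw.
have [[_ _ gS] [_ zg wg] [_ _ eg] Ne'] := nbrs3 cN eS Ne.
pose B := [:: x; y; z; w; e].
(* The edge [e g] is the only way out of [B]. *)
have closed s r : s \in B -> r \in N s -> (r \in B) || (s == e) && (r == g).
  rewrite /B !inE; case/or4P=> [|||/orP[]] /eqP->.
  - by rewrite Nx' => /or3P[]->; rewrite ?orbT.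
  - by rewrite Ny' => /or3P[]->; rewrite ?orbT.
  - by rewrite Nz' => /or3P[]->; rewrite ?orbT.
  - by rewrite Nw' => /or3P[]->; rewrite ?orbT.
  by rewrite Ne' eqxx => /or3P[]->; rewrite ?orbT.
have xg : x != g.
  apply: contraNneq xe => xg; have : e \in N x by rewrite (cubic_symE cN) // Ne' xg eqxx !orbT.
  by rewrite Nx' ![e == _]eq_sym (negPf ye) (negPf ze) [w == e]eq_sym (negPf ew).
have yg : y != g.
  apply: contraNneq ye => yg; have : e \in N y by rewrite (cubic_symE cN) // Ne' yg eqxx !orbT.
  by rewrite Ny' ![e == _]eq_sym (negPf xe) (negPf ze) [w == e]eq_sym (negPf ew).
have gB : g \notin B by rewrite !inE ![g == _]eq_sym !negb_or xg yg zg wg eg.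
have outB s : s \in S -> s != e -> g \in N s -> s \notin B.
  move=> sS se gs; apply/negP => sB; case/orP: (closed s g sB gs).
    by rewrite (negPf gB).
  by rewrite (negPf se).
have far s r : s \in S -> r \in N s -> s \notin B -> s != g -> r \notin B.
  move=> sS rs sB sg; apply/negP => rB.
  have rS := cubic_sub cN sS rs.
  case/orP: (closed r s rB (cubic_sym cN sS rs)); first by rewrite (negPf sB).
  by rewrite (negPf sg) andbF.
have eNg : e \in N g by rewrite (cubic_symE cN) // Ne' eqxx !orbT.
have [h [i Ng]] := other_nbrs gS eNg.
have [[_ hS iS] [eh ei hi] [_ gh gi] Ng'] := nbrs3 cN gS Ng.
have gNh : g \in N h by rewrite (cubic_symE cN) // Ng' eqxx !orbT.
have gNi : g \in N i by rewrite (cubic_symE cN) // Ng' eqxx !orbT.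
have hB : h \notin B by apply: outB => //; rewrite eq_sym.
have iB : i \notin B by apply: outB => //; rewrite eq_sym.
have neB s r : s \in B -> r \notin B -> s != r.
  by move=> sB; apply: contraNneq => <-.
have [hNi|hNi] := boolP (i \in N h); last first.
  have red : reducible S N e g z w h i.
    split=> //; first exact: perm3_swap23 (perm3_swap12 Ng) .
    - by rewrite Nz' ![w == _]eq_sym (negPf xw) (negPf yw) (negPf ew).
    - by rewrite (negPf (neB z h _ hB)) // !inE eqxx !orbT.
    by rewrite (negPf (neB z i _ iB)) // !inE eqxx !orbT.
  by left; apply: (reduce_edge red).
have iNh : h \in N i by rewrite (cubic_symE cN).
have [h' Nh] := third_nbr hS gNh hNi gi.
have [i' Ni] := third_nbr iS gNi iNh gh.
have [[_ _ h'S] [_ gh' ih'] [_ _ hh'] Nh'] := nbrs3 cN hS Nh.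
have [[_ _ i'S] [_ gi' hi'] [_ _ ii'] Ni'] := nbrs3 cN iS Ni.
have h'Nh : h' \in N h by rewrite Nh' eqxx !orbT.
have i'Ni : i' \in N i by rewrite Ni' eqxx !orbT.
have h'B : h' \notin B by apply: far h'Nh hB _; rewrite // eq_sym.
have i'B : i' \notin B by apply: far i'Ni iB _; rewrite // eq_sym.
have eB : e \in B by rewrite !inE eqxx !orbT.
have [E|h'i'] := eqVneq h' i'; last first.
  left; apply: (reduce_triangle hS iS gS _ _ _ h'i').
  - exact: perm3_swap12 Nh.
  - exact: perm3_swap12 Ni.
  - exact: perm3_swap23 (perm3_swap12 Ng).
  - by rewrite eq_sym neB.
  by rewrite eq_sym neB.
subst i'; have hNh' : h \in N h' by rewrite (cubic_symE cN).
have iNh' : i \in N h' by rewrite (cubic_symE cN).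
have [k Nh'k] := third_nbr h'S hNh' iNh' hi.
have [[_ _ kS] [_ hk ik] [_ _ h'k] Nh'k'] := nbrs3 cN h'S Nh'k.
have kB : k \notin B.
  by apply: (far h' k h'S) => //; rewrite ?Nh'k' ?eqxx ?orbT // eq_sym.
right; apply: (reduce_diamond hS iS gS h'S _ _ _ Nh'k (neB _ _ eB kB)).
- exact: perm3_swap12 Nh.
- exact: perm3_swap12 Ni.
- exact: perm3_swap23 (perm3_swap12 Ng).
have zB : z \in B by rewrite !inE eqxx !orbT.
have wB : w \in B by rewrite !inE eqxx !orbT.
rewrite Ne' !negb_or ![k == _]eq_sym (neB z k zB kB) (neB w k wB kB) /=.
apply/eqP => gk; have : h' \in N g.
  by rewrite (cubic_symE cN) // Nh'k' gk eqxx !orbT.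
by rewrite Ng' ![h' == _]eq_sym (negPf (neB _ _ eB h'B)) (negPf hh') (negPf ii').
Qed.

(** If two of the outer neighbours of a triangle coincide, two of its vertices span
    a diamond or a [K_4]. *)
Lemma reduce_has_triangle x y z : x \in S -> y \in N x -> z \in N x -> z \in N y ->
  reducible_graph.
Proof.
move=> xS yx zx zy; have yS := cubic_sub cN xS yx; have zS := cubic_sub cN xS zx.
have xy := cubic_sym cN xS yx; have xz := cubic_sym cN xS zx.
have yz := cubic_sym cN yS zy.
have ne a b : a \in S -> b \in N a -> a != b.
  by move=> aS ba; apply: contraTneq ba => <-; apply: (cubic_irr cN).
have [x' Nx] := third_nbr xS yx zx (ne _ _ yS zy).
have [y' Ny] := third_nbr yS xy zy (ne _ _ xS zx).
have [z' Nz] := third_nbr zS xz yz (ne _ _ xS yx).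
have [E|xy'] := eqVneq x' y'.
  by subst y'; apply: (reduce_shared_pair xS yS Nx Ny).
have [E|xz'] := eqVneq x' z'.
  by subst z'; apply: (reduce_shared_pair xS zS (perm3_swap12 Nx) Nz).
have [E|yz'] := eqVneq y' z'.
  by subst z'; apply: (reduce_shared_pair yS zS (perm3_swap12 Ny) (perm3_swap12 Nz)).
by left; apply: (reduce_triangle xS yS zS Nx Ny Nz).
Qed.

(** Without triangles every edge can be deleted. *)
Lemma reduce_triangle_free u v :
  (forall x y z, x \in S -> y \in N x -> z \in N x -> z \notin N y) ->
  u \in S -> v \in N u -> reduces_by 2 edge_insertions S N.
Proof.
move=> tf uS vu; have vS := cubic_sub cN uS vu; have uv := cubic_sym cN uS vu.
have [a [b /perm3_swap12/perm3_swap23 Nu]] := other_nbrs uS vu.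
have [c [d /perm3_swap12/perm3_swap23 Nv]] := other_nbrs vS uv.
have [_ _ _ Nu'] := nbrs3 cN uS Nu; have [_ _ _ Nv'] := nbrs3 cN vS Nv.
have [au bu] : a \in N u /\ b \in N u by rewrite !Nu' !eqxx orbT.
have [cv dv] : c \in N v /\ d \in N v by rewrite !Nv' !eqxx orbT.
have disj x y : x \in N u -> y \in N v -> x != y.
  by move=> xu yv; apply: contraTneq yv => <-; apply: tf xu.
apply: (@reduce_edge u v a b c d); split=> //.
- exact: tf uS au bu.
- exact: tf vS cv dv.
- by rewrite (negPf (disj a c au cv)).
by rewrite (negPf (disj a d au dv)).
Qed.

Lemma reduce_cubic x : x \in S -> reducible_graph.
Proof.
move=> xS.
have [/hasP[u uS /hasP[v vu /hasP[w wu wv]]]|no_tri] :=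
    boolP (has (fun u => has (fun v => has (fun w => w \in N v) (N u)) (N u)) S).
  exact: reduce_has_triangle uS vu wu wv.
have [y yx] : exists y, y \in N x.
  by have := cubic_size cN xS; case: (N x) => [|y r] // _; exists y; rewrite mem_head.
left; apply: reduce_triangle_free xS yx => u v w uS vu wu.
apply: contra no_tri => wv.
by apply/hasP; exists u => //; apply/hasP; exists v => //; apply/hasP; exists w.
Qed.

End Reduce.

(** * Completeness of the list of cubic graphs *)

Section Copies.
Variables (V : eqType) (x0 : V) (S : seq V) (N : V -> seq V).
Hypothesis cN : cubic_on S N.

Lemma iso_check_realizes q g c :
  iso_check q g c -> realizes x0 c S N -> realizes x0 g S N.
Proof.
rewrite /iso_check !eqnE => /and4P[/eqP sg /eqP sq /allP qall /allP rows] [p lp].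
set n := size c in sg sq qall rows.
have pq : perm_eq q (iota 0 n).
  have sub : {subset iota 0 n <= q} by move=> i /qall; rewrite memnE.
  have le : size q <= size (iota 0 n) by rewrite sq size_iota.
  have [_ eqm] := uniq_min_size (iota_uniq 0 n) sub le.
  apply: uniq_perm (leq_size_uniq (iota_uniq 0 n) sub le) (iota_uniq 0 n) _.
  by move=> i; rewrite -eqm.
have ltq k : k < n -> nth 0 q k < n.
  by move=> ltk; have := perm_mem pq (nth 0 q k); rewrite mem_nth ?sq // mem_iota => /esym.
exists (map (nth x0 p) q); split.
- apply: perm_trans (perm_map _ pq) _; rewrite map_nth_iota0 ?(labels_size lp) //.
  by rewrite /n -(labels_size lp) take_size (labels_perm lp).
- by rewrite size_map sq sg.
- move=> i; rewrite sg => lti; have := rows i; rewrite mem_iota => /(_ lti).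
  by case/and3P=> _ _ /allP b; apply/allP => j /b.
move=> i; rewrite sg => lti; have := rows i; rewrite mem_iota => /(_ lti).
rewrite ?eqnE => /and3P[/eqP sm /allP sub /allP b].
have lc := ltq i lti; rewrite (nth_map 0) ?sq //.
apply: perm_trans (labels_row lp lc).
have -> : map (nth x0 (map (nth x0 p) q)) (row g i) =
    map (nth x0 p) (map (nth 0 q) (row g i)).
  by rewrite -map_comp; apply/eq_in_map => j /b ltj; rewrite /= (nth_map 0) // sq.
apply: perm_map; have ur := labels_row_uniq cN lp lc.
have sub' : {subset row c (nth 0 q i) <= map (nth 0 q) (row g i)}.
  by move=> j /sub; rewrite memnE.
have le : size (map (nth 0 q) (row g i)) <= size (row c (nth 0 q i)) by rewrite sm.
have [_ eqm] := uniq_min_size ur sub' le.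
by apply: uniq_perm (leq_size_uniq ur sub' le) ur _ => j; rewrite -eqm.
Qed.

Lemma keyed_iso_realizes g c : keyed_iso g c ->
  realizes x0 c.2.2 S N -> realizes x0 g.2.2 S N.
Proof.
by rewrite /keyed_iso; case: ifP => // _; case: iso_search => // q; apply: iso_check_realizes.
Qed.

Lemma remove_copies_realizes s c : c \in s -> realizes x0 c S N ->
  exists2 g, g \in remove_copies s & realizes x0 g S N.
Proof.
move=> cs rc.
suff [e es re] : exists2 e, e \in foldr insert_table [::] s & realizes x0 e.2.2 S N.
  by exists e.2.2 => //; apply: map_f.
elim: s cs => //= d s IH; rewrite inE /insert_table => /predU1P[<-|/IH[e es re]].
  case: ifP => [/hasP[e es ec]|_]; last first.
    by exists (signature_key (signatures c), (signatures c, c)); rewrite ?mem_head.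
  by exists e => //; apply: keyed_iso_realizes ec rc.
by case: ifP => _; exists e; rewrite // inE es orbT.
Qed.

End Copies.

(** By strong induction on the number of vertices. Deletions may disconnect a graph,
    so the lists contain all cubic graphs, connected or not. *)
Theorem cubic_tables_complete (V : eqType) (x0 : V) n (S : seq V) (N : V -> seq V) :
  cubic_on S N -> size S = n ->
  ~~ odd n /\ exists2 t, t \in (cubic_tables n./2).1 & realizes x0 t S N.
Proof.
have [m] := ubnP n; elim: m n S N => // m IH n S N lt_m cN sS.
have step k : (cubic_tables k.+1).1 =
    remove_copies (extensions (cubic_tables k).1 (cubic_tables k).2).
  by rewrite /=; case: (cubic_tables k).
have snd k : (cubic_tables k.+1).2 = (cubic_tables k).1.
  by rewrite /=; case: (cubic_tables k).
case: S => [|x S] in cN sS *.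
  rewrite -sS; split=> //; exists [::] => //=.
  by exists [::].
case: (reduce_cubic x0 cN (mem_head x S)) => -[S' [N' [cN' sS' ext]]].
  have [|ev [t tA rt]] := IH (size S') S' N' _ cN' erefl.
    by rewrite -ltnS; apply: leq_trans lt_m; rewrite ltnS -sS -sS' addn2.
  have [t' t'e rt'] := ext t rt.
  have En : n = (size S').+2 by rewrite -sS -sS' addn2.
  rewrite En; split; first by rewrite /= negbK.
  rewrite (_ : (size S').+2./2 = (size S')./2.+1) // step.
  apply: (remove_copies_realizes cN _ rt').
  by rewrite mem_cat; apply/orP; left; apply/flatten_mapP; exists t.
have [|ev [t tB rt]] := IH (size S') S' N' _ cN' erefl.
  by rewrite -ltnS; apply: leq_trans lt_m; rewrite ltnS -sS -sS' addn4 ltnS ltnW // ltnW.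
have [t' t'e rt'] := ext t rt.
have En : n = (size S').+4 by rewrite -sS -sS' addn4.
rewrite En; split; first by rewrite /= !negbK.
rewrite (_ : (size S').+4./2 = (size S')./2.+2) // step.
apply: (remove_copies_realizes cN _ rt').
by rewrite mem_cat snd; apply/orP; right; apply/flatten_mapP; exists t.
Qed.

(** * Closed walks of tabulated graphs *)

Fixpoint diagonal_sum (i : nat) (M : seq (seq N)) : N :=
  if M is r :: M' then N.add (nth 0%num r i) (diagonal_sum i.+1 M') else 0%num.

Definition closed_walk_counts (t : table) (K : nat) : seq N :=
  [seq diagonal_sum 0 M | M <- walk_tables t K (walk_id t)].

Fixpoint eq_counts (c d : seq N) : bool :=
  match c, d with
  | [::], [::] => true
  | x :: c', y :: d' => N.eqb x y && eq_counts c' d'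
  | _, _ => false
  end.

Lemma eq_countsE c d : eq_counts c d = (c == d).
Proof.
by elim: c d => [|x c IH] [|y d] //=; rewrite IH eqseq_cons.
Qed.

Lemma nat_of_addN (x y : N) : N.add x y = x + y :> nat.
Proof. by case: x y => [|x] [|y] //=; rewrite ?addn0 // nat_of_add_pos. Qed.

Lemma nth_add3 x y z i : size x = size y -> size x = size z ->
  (nth 0%num (add3 x y z) i : nat) =
  ((nth 0%num x i : nat) + ((nth 0%num y i : nat) + (nth 0%num z i : nat)))%N.
Proof.
elim: x y z i => [|a x IH] [|b y] [|c z] [|i] //= [sy] [sz].
  by rewrite !nat_of_addN.
exact: IH.
Qed.

Lemma size_add3 x y z : size x = size y -> size x = size z -> size (add3 x y z) = size x.
Proof. by elim: x y z => [|a x IH] [|b y] [|c z] //= [sy] [sz]; rewrite IH. Qed.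

Section TableGraph.
Variable (G : sgraph) (x0 : G).

Definition nbr_seq (x : G) : seq G := enum (nbhd x).

Lemma mem_nbr_seq x y : (y \in nbr_seq x) = adj x y.
Proof. by rewrite mem_enum inE. Qed.

Lemma cubic_cubic_on : cubic G -> cubic_on (enum G) nbr_seq.
Proof.
move=> /forallP cG; split=> [|x _|x _|x _|x y _ _|x y _].
- exact: enum_uniq.
- by rewrite -cardE; apply/eqP.
- exact: enum_uniq.
- by rewrite mem_nbr_seq adj_irr.
- by rewrite mem_enum.
by rewrite !mem_nbr_seq adj_sym.
Qed.

Hypothesis cG : cubic G.
Variables (t : table) (p : seq G).
Hypothesis lp : labels x0 t (enum G) nbr_seq p.

Let cN := cubic_cubic_on cG.

Lemma sum_labels (F : G -> nat) : \sum_x F x = \sum_(i < size t) F (nth x0 p i).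
Proof.
rewrite -(labels_size lp) -[RHS](big_mkord xpredT (fun i => F (nth x0 p i))).
rewrite -(big_nth x0 xpredT F) (perm_big _ (labels_perm lp)) big_enum.
by [].
Qed.

(** Row [i] and column [j] of [M] give the walks between the vertices with
    these labels. *)
Definition counts_walks (k : nat) (M : seq (seq N)) : Prop :=
  size M = size t /\ forall i, i < size t -> size (nth [::] M i) = size t /\
    forall j, j < size t ->
      (nth 0%num (nth [::] M i) j : nat) = walks k (nth x0 p i) (nth x0 p j).

Lemma counts_walks0 : counts_walks 0 (walk_id t).
Proof.
split=> [|i lti]; first by rewrite size_map size_iota.
rewrite (nth_map 0) ?size_iota // size_map size_iota; split=> // j ltj.
rewrite (nth_map 0) ?size_iota // !nth_iota // !add0n eqnE /=.
rewrite nth_uniq ?(labels_size lp) ?(labels_uniq cN lp) //.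
by case: (i == j).
Qed.

Lemma counts_walksS k M : counts_walks k M -> counts_walks k.+1 (walk_step t M).
Proof.
move=> [sM MP]; split=> [|i lti]; first by rewrite size_map.
rewrite (nth_map [::]) // -/(row t i).
have := labels_row_size cN lp lti; have := labels_row lp lti.
have := labels_bound lp lti.
case: (row t i) => [|a [|b [|c [|]]]] //= /and4P[lta ltb ltc _] pr _.
have [sa Ma] := MP a lta; have [sb Mb] := MP b ltb; have [sc Mc] := MP c ltc.
have sab := etrans sa (esym sb); have sac := etrans sa (esym sc).
rewrite (size_add3 sab sac); split=> // j ltj.
rewrite (nth_add3 _ sab sac) Ma // Mb // Mc //.
rewrite /= -(big_filter _ (adj (nth x0 p i))).
set W := fun z => walks k z (nth x0 p j).
have -> : \sum_(z <- [seq z <- index_enum G | adj (nth x0 p i) z]) W z =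
    \sum_(z <- nbr_seq (nth x0 p i)) W z.
  by apply/perm_big/uniq_perm; rewrite ?filter_uniq ?index_enum_uniq ?enum_uniq // => z;
    rewrite mem_filter mem_nbr_seq mem_index_enum andbT.
by rewrite -(perm_big _ pr) !big_cons big_nil /= addn0.
Qed.

Lemma walk_tables_count K k M j : counts_walks j M -> k < K ->
  counts_walks (k + j) (nth [::] (walk_tables t K M) k).
Proof.
elim: K k M j => // K IH [|k] M j cM //= ltk.
by rewrite addSnnS; apply: IH => //; apply: counts_walksS.
Qed.

Lemma size_walk_tables K M : size (walk_tables t K M) = K.
Proof. by elim: K M => //= K IH M; rewrite IH. Qed.

Lemma diagonal_sumE M i :
  (diagonal_sum i M : nat) = \sum_(j < size M) (nth 0%num (nth [::] M j) (i + j) : nat).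
Proof.
elim: M i => [|r M IH] i /=; first by rewrite big_ord0.
rewrite nat_of_addN IH big_ord_recl addn0; congr (_ + _).
by apply: eq_bigr => j _; rewrite addSnnS.
Qed.

Lemma closed_walk_countsE K k : k < K ->
  closed_walks G k = nth 0%num (closed_walk_counts t K) k.
Proof.
move=> ltk; rewrite (nth_map [::]) ?size_walk_tables //.
have := walk_tables_count counts_walks0 ltk; rewrite addn0.
set M := nth _ _ _ => -[sM MP].
rewrite diagonal_sumE sM /closed_walks (sum_labels (fun x => walks k x x)).
by apply: eq_bigr => i _; rewrite add0n; have [_ ->] := MP i (ltn_ord i).
Qed.

End TableGraph.

(** Two graphs with the same table are isomorphic. *)
Lemma same_table_genus_poly (G H : sgraph) (x0 : G) (y0 : H) t :
  cubic G -> cubic H ->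
  realizes x0 t (enum G) (@nbr_seq G) -> realizes y0 t (enum H) (@nbr_seq H) ->
  genus_poly G = genus_poly H.
Proof.
move=> cG cH [p lp] [q lq].
have cp := cubic_cubic_on cG; have cq := cubic_cubic_on cH.
have ltp x : index x p < size t by apply: (labels_index lp); rewrite mem_enum.
have ltq x : index x q < size t by apply: (labels_index lq); rewrite mem_enum.
have pK x : nth x0 p (index x p) = x by apply: (labels_nthK lp); rewrite mem_enum.
have qK x : nth y0 q (index x q) = x by apply: (labels_nthK lq); rewrite mem_enum.
have iq i : i < size t -> index (nth y0 q i) q = i.
  by move=> lti; rewrite index_uniq ?(labels_size lq) ?(labels_uniq cq lq).
have ip i : i < size t -> index (nth x0 p i) p = i.
  by move=> lti; rewrite index_uniq ?(labels_size lp) ?(labels_uniq cp lp).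
apply: (@genus_poly_iso _ _ (fun x => nth y0 q (index x p))).
  exists (fun y => nth x0 p (index y q)) => x; first by rewrite iq.
  by rewrite ip.
move=> x y; rewrite -!mem_nbr_seq -(mem_row_index cq lq) ?mem_enum // !iq //.
by rewrite (mem_row_index cp lp) ?mem_enum.
Qed.

(** * No triple on fewer than sixteen vertices *)

(** No three entries of [L] share their closed-walk counts. The counts of lengths 0,
    1 and 2 are the same for all cubic graphs of one order and are dropped. *)
Definition count_classes_small (K : nat) (L : seq table) : bool :=
  let cs := [seq drop 3 (closed_walk_counts t K) | t <- L] in
  all (fun c => count (eq_counts c) cs <= 2) cs.

Lemma count_classes_smallP K L t1 t2 t3 : count_classes_small K L ->
  t1 \in L -> t2 \in L -> t3 \in L ->
  closed_walk_counts t1 K = closed_walk_counts t2 K ->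
  closed_walk_counts t1 K = closed_walk_counts t3 K ->
  ~~ uniq [:: t1; t2; t3].
Proof.
move=> /allP small L1 L2 L3 E12 E13; apply/negP => u.
have := small _ (map_f (fun t => drop 3 (closed_walk_counts t K)) L1).
rewrite count_map -size_filter leqNgt => /negP[].
apply: (uniq_leq_size u) => t; rewrite !inE mem_filter /= eq_countsE.
by case/or3P=> /eqP->; rewrite ?L1 ?L2 ?L3 -?E12 -?E13 eqxx.
Qed.

Lemma count_classes_small_14 :
  all (fun k => count_classes_small 10 (cubic_tables k).1) (iota 1 7).
Proof. by vm_cast_no_check (erefl true). Qed.

Theorem no_small_genus_triple (n : nat) : n < 16 ->
  ~ exists G1 G2 G3 : sgraph, genus_triple n G1 G2 G3.
Proof.
move=> lt16 [G1 [G2 [G3 [[/andP[n1 c1] /andP[n2 c2] /andP[n3 c3]] [s1 s2 s3]]]]].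
move=> [[_ _ _ _ co12] [_ _ _ _ co13] _] [g12 g13 g23].
have inh (G : sgraph) : connected G -> exists x : G, true.
  by case/andP=> /card_gt0P[x _] _; exists x.
have [[x1 _] [x2 _] [x3 _]] := And3 (inh _ n1) (inh _ n2) (inh _ n3).
have tab (G : sgraph) (x : G) : cubic G -> #|G| = n ->
    ~~ odd n /\ exists2 t, t \in (cubic_tables n./2).1 & realizes x t (enum G) (@nbr_seq G).
  move=> cG sG; apply: cubic_tables_complete; first exact: cubic_cubic_on.
  by rewrite -cardE.
have [ev [t1 L1 r1]] := tab G1 x1 c1 s1.
have [_ [t2 L2 r2]] := tab G2 x2 c2 s2; have [_ [t3 L3 r3]] := tab G3 x3 c3 s3.
have counts (G : sgraph) (x : G) t : cubic G -> realizes x t (enum G) (@nbr_seq G) ->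
    forall k, k < 10 -> closed_walks G k = nth 0%num (closed_walk_counts t 10) k.
  by move=> cG [p lp] k ltk; apply: closed_walk_countsE lp _ _ ltk.
have same (G H : sgraph) (x : G) (y : H) t u : cubic G -> cubic H -> cospectral G H ->
    realizes x t (enum G) (@nbr_seq G) -> realizes y u (enum H) (@nbr_seq H) ->
    closed_walk_counts t 10 = closed_walk_counts u 10.
  move=> cG cH co rt ru; apply: (@eq_from_nth _ 0%num).
    by rewrite !size_map !size_walk_tables.
  move=> k; rewrite size_map size_walk_tables => ltk.
  apply: (can_inj nat_of_binK).
  by rewrite -(counts G x t) // -(counts H y u) //; apply: cospectral_closed_walks.
have small : count_classes_small 10 (cubic_tables n./2).1.
  apply: (allP count_classes_small_14); rewrite mem_iota; apply/andP; split; last first.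
    by rewrite add1n ltnS -[7]/(15./2) half_leq.
  case: n ev s1 {tab s2 s3 L1 L2 L3 lt16} => [|[]] //= _ s1.
  by have := fintype0 x1; rewrite s1 => /(_ erefl).
have := count_classes_smallP small L1 L2 L3 (same _ _ _ _ _ _ c1 c2 co12 r1 r2)
  (same _ _ _ _ _ _ c1 c3 co13 r1 r3).
rewrite /= !inE andbT negb_and !negbK => /orP[/orP[]|] /eqP E; subst.
- by apply: g12; apply: same_table_genus_poly c1 c2 r1 r2.
- by apply: g13; apply: same_table_genus_poly c1 c3 r1 r3.
by apply: g23; apply: same_table_genus_poly c2 c3 r2 r3.
Qed.

(** * Counting the cycles of a permutation *)

Section AddArc.
Variables (D : Type) (eqd : D -> D -> bool).

Fixpoint look (P : seq (D * D)) (a : D) : D :=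
  if P is (x, y) :: P' then if eqd x a then y else look P' a else a.

(** [P] lists the maximal paths of the arcs added so far, as pairs of an end and
    a start; vertices without arcs are left out. A path that closes up counts as
    a cycle. *)
Definition add_arc (st : seq (D * D) * nat) (arc : D * D) : seq (D * D) * nat :=
  let: (P, c) := st in let: (a, b) := arc in
  let s := look P a in let P' := [seq q <- P | ~~ eqd q.1 a] in
  if eqd s b then (P', c.+1)
  else if has (fun q => eqd q.2 b) P'
    then ([seq if eqd q.2 b then (q.1, s) else q | q <- P'], c)
    else ((b, s) :: P', c).

End AddArc.

Section Porbits.
Variable T : finType.
Implicit Types (s : {perm T}) (x y : T).

Lemma fconnect_perm s x y : fconnect s x y = (y \in porbit s x).
Proof.
apply/idP/porbitP => [/iter_findex <-|[i ->]]; first by exists (findex s x y); rewrite permX.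
by rewrite permX fconnect_iter.
Qed.

Lemma card_porbits s : #|porbits s| = fcard s T.
Proof.
have sym : connect_sym (coerced_frel s) by move=> x y; apply/fconnect_sym/perm_inj.
have inj : {in froots s &, injective (porbit s)}.
  move=> x y /eqP rx /eqP ry E; rewrite -rx -ry; apply/eqP; rewrite root_connect; last exact: sym.
  by rewrite fconnect_perm E porbit_id.
have -> : porbits s = [set porbit s x | x in froots s].
  apply/setP => X; apply/imsetP/imsetP => -[x xT ->]; last by exists x.
  exists (froot s x); first exact: roots_root.
  by apply/esym/eqP; rewrite eq_porbit_mem -fconnect_perm connect_root.
by rewrite card_in_imset //; apply: eq_card => x; rewrite !inE andbT.
Qed.

Lemma eq_porbit_on s s' x : {in porbit s x, s =1 s'} -> porbit s' x = porbit s x.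
Proof.
move=> E; have it i : (s' ^+ i)%g x = (s ^+ i)%g x.
  elim: i => [|i IH]; first by rewrite !expg0.
  by rewrite !expgSr !permM IH E ?mem_porbit.
by apply/setP => y; apply/porbitP/porbitP => -[i ->]; exists i; rewrite it.
Qed.

Variables (A : {pred T}) (f : T -> T) (phi : {perm T}).
Hypotheses (phiE : phi =1 f) (phiA : fclosed f A).

Lemma closed_perm x : (phi x \in A) = (x \in A).
Proof. by apply/esym/phiA; rewrite /= phiE. Qed.

(** Outside [A] the cycles of [s] are single points. *)
Lemma fcard_on s : {in A, s =1 f} -> {in [predC A], s =1 id} ->
  #|porbits s| = fcard f A + #|[predC A]|.
Proof.
move=> sA sC; rewrite card_porbits.
have iterA x i : x \in A -> iter i s x = iter i f x /\ iter i f x \in A.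
  move=> xA; elim: i => //= i [-> IH]; rewrite sA //; split=> //.
  by rewrite -phiE closed_perm.
have iterC x i : x \notin A -> iter i s x = x.
  by move=> xA; elim: i => //= i ->; rewrite sC.
have conA x : x \in A -> fconnect s x =1 fconnect f x.
  move=> xA y; apply/idP/idP => /iter_findex <-.
    by have [-> _] := iterA x (findex s x y) xA; apply: fconnect_iter.
  by have [<- _] := iterA x (findex f x y) xA; apply: fconnect_iter.
have conC x : x \notin A -> fconnect s x =1 pred1 x.
  move=> xA y; apply/idP/eqP => [/iter_findex <-|->]; [exact: iterC|exact: connect0].
have clA : closed (frel s) A.
  move=> x y /eqP <-; have [xA|xA] := boolP (x \in A).
    by rewrite sA // -phiE closed_perm.
  by rewrite sC ?inE // (negPf xA).
rewrite (n_compC A); congr (_ + _).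
  apply: eq_card => x; rewrite !inE andbC [RHS]andbC.
  case: (boolP (x \in A)) => //= xA; rewrite /roots /root.
  by congr (odflt x _ == x); apply: eq_pick => y; apply: conA.
apply: eq_card => x; rewrite !inE andbC; case: (boolP (x \in A)) => //= xA.
exact: etrans (esym (conC x xA (froot s x))) (connect_root _ x).
Qed.

(** [s] follows the arcs that leave the points of [l] and leads from the end of each
    maximal path, trivial paths included, back to its start. Hence it has as
    many cycles as there are maximal paths and closed cycles together. No two
    starts lie on one cycle of [s]. *)
Record arcs_added (l : seq T) (P : seq (T * T)) (c : nat) (s : {perm T}) : Prop := ArcsAdded {
  added_on : perm_on [set x in A] s;
  added_src : {in l, s =1 phi};
  added_look : forall x, x \notin l -> s x = look eq_op P x;
  added_keys : uniq (unzip1 P);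
  added_fresh : forall x, x \in unzip1 P -> x \notin l;
  added_start : forall x y, x \notin map phi l -> y \notin map phi l ->
    y \in porbit s x -> x = y;
  added_card : #|porbits s| + size l = #|T| + c }.

Lemma look_notin P x : x \notin unzip1 P -> look eq_op P x = x.
Proof.
elim: P => [|[y z] P IH] //=; rewrite inE negb_or eq_sym => /andP[/negPf -> xP].
exact: IH.
Qed.

Lemma look_mem P x y : uniq (unzip1 P) -> (x, y) \in P -> look eq_op P x = y.
Proof.
elim: P => [|[u w] P IH] //= /andP[uP unP]; rewrite inE => /predU1P[[-> ->]|xyP].
  by rewrite eqxx.
case: eqP => [E|_]; last exact: IH.
by case/negP: uP; rewrite E; apply/mapP; exists (x, y).
Qed.

Lemma look_in P x : x \in unzip1 P -> (x, look eq_op P x) \in P.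
Proof.
elim: P => [|[u w] P IH] //=; rewrite inE eq_sym.
by case: eqP => [->|_] /=; rewrite inE ?eqxx // => /IH ->; rewrite orbT.
Qed.

Lemma look_filter (P : seq (T * T)) (a x : T) : x != a ->
  look eq_op [seq q <- P | q.1 != a] x = look eq_op P x.
Proof.
move=> xa; elim: P => [|[u w] P IH] //=; case: (eqVneq u a) => [->|ua] /=.
  by rewrite eq_sym (negPf xa).
by rewrite IH.
Qed.

Lemma unzip1_filter (P : seq (T * T)) (a : T) :
  unzip1 [seq q <- P | q.1 != a] = [seq x <- unzip1 P | x != a].
Proof. by rewrite /unzip1 filter_map. Qed.

Lemma look_redirect (P : seq (T * T)) (b r x : T) :
  look eq_op [seq if q.2 == b then (q.1, r) else q | q <- P] x =
  if x \in unzip1 P then if look eq_op P x == b then r else look eq_op P x else x.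
Proof.
elim: P => [|[u w] P IH] //=; rewrite inE [x == u]eq_sym.
by case wb: (w == b) => /=; case: (u == x) => //=; rewrite wb.
Qed.

Lemma arcs_added0 : arcs_added [::] [::] 0 1.
Proof.
split=> //.
- exact: perm_on1.
- by move=> x _; rewrite perm1.
- by move=> x y _ _ /porbitP[i ->]; rewrite expg1n perm1.
rewrite addn0 addn0 card_porbits; rewrite (eq_fcard (f' := id)); last by move=> x; rewrite perm1.
by rewrite fcard_id.
Qed.

(** Adding the arc from [a] to [b] leaves [s] alone when it closes the path that
    starts at [b]. Otherwise [s] changes by the transposition of [a] and the
    end of the path that starts at [b], which merges two cycles. *)
Lemma arcs_addedS l P c s a : arcs_added l P c s -> a \in A -> a \notin l ->
  let: (P', c') := add_arc eq_op (P, c) (a, phi a) in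
  exists s', arcs_added (a :: l) P' c' s'.
Proof.
case=> on src lk keys fresh start card aA al.
set b := phi a; have sa := lk a al.
pose e := (s^-1)%g b; have se : s e = b by rewrite permKV.
have P'x x : x != a -> look eq_op [seq q <- P | q.1 != a] x = look eq_op P x.
  exact: look_filter.
have uP' : uniq (unzip1 [seq q <- P | q.1 != a]).
  by rewrite unzip1_filter filter_uniq.
have fP' x : x \in unzip1 [seq q <- P | q.1 != a] -> (x != a) && (x \notin l).
  by rewrite unzip1_filter mem_filter => /andP[-> /fresh].
have bl : b \notin map phi l by rewrite mem_map //; apply: perm_inj.
rewrite /add_arc -sa; case: eqP => [sab|/eqP sab].
  exists s; split=> //.
  - by move=> x; rewrite inE => /predU1P[->|/src //].
  - by move=> x; rewrite inE negb_or => /andP[xa xl]; rewrite P'x // lk.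
  - by move=> x /fP'; rewrite inE negb_or.
  - move=> x y; rewrite !inE !negb_or => /andP[_ xl] /andP[_ yl]; exact: start.
  by rewrite /= addnS card addnS.
have ea : e != a by apply: contraNneq sab => <-; rewrite se.
have el : e \notin l.
  by apply/negP => el; case/eqP: ea; apply: (@perm_inj _ phi); rewrite -src.
pose s' := (tperm e a * s)%g.
have s'a : s' a = b by rewrite permM tpermR.
have s'e : s' e = s a by rewrite permM tpermL.
have s'x x : x != e -> x != a -> s' x = s x.
  by move=> xe xa; rewrite permM tpermD // eq_sym.
have sal : s a \notin map phi l.
  apply/mapP => -[x xl]; rewrite -src // => /perm_inj xa.
  by rewrite xa xl in al.
have porb_e : b \in porbit s e by rewrite -se (mem_porbit s 1 e).
have porb_a : s a \in porbit s a by rewrite (mem_porbit s 1 a).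
have porbE x y : x \in porbit s y -> porbit s x = porbit s y.
  by rewrite -eq_porbit_mem => /eqP.
have eNa : e \notin porbit s a.
  apply/negP => ea'; case/eqP: sab; apply: start => //.
  by rewrite (porbE _ _ porb_a) -(porbE _ _ ea').
have lk' x : x != a -> x \notin l -> s' x = if x == e then s a else look eq_op P x.
  by move=> xa xl; case: (eqVneq x e) => [->|xe]; rewrite ?s'e // s'x // lk.
have goal P' : uniq (unzip1 P') -> (forall x, x \in unzip1 P' -> (x != a) && (x \notin l)) ->
    (forall x, x != a -> x \notin l -> look eq_op P' x = if x == e then s a else look eq_op P x) ->
    exists s'', arcs_added (a :: l) P' c s''.
  move=> uP1 fP1 lP1; exists s'; split=> //.
  - have bA : b \in A by rewrite closed_perm.
    have eA : e \in A.
      by have := perm_closed e on; rewrite !inE se bA => /esym.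
    apply/subsetP => x; rewrite !inE; have [->|xa] := eqVneq x a; first by [].
    have [->|xe] := eqVneq x e; first by [].
    rewrite s'x // => sx; have := subsetP on x; rewrite !inE; exact.
  - move=> x; rewrite inE => /predU1P[->|xl] //.
    rewrite s'x ?src //; last by apply: contraNneq al => <-.
    by apply: contraNneq el => <-.
  - by move=> x; rewrite inE negb_or => /andP[xa xl]; rewrite lP1 ?lk'.
  - by move=> x /fP1; rewrite inE negb_or.
  - have out z : z \notin porbit s a -> z \notin porbit s e -> porbit s' z = porbit s z.
      move=> za ze; apply: eq_porbit_on => w; rewrite porbit_sym => wz.
      by rewrite s'x //; apply: contraTneq wz => ->.
    have inO z : z \notin map phi (a :: l) -> (z \in porbit s a) || (z \in porbit s e) -> z = s a.
      rewrite inE negb_or -/b => /andP[zb zl] /orP[] zO.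
        by apply: start; rewrite // (porbE _ _ zO).
      by case/eqP: zb; apply: start; rewrite // (porbE _ _ zO).
    move=> x y xl yl yx; case: (boolP ((x \in porbit s a) || (x \in porbit s e))) => xO.
      rewrite (inO x xl xO); apply/esym/inO => //; apply: contraLR xO.
      rewrite negb_or => /andP[ya ye]; rewrite porbit_sym out // in yx.
      by rewrite negb_or !(porbit_sym s x) (porbE _ _ yx) -!(porbit_sym s y) ya ye.
    move: xO yx; rewrite negb_or => /andP[xa xe]; rewrite out //; apply: start.
      by move: xl; rewrite inE negb_or => /andP[].
    by move: yl; rewrite inE negb_or => /andP[].
  have := porbits_mul_tperm s e a; rewrite eNa ea /= -/s' addn2 addn1 => -[E].
  by rewrite /= addnS -addSn E.
set P1 := [seq q <- P | q.1 != a] in P'x uP' fP' *.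
have lk1 x : x != a -> x \notin l -> look eq_op P1 x = s x by move=> xa xl; rewrite P'x ?lk.
case: ifP => [/hasP[[x1 b1] q1 /= /eqP b1b]|nob]; apply: goal.
- by rewrite /unzip1 -map_comp (eq_map (g := fst)) // => -[q r] /=; case: ifP.
- move=> x; rewrite /unzip1 -map_comp (eq_map (g := fst)); first exact: fP'.
  by move=> [q r] /=; case: ifP.
- have ekey : e \in unzip1 P1.
    have x1P : x1 \in unzip1 P1 by apply/mapP; exists (x1, b1).
    have /andP[x1a x1l] := fP' _ x1P.
    suff <- : x1 = e by [].
    apply: (@perm_inj _ s); rewrite se -b1b -(look_mem uP' q1).
    by rewrite lk1.
  move=> x xa xl; rewrite look_redirect; case: ifP => xP; last first.
    have -> : x == e = false by apply: contraFF xP => /eqP->.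
    by rewrite -P'x // look_notin // xP.
  rewrite lk1 // -lk // -se (inj_eq perm_inj); by case: eqP.
- have eb : e = b.
    rewrite -se -lk1 // look_notin //; apply: contraFN nob => eP.
    by apply/hasP; exists (e, look eq_op P1 e); rewrite ?look_in //= lk1 // se.
  rewrite /= uP' andbT -eb; apply: contraFN nob => eP.
  by apply/hasP; exists (e, look eq_op P1 e); rewrite ?look_in //= lk1 // se.
- have eb : e = b.
    rewrite -se -lk1 // look_notin //; apply: contraFN nob => eP.
    by apply/hasP; exists (e, look eq_op P1 e); rewrite ?look_in //= lk1 // se.
  by move=> x; rewrite inE => /predU1P[->|/fP' //]; rewrite /= -eb ea.
have eb : e = b.
  rewrite -se -lk1 // look_notin //; apply: contraFN nob => eP.
  by apply/hasP; exists (e, look eq_op P1 e); rewrite ?look_in //= lk1 // se.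
by move=> x xa xl; rewrite /= -eb eq_sym P'x.
Qed.

End Porbits.

(** * The face distribution of a tabulated graph *)

Definition dart := (nat * nat)%type.

Definition eqdart (d e : dart) : bool := eqn d.1 e.1 && eqn d.2 e.2.

(** The two rotations at [v] contribute these arcs of the face permutation. Both
    lists have the same order of targets, so that equal sets of paths tend to
    be reached as equal lists. *)
Definition rotation_arcs (T : Type) (v : T) (r : seq T) (flip : bool) :
    seq ((T * T) * (T * T)) :=
  if r is [:: x; y; z] then
    if flip then [:: ((z, v), (v, y)); ((x, v), (v, z)); ((y, v), (v, x))]
    else [:: ((x, v), (v, y)); ((y, v), (v, z)); ((z, v), (v, x))]
  else [::].

Definition face_state := seq (dart * dart).

Fixpoint addN (h k : seq N) : seq N :=
  match h, k with
  | [::], _ => k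
  | _, [::] => h
  | a :: h', b :: k' => N.add a b :: addN h' k'
  end.

Fixpoint eqstate (P Q : face_state) : bool :=
  match P, Q with
  | [::], [::] => true
  | p :: P', q :: Q' => [&& eqdart p.1 q.1, eqdart p.2 q.2 & eqstate P' Q']
  | _, _ => false
  end.

Fixpoint merge_state (P : face_state) (h : seq N) (L : seq (face_state * seq N)) :=
  if L is (Q, k) :: L' then
    if eqstate P Q then (Q, addN h k) :: L' else (Q, k) :: merge_state P h L'
  else [:: (P, h)].

Definition extend_state (v : nat) (r : seq nat) (flip : bool) (Ph : face_state * seq N)
    (L : seq (face_state * seq N)) :=
  let: (P, c) := foldl (add_arc eqdart) (Ph.1, 0) (rotation_arcs v r flip) in
  merge_state P (ncons c 0%num Ph.2) L.

(** The states reached by the rotations at the first vertices. The list of numbers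
    attached to a state gives, by the number of faces closed so far, the ways to
    reach it. The rest of the count depends on the state only, so that equal
    states can be merged. *)
Fixpoint face_states (v : nat) (t : table) (L : seq (face_state * seq N)) :=
  if t is r :: t' then
    face_states v.+1 t' (foldr (fun Ph L' =>
      extend_state v r false Ph (extend_state v r true Ph L')) [::] L)
  else L.

Definition face_distribution (t : table) : seq N :=
  foldr (fun Ph h => addN Ph.2 h) [::] (face_states 0 t [:: ([::], [:: 1%num])]).

(** * The face distribution counts choices of rotations *)

Section Distribution.

(** The number of ways to choose the rotations at the vertices of [vs] so that
    [k] faces are closed in all, when the state [st] has been reached. *)
Fixpoint ways (vs : seq (nat * seq nat)) (st : face_state * nat) (k : nat) : nat :=
  if vs is (v, r) :: vs' then
    ways vs' (foldl (add_arc eqdart) st (rotation_arcs v r false)) k +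
    ways vs' (foldl (add_arc eqdart) st (rotation_arcs v r true)) k
  else (st.2 == k).

Lemma add_arcs_shift P c l : foldl (add_arc eqdart) (P, c) l =
  ((foldl (add_arc eqdart) (P, 0) l).1, (foldl (add_arc eqdart) (P, 0) l).2 + c).
Proof.
elim: l P c => [|[a b] l IH] P c //=; case: ifP => _; last first.
  by case: ifP => _; rewrite IH.
by rewrite IH [in RHS]IH /= -addnA add1n.
Qed.

(** [h] is a distribution of the number of faces closed so far, and [f] is what
    remains to be counted from there. *)
Fixpoint wsum (h : seq N) (f : nat -> nat) : nat :=
  if h is a :: h' then a * f 0 + wsum h' (fun i => f i.+1) else 0.

Lemma eq_wsum h f g : f =1 g -> wsum h f = wsum h g.
Proof. by elim: h f g => //= a h IH f g E; rewrite E (IH _ (fun i => g i.+1)). Qed.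

Lemma wsum_addN h k f : wsum (addN h k) f = wsum h f + wsum k f.
Proof.
elim: h k f => [|a h IH] [|b k] f //=; first by rewrite addn0.
by rewrite IH nat_of_addN mulnDl addnACA.
Qed.

Lemma wsum_ncons c h f : wsum (ncons c 0%num h) f = wsum h (fun i => f (c + i)).
Proof. by elim: c f => [|c IH] f //=; rewrite mul0n add0n IH. Qed.

Lemma wsum_sum h f g : wsum h (fun i => f i + g i) = wsum h f + wsum h g.
Proof. by elim: h f g => //= a h IH f g; rewrite IH mulnDr addnACA. Qed.

Lemma wsum_nth h k : wsum h (fun i => i == k) = nth 0%num h k.
Proof.
elim: h k => [|a h IH] [|k] //=; rewrite ?muln1 ?muln0 ?IH //.
rewrite (_ : wsum h _ = 0) ?addn0 //.
by elim: h {IH} => [|b h IH] //=; rewrite muln0 IH.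
Qed.

Definition total_ways vs k (L : seq (face_state * seq N)) : nat :=
  \sum_(Ph <- L) wsum Ph.2 (fun i => ways vs (Ph.1, i) k).

Lemma eqdartE d e : eqdart d e = (d == e).
Proof. by []. Qed.

Lemma eqstateP P Q : eqstate P Q -> P = Q.
Proof.
elim: P Q => [|[a b] P IH] [|[c d] Q] //=.
by rewrite !eqdartE => /and3P[/eqP-> /eqP-> /IH ->].
Qed.

Lemma total_ways_merge vs k P h L : total_ways vs k (merge_state P h L) =
  wsum h (fun i => ways vs (P, i) k) + total_ways vs k L.
Proof.
elim: L => [|[Q g] L IH] /=; first by rewrite /total_ways big_seq1 big_nil addn0.
case: ifP => [/eqstateP ->|_]; rewrite /total_ways !big_cons /=.
  by rewrite wsum_addN addnA.
by rewrite -/(total_ways _ _ _) IH addnCA.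
Qed.

Lemma total_ways_extend vs k v r flip Ph L :
  total_ways vs k (extend_state v r flip Ph L) =
  wsum Ph.2 (fun i => ways vs (foldl (add_arc eqdart) (Ph.1, i) (rotation_arcs v r flip)) k)
    + total_ways vs k L.
Proof.
rewrite /extend_state; case E: (foldl _ _ _) => [P c].
rewrite total_ways_merge wsum_ncons; congr (_ + _); apply: eq_wsum => i.
by rewrite [in RHS]add_arcs_shift E.
Qed.

Definition numbered_rows (v : nat) (t : table) := zip (iota v (size t)) t.

Lemma face_states_ways v t k L :
  total_ways [::] k (face_states v t L) = total_ways (numbered_rows v t) k L.
Proof.
elim: t v L => //= r t IH v L; rewrite IH.
elim: L => [|Ph L IHL] /=; first by rewrite /total_ways !big_nil.
rewrite !total_ways_extend IHL [in RHS]/total_ways big_cons -/(total_ways _ _ _).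
by rewrite addnA -wsum_sum.
Qed.

Lemma face_distribution_ways t k :
  (nth 0%num (face_distribution t) k : nat) = ways (numbered_rows 0 t) ([::], 0) k.
Proof.
have -> : ways (numbered_rows 0 t) ([::], 0) k =
    total_ways (numbered_rows 0 t) k [:: ([::], [:: 1%num])].
  by rewrite /total_ways big_seq1 /= mul1n addn0.
rewrite -face_states_ways /face_distribution.
elim: (face_states _ _ _) => [|[P h] L IH]; first by rewrite /total_ways big_nil nth_nil.
rewrite /total_ways big_cons -/(total_ways _ _ _) -IH /= -!wsum_nth.
exact: wsum_addN.
Qed.

Definition run_rotations (vs : seq (nat * seq nat)) (st : face_state * nat) (b : seq bool) :=
  foldl (fun st q => foldl (add_arc eqdart) st (rotation_arcs q.1.1 q.1.2 q.2)) st (zip vs b).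

Lemma big_tuple_cons n (F : seq bool -> nat) :
  \sum_(b : n.+1.-tuple bool) F b =
  \sum_(b : n.-tuple bool) F (false :: b) + \sum_(b : n.-tuple bool) F (true :: b).
Proof.
rewrite (reindex (fun q : bool * n.-tuple bool => cons_tuple q.1 q.2)) /=; last first.
  exists (fun b : n.+1.-tuple bool => (thead b, behead_tuple b)) => [[x b] _|b _] /=.
    by congr pair; apply: val_inj.
  by rewrite [RHS]tuple_eta; apply: val_inj.
rewrite -(pair_bigA _ (fun x (b : n.-tuple bool) => F (x :: b))) /=.
by rewrite big_bool addnC.
Qed.

Lemma ways_tuples vs st k m : size vs = m ->
  ways vs st k = \sum_(b : m.-tuple bool) ((run_rotations vs st b).2 == k).
Proof.
move=> <- {m}; elim: vs st => [|[v r] vs IH] st /=.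
  rewrite (bigD1 [tuple]) //= big1 ?addn0 // => b /negP[].
  by rewrite (tuple0 b).
by rewrite (big_tuple_cons _ (fun b => (run_rotations ((v, r) :: vs) st b).2 == k)) !IH.
Qed.

End Distribution.

(** Allows the darts of a graph to be replaced by pairs of labels. *)
Section MapArcs.
Variables (D E : Type) (eqd : rel D) (eqe : rel E) (g : D -> E).
Hypothesis g_eq : forall x y, eqe (g x) (g y) = eqd x y.

Let g2 (q : D * D) := (g q.1, g q.2).

Lemma look_map P a : look eqe (map g2 P) (g a) = g (look eqd P a).
Proof. by elim: P => [|[x y] P IH] //=; rewrite g_eq; case: ifP. Qed.

Lemma add_arc_map P c q : add_arc eqe (map g2 P, c) (g2 q) =
  (map g2 (add_arc eqd (P, c) q).1, (add_arc eqd (P, c) q).2).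
Proof.
case: q => a b; rewrite /add_arc /= look_map filter_map g_eq.
rewrite (eq_filter (a2 := fun q => ~~ eqd q.1 a)); last by move=> q /=; rewrite g_eq.
case: ifP => // _; rewrite has_map (eq_has (a2 := fun q => eqd q.2 b)); last first.
  by move=> q /=; rewrite g_eq.
case: ifP => // _ /=; congr (_, _); rewrite -!map_comp; apply: eq_map => q /=.
by rewrite g_eq; case: ifP.
Qed.

Lemma add_arcs_map P c l : foldl (add_arc eqe) (map g2 P, c) (map g2 l) =
  (map g2 (foldl (add_arc eqd) (P, c) l).1, (foldl (add_arc eqd) (P, c) l).2).
Proof.
elim: l P c => // q l IH P c.
rewrite -[LHS]/(foldl (add_arc eqe) (add_arc eqe (map g2 P, c) (g2 q)) (map g2 l)).
rewrite -[foldl _ _ (q :: l)]/(foldl (add_arc eqd) (add_arc eqd (P, c) q) l).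
by rewrite add_arc_map IH; case: (add_arc eqd (P, c) q).
Qed.

End MapArcs.

(** Once all arcs are added, every cycle of [phi] on [A] has been closed exactly
    once. *)
Lemma fcard_closed_paths (T : finType) (A : {pred T}) (f : T -> T) (phi : {perm T})
    (l : seq T) : phi =1 f -> fclosed f A -> uniq l -> l =i A ->
  (foldl (add_arc eq_op) ([::], 0) [seq (a, f a) | a <- l]).2 = fcard f A.
Proof.
move=> phiE clA ul lA.
have gen l2 : forall l1 P c s, arcs_added A phi l1 P c s -> uniq (l1 ++ l2) ->
    {subset l2 <= A} -> exists s',
    arcs_added A phi (rev l2 ++ l1) (foldl (add_arc eq_op) (P, c) [seq (a, f a) | a <- l2]).1
      (foldl (add_arc eq_op) (P, c) [seq (a, f a) | a <- l2]).2 s'.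
  elim: l2 => [|a l2 IH] l1 P c s inv u sub; first by exists s.
  have al : a \notin l1.
    by move: u; rewrite cat_uniq /= negb_or => /and3P[_ /andP[]].
  have := arcs_addedS phiE clA inv (sub a (mem_head _ _)) al.
  rewrite [map _ _]/= [foldl _ _ (_ :: _)]/(foldl _ (add_arc eq_op (P, c) (a, f a)) _) -phiE.
  case: (add_arc eq_op (P, c) (a, phi a)) => P' c' [s' inv'].
  have [|x l2x|s2 inv2] := IH _ _ _ _ inv'.
  - by move: u; rewrite -cat1s catA cats1 -(perm_uniq (s1 := (a :: l1) ++ l2)) //
      perm_cat2r perm_sym perm_rcons.
  - by apply: sub; rewrite inE l2x orbT.
  by exists s2; rewrite rev_cons cat_rcons.
have [||s inv] := gen l [::] [::] 0 _ (arcs_added0 A phi); first by [].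
  by move=> x; rewrite lA.
have mem_l x : (x \in rev l ++ [::]) = (x \in A) by rewrite cats0 mem_rev lA.
have sA : {in A, s =1 f} by move=> x xA; rewrite -phiE (added_src inv) // mem_l.
have sC : {in [predC A], s =1 id}.
  by move=> x xA; apply: (out_perm (added_on inv)); rewrite inE.
have := added_card inv; rewrite (fcard_on phiE clA sA sC) cats0 size_rev.
have -> : size l = #|A| by rewrite -(card_uniqP ul); apply: eq_card.
rewrite -addnA (addnC #|_|) cardC => /eqP; rewrite addnC eqn_add2l => /eqP.
by [].
Qed.

(** * The graph of a table and its rotation systems *)

Section ThreeCycles.
Variable T : finType.
Implicit Types (x y z : T) (s : {perm T}).

Definition cyc3 x y z : {perm T} := (tperm x y * tperm x z)%g.

Lemma uniq3_swap x y z : uniq [:: x; y; z] -> uniq [:: x; z; y].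
Proof. by rewrite (perm_uniq (s2 := [:: x; z; y])) // perm_cons (perm_catC [:: y] [:: z]). Qed.

Lemma cyc3E x y z : uniq [:: x; y; z] ->
  [/\ cyc3 x y z x = y, cyc3 x y z y = z & cyc3 x y z z = x].
Proof.
rewrite /= !inE negb_or andbT => /andP[/andP[xy xz] yz].
have [yx zx zy] : [/\ y != x, z != x & z != y] by rewrite ![_ == x]eq_sym (eq_sym z).
split; rewrite permM ?tpermL ?tpermR ?tpermL //.
- by rewrite tpermD // eq_sym.
by rewrite (@tpermD _ x y z) // tpermR.
Qed.

Lemma cyc3_out x y z u : u \notin [set x; y; z] -> cyc3 x y z u = u.
Proof.
rewrite !inE !negb_or -!andbA => /and3P[ux uy uz].
by rewrite eq_sym in ux; rewrite eq_sym in uy; rewrite eq_sym in uz; rewrite permM !tpermD.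
Qed.

Lemma porbit_sub (S : {set T}) s u : {in S, forall w, s w \in S} -> u \in S ->
  porbit s u \subset S.
Proof.
move=> clS uS; apply/subsetP => w /porbitP[i ->].
by elim: i => [|i IH]; rewrite ?perm1 // expgSr permM; apply: clS.
Qed.

Lemma eq_cyc3 x y z s : uniq [:: x; y; z] -> perm_on [set x; y; z] s ->
  s x = y -> s y = z -> s z = x -> s = cyc3 x y z.
Proof.
move=> u on sx sy sz; have [cx cy cz] := cyc3E u.
apply/permP => w; have [|out] := boolP (w \in [set x; y; z]).
  by rewrite !inE -orbA => /or3P[] /eqP ->; rewrite ?cx ?cy ?cz.
by rewrite cyc3_out // (out_perm on).
Qed.

Lemma cyc3_rotation x y z : uniq [:: x; y; z] ->
  perm_on [set x; y; z] (cyc3 x y z) &&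
  [forall u in [set x; y; z], porbit (cyc3 x y z) u == [set x; y; z]].
Proof.
move=> u; have [cx cy cz] := cyc3E u; set s := cyc3 x y z in cx cy cz *.
have on : perm_on [set x; y; z] s.
  by apply/subsetP => w; rewrite inE; apply: contraNT => /cyc3_out ->.
rewrite on; apply/forall_inP => w wS; rewrite eqEsubset porbit_sub //=; last first.
  by move=> v vS; rewrite perm_closed.
have Px : porbit s x = porbit s w.
  apply/eqP; rewrite eq_porbit_mem porbit_sym.
  move: wS; rewrite !inE -orbA => /or3P[] /eqP ->.
  - exact: porbit_id.
  - by rewrite -cx; apply: (mem_porbit s 1).
  by have := mem_porbit s 2 x; rewrite permX /= cx cy.
apply/subsetP => v; rewrite -Px !inE -orbA => /or3P[] /eqP ->.
- exact: porbit_id.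
- by rewrite -cx; apply: (mem_porbit s 1).
by have := mem_porbit s 2 x; rewrite permX /= cx cy.
Qed.

(** Three points have two cyclic orders. *)
Lemma rotation3 x y z s : uniq [:: x; y; z] ->
  perm_on [set x; y; z] s &&
    [forall u in [set x; y; z], porbit s u == [set x; y; z]] =
  (s == cyc3 x y z) || (s == cyc3 x z y).
Proof.
have half a b c : uniq [:: a; b; c] -> perm_on [set a; b; c] s ->
    porbit s a == [set a; b; c] -> s a = b -> s = cyc3 a b c.
  move=> u on orb sa; move: (u); rewrite /= !inE negb_or andbT => /andP[/andP[ab ac] bc].
  have sb : s b = c.
    have := perm_closed b on; rewrite !inE eqxx orbT /= => /orP[/orP[]|] /eqP // sb.
      suff : c \in [set a; b] by rewrite !inE (eq_sym c) (negPf ac) eq_sym (negPf bc).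
      have : c \in porbit s a by rewrite (eqP orb) !inE eqxx !orbT.
      apply/subsetP/porbit_sub; rewrite ?inE ?eqxx // => w.
      by rewrite !inE => /orP[] /eqP ->; rewrite ?sa ?sb eqxx ?orbT.
    by case/eqP: ab; apply: (@perm_inj _ s); rewrite sa sb.
  apply: eq_cyc3 => //.
  have := perm_closed c on; rewrite !inE eqxx !orbT /= => /orP[/orP[]|] /eqP // sc.
    by case/eqP: ac; apply: (@perm_inj _ s); rewrite sa sc.
  by case/eqP: bc; apply: (@perm_inj _ s); rewrite sb sc.
have E a b c : [set a; b; c] = [set a; c; b] :> {set T} by rewrite setUAC.
move=> u; have u' := uniq3_swap u.
apply/idP/orP => [/andP[on /forall_inP orb]|[] /eqP ->]; last 2 first.
- exact: cyc3_rotation.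
- by rewrite E; apply: cyc3_rotation.
have xS : x \in [set x; y; z] by rewrite !inE eqxx.
have := perm_closed x on; rewrite xS !inE => /orP[/orP[]|] /eqP sx.
- suff : y \in [set x].
    by move: u; rewrite /= !inE eq_sym => /andP[/norP[/negPf->]].
  have : y \in porbit s x by rewrite (eqP (orb x xS)) !inE eqxx orbT.
  apply/subsetP/porbit_sub; rewrite ?inE ?eqxx // => w.
  by rewrite !inE => /eqP ->; rewrite sx.
- by left; apply/eqP/half; rewrite ?orb.
by right; apply/eqP/half; rewrite // -E ?orb.
Qed.

End ThreeCycles.

Section TableGraph.
Variables (n : nat) (t : table).

Definition table_adj : rel 'I_n.+1 :=
  fun i j => [&& i != j, memn j (row t i) & memn i (row t j)].

Lemma table_adj_sym : symmetric table_adj.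
Proof. by move=> i j; rewrite /table_adj eq_sym [memn j _ && _]andbC. Qed.

Lemma table_adj_irr : irreflexive table_adj.
Proof. by move=> i; rewrite /table_adj eqxx. Qed.

Definition table_graph := SGraph table_adj_sym table_adj_irr.

Definition table_ok : bool := eqn (size t) n.+1 &&
  all (fun i => let r := row t i in [&& eqn (size r) 3, uniq r &
    all (fun j => [&& j < n.+1, ~~ eqn i j & memn i (row t j)]) r]) (iota 0 n.+1).

Hypothesis ok : table_ok.
Local Notation G := table_graph.
Implicit Types i j v : G.

Lemma table_size : size t = n.+1. Proof. by case/andP: ok => /eqP. Qed.

Lemma table_rows i : [/\ size (row t i) = 3, uniq (row t i) &
  forall k, k \in row t i -> [/\ k < n.+1, val i != k & val i \in row t k]].
Proof.
have /andP[_ /allP/(_ (val i))] := ok; rewrite mem_iota /= => /(_ (ltn_ord i)).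
case/and3P=> /eqP -> -> /allP rP; split=> // j /rP /and3P[-> ij]; rewrite memnE => ->.
by split.
Qed.

Lemma table_adjE i j : adj i j = (val j \in row t i).
Proof.
rewrite /= /table_adj !memnE; apply/and3P/idP => [[]|ji] //.
by have [_ _ /(_ _ ji) [_ ij]] := table_rows i.
Qed.

Lemma table_rowE i : exists x y z : G,
  [/\ row t i = [:: val x; val y; val z], uniq [:: x; y; z] & nbhd i = [set x; y; z]].
Proof.
have [] := table_rows i; case E: (row t i) => [|x [|y [|z [|]]]] // _ u rP.
have [] : [/\ x < n.+1, y < n.+1 & z < n.+1].
  by split; [case: (rP x)|case: (rP y)|case: (rP z)] => //; rewrite !inE eqxx ?orbT.
move=> ltx lty ltz; exists (Ordinal ltx), (Ordinal lty), (Ordinal ltz); split=> //.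
apply/setP => j; rewrite inE table_adjE E !inE orbA.
by rewrite -!(inj_eq val_inj).
Qed.

Lemma table_cubic : cubic G.
Proof.
apply/forallP => i; have [x [y [z [_ u ->]]]] := table_rowE i.
move: u; rewrite /= !inE negb_or andbT => /andP[/andP[xy xz] yz].
by rewrite -setUA cardsU1 cards2 !inE negb_or xy xz yz.
Qed.

Lemma card_table_graph : #|G| = n.+1. Proof. exact: card_ord. Qed.

Lemma table_labels : labels (ord0 : G) t (enum G) (@nbr_seq G) (enum 'I_n.+1).
Proof.
split=> [||i|i].
- exact: perm_refl.
- by rewrite size_enum_ord table_size.
- rewrite table_size => lti; apply/allP => j.
  by have [_ _ rP] := table_rows (Ordinal lti); move=> /rP[].
rewrite table_size => lti; have -> : nth ord0 (enum 'I_n.+1) i = Ordinal lti.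
  by apply: val_inj; rewrite /= nth_enum_ord.
have [x [y [z [rE u nE]]]] := table_rowE (Ordinal lti); rewrite -/(row t i) in rE *.
rewrite [row t i]rE /= !nth_ord_enum; apply: uniq_perm; rewrite ?enum_uniq // => w.
by rewrite mem_enum nE !inE orbA.
Qed.

End TableGraph.

(** * Counting the faces of a rotation system *)

Lemma run_rotationsE vs st b :
  run_rotations vs st b =
  foldl (add_arc eqdart) st (flatten [seq rotation_arcs q.1.1 q.1.2 q.2 | q <- zip vs b]).
Proof.
rewrite /run_rotations; elim: (zip vs b) st => //= q l IH st.
by rewrite IH foldl_cat.
Qed.

Lemma rotation_arcs_map (T S : Type) (g : T -> S) v r flip :
  rotation_arcs (g v) (map g r) flip =
  [seq ((g q.1.1, g q.1.2), (g q.2.1, g q.2.2)) | q <- rotation_arcs v r flip].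
Proof. by case: r => [|x [|y [|z [|w r]]]] //; case: flip. Qed.

Section TableRotations.
Variables (n : nat) (t : table).
Hypothesis ok : table_ok n t.
Local Notation G := (table_graph n t).

Definition graph_row (v : G) : seq G := [seq inord k | k <- row t v].

Lemma graph_rowP v : exists x y z : G,
  [/\ graph_row v = [:: x; y; z], uniq [:: x; y; z] & nbhd v = [set x; y; z]].
Proof.
have [x [y [z [E u N]]]] := table_rowE ok v; exists x, y, z; split=> //.
by rewrite /graph_row E /= !inord_val.
Qed.

Lemma val_graph_row v : [seq val x | x <- graph_row v] = row t v.
Proof.
by have [x [y [z [E _ _]]]] := table_rowE ok v; rewrite /graph_row E /= !inord_val.
Qed.

Definition row_rotation (v : G) (flip : bool) : {perm G} :=
  if graph_row v is [:: x; y; z] then if flip then cyc3 x z y else cyc3 x y z else 1%g.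

Definition rotation_of (b : n.+1.-tuple bool) : {ffun G -> {perm G}} :=
  [ffun v => row_rotation v (tnth b v)].

Definition flips_of (rho : {ffun G -> {perm G}}) : n.+1.-tuple bool :=
  [tuple rho v == row_rotation v true | v < n.+1].

Lemma row_rotation_flip v : row_rotation v false != row_rotation v true.
Proof.
rewrite /row_rotation; have [x [y [z [-> u _]]]] := graph_rowP v.
have [cx _ _] := cyc3E u; have [cx' _ _] := cyc3E (uniq3_swap u).
apply/eqP => /permP/(_ x); rewrite cx cx' => yz.
by move: u; rewrite yz /= !inE eqxx !andbF.
Qed.

Lemma rotation_systemE rho : rotation_system rho =
  [forall v, (rho v == row_rotation v false) || (rho v == row_rotation v true)].
Proof.
apply: eq_forallb => v; rewrite /row_rotation.
by have [x [y [z [-> u N]]]] := graph_rowP v; rewrite N rotation3.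
Qed.

Lemma rotation_of_flips rho : rotation_system rho -> rotation_of (flips_of rho) = rho.
Proof.
rewrite rotation_systemE => /forallP rP; apply/ffunP => v; rewrite ffunE tnth_mktuple.
by have := rP v; case: eqP => [->|_] /=; case: eqP => //.
Qed.

Lemma rotation_of_system b : rotation_system (rotation_of b).
Proof.
rewrite rotation_systemE; apply/forallP => v; rewrite ffunE.
by case: (tnth b v); rewrite eqxx ?orbT.
Qed.

Lemma flips_of_rotation b : flips_of (rotation_of b) = b.
Proof.
apply: eq_from_tnth => v; rewrite tnth_mktuple ffunE.
by case: (tnth b v); rewrite ?eqxx // (negPf (row_rotation_flip v)).
Qed.

Definition graph_arcs (b : n.+1.-tuple bool) :=
  flatten [seq rotation_arcs v (graph_row v) (tnth b v) | v <- enum 'I_n.+1].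

Lemma graph_arcs_face b q : q \in graph_arcs b -> q.2 = face_map (rotation_of b) q.1.
Proof.
case/flatten_mapP => v _; rewrite /face_map ffunE /row_rotation.
have [x [y [z [E u _]]]] := graph_rowP v.
have [cx cy cz] := cyc3E u; have [dx dy dz] := cyc3E (uniq3_swap u).
rewrite E; case F: (tnth b v); rewrite !inE => /or3P[] /eqP -> /=; rewrite F E.
all: by rewrite ?cx ?cy ?cz ?dx ?dy ?dz.
Qed.

Lemma card_darts : #|@darts G| = 3 * n.+1.
Proof.
rewrite -sum1_card -(pair_big_dep xpredT (@adj G) (fun _ _ => 1)) /=.
rewrite (eq_bigr (fun=> 3)) => [|v _]; first by rewrite sum_nat_const card_ord mulnC.
rewrite sum1_card; have /forallP/(_ v)/eqP <- := table_cubic ok.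
by apply: eq_card => x; rewrite inE.
Qed.

(** Every dart is the source of an arc, and there are as many arcs as darts. *)
Lemma graph_arcs_darts b :
  uniq (unzip1 (graph_arcs b)) /\ unzip1 (graph_arcs b) =i @darts G.
Proof.
have sub : {subset enum (@darts G) <= unzip1 (graph_arcs b)}.
  move=> [u v]; rewrite mem_enum inE /= => uv.
  rewrite /unzip1 map_flatten -map_comp; apply/flatten_mapP; exists v => /=.
    exact: (mem_enum 'I_n.+1 v).
  have [x [y [z [E _ N]]]] := graph_rowP v.
  have : u \in nbhd v by rewrite inE adj_sym.
  rewrite N E !inE -orbA; case: (tnth b v) => /or3P[] /eqP ->;
    by rewrite /= !inE eqxx ?orbT.
have sz : size (unzip1 (graph_arcs b)) <= size (enum (@darts G)).
  rewrite -cardE card_darts size_map size_flatten sumnE !big_map.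
  rewrite (eq_bigr (fun=> 3)) => [|v _].
    by rewrite -enumT big_const_seq count_predT size_enum_ord iter_addn_0.
  by have [x [y [z [-> _ _]]]] := graph_rowP v; case: (tnth b v).
have [sz1 E] := uniq_min_size (enum_uniq _) sub sz; split.
  by rewrite (uniq_size_uniq (enum_uniq (@darts G)) E) sz1.
by move=> d; rewrite -E mem_enum.
Qed.

Lemma val_graph_arcs (b : n.+1.-tuple bool) :
  [seq ((val q.1.1, val q.1.2), (val q.2.1, val q.2.2)) | q <- graph_arcs b] =
  flatten [seq rotation_arcs q.1.1 q.1.2 q.2 | q <- zip (numbered_rows 0 t) b].
Proof.
rewrite map_flatten -map_comp; congr flatten.
have sr : size (numbered_rows 0 t) = n.+1.
  by rewrite size_zip size_iota minnn (table_size ok).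
have sz : size (zip (numbered_rows 0 t) b) = n.+1 by rewrite size_zip sr size_tuple minnn.
apply: (@eq_from_nth _ [::]) => [|i];
  rewrite size_map size_enum_ord ?[in RHS]size_map ?sz // => lti.
rewrite (nth_map ord0) ?size_enum_ord // (nth_map ((0, [::]), false)) ?sz //.
have -> : nth ord0 (enum 'I_n.+1) i = Ordinal lti by apply: val_inj; rewrite /= nth_enum_ord.
rewrite nth_zip ?sr ?size_tuple // nth_zip ?size_iota //= nth_iota ?(table_size ok) //.
rewrite -(rotation_arcs_map val) val_graph_row add0n.
by rewrite (tnth_nth false).
Qed.

Lemma num_faces_run (b : n.+1.-tuple bool) :
  num_faces (rotation_of b) = (run_rotations (numbered_rows 0 t) ([::], 0) b).2.
Proof.
rewrite run_rotationsE -val_graph_arcs.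
pose g (d : G * G) : dart := (val d.1, val d.2).
have gE x y : eqdart (g x) (g y) = (x == y) by [].
have -> : [seq ((val q.1.1, val q.1.2), (val q.2.1, val q.2.2)) | q <- graph_arcs b] =
  [seq (g q.1, g q.2) | q <- graph_arcs b] by [].
rewrite (add_arcs_map gE [::]) /=.
have [ul lE] := graph_arcs_darts b.
rewrite /num_faces -(fcard_closed_paths (phi := perm (@face_map_inj G (rotation_of b)))
  (l := unzip1 (graph_arcs b))) //; last 2 first.
- by move=> d; rewrite permE.
- exact/darts_closed/rotation_of_system.
congr (foldl _ _ _).2; rewrite -map_comp -[RHS]map_id.
by apply/eq_in_map => -[d e] /graph_arcs_face /= ->.
Qed.

Lemma sum_rotations (V : nmodType) (F : {ffun G -> {perm G}} -> V) :
  (\sum_(rho | rotation_system rho) F rho = \sum_b F (rotation_of b))%R.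
Proof.
rewrite (reindex_onto rotation_of flips_of) => [|rho]; last exact: rotation_of_flips.
by apply: eq_bigl => b; rewrite rotation_of_system flips_of_rotation eqxx.
Qed.

Lemma card_rotations_faces k :
  #|[set rho : {ffun G -> {perm G}} | rotation_system rho & num_faces rho == k]| =
  nth 0%num (face_distribution t) k.
Proof.
rewrite face_distribution_ways (@ways_tuples _ _ _ n.+1); last first.
  by rewrite size_zip size_iota minnn (table_size ok).
rewrite -sum1_card (eq_bigl (fun rho => rotation_system rho && (num_faces rho == k))).
  rewrite big_mkcondr (sum_rotations (fun rho => if num_faces rho == k then 1 else 0)).
  by apply: eq_bigr => b _; rewrite num_faces_run; case: eqP.
by move=> rho; rewrite inE.
Qed.

End TableRotations.

(** * Genera *)

Section MinimumOver.
Variables (I : finType) (P : pred I) (F : I -> nat) (m v : nat).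

Lemma bigminn_eq i : P i -> F i = v -> v <= m -> (forall j, P j -> v <= F j) ->
  \big[minn/m]_(j | P j) F j = v.
Proof.
move=> Pi Fi vm lb; apply/eqP; rewrite eqn_leq; apply/andP; split; last first.
  by elim/big_rec: _ => // j x Pj vx; rewrite leq_min lb.
rewrite -Fi; elim: (index_enum I) (mem_index_enum i) => // j r IH.
rewrite inE big_cons => /predU1P[<-|ir]; first by rewrite Pi geq_minl.
by case: (P j); rewrite ?geq_min ?IH ?orbT.
Qed.

End MinimumOver.

Lemma nat_of_bin_gt0 (x : N) : (0 < x) = (x != 0%num).
Proof. by rewrite lt0n -[0]/(nat_of_bin 0) (can_eq nat_of_binK). Qed.

(** On 16 vertices the genus is [5 - F / 2] for [F] faces. *)
Section Genera.
Variables (t : table) (a b c d : N).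
Hypothesis ok : table_ok 15 t.
Hypothesis dist : face_distribution t = [:: 0; 0; a; 0; b; 0; c; 0; d]%num.
Local Notation G := (table_graph 15 t).
Implicit Types rho : {ffun G -> {perm G}}.

Lemma num_faces_cases rho : rotation_system rho -> num_faces rho \in [:: 2; 4; 6; 8].
Proof.
move=> rP; have : 0 < #|[set r : {ffun G -> {perm G}} | rotation_system r &
    num_faces r == num_faces rho]|.
  by apply/card_gt0P; exists rho; rewrite inE rP /=.
rewrite card_rotations_faces // dist.
by move: (num_faces rho); do 9!case=> //=; case.
Qed.

Lemma genus_faces rho : rotation_system rho -> genus rho = 5 - (num_faces rho)./2.
Proof.
move=> rP; have ge k m : (1 + 16%:R / 4%:R - k%:R / 2%:R : rat)%R = m%:R%R ->
  Num.truncn (1 + 16%:R / 4%:R - k%:R / 2%:R : rat)%R = m by move=> ->; rewrite natrK.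
rewrite /genus card_table_graph; apply: ge.
by have := num_faces_cases rP; rewrite !inE => /or4P[] /eqP ->.
Qed.

Lemma genus_bounds rho : rotation_system rho -> 0 < genus rho <= 4.
Proof.
move=> rP; rewrite genus_faces //.
by have := num_faces_cases rP; rewrite !inE => /or4P[] /eqP ->.
Qed.

Lemma exists_rotation k : 0 < nth 0%num (face_distribution t) k ->
  exists2 rho : {ffun G -> {perm G}}, rotation_system rho & num_faces rho = k.
Proof.
rewrite -(card_rotations_faces ok) => /card_gt0P[rho]; rewrite inE => /andP[rP /eqP fk].
by exists rho.
Qed.

Lemma table_max_genus : a != 0%num -> max_genus G = 4.
Proof.
move=> a0; have [|rho rP fE] := @exists_rotation 2; first by rewrite dist nat_of_bin_gt0.
apply/eqP; rewrite eqn_leq; apply/andP; split.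
  by apply/bigmax_leqP => r /genus_bounds/andP[].
by apply: (bigmax_sup rho) => //; rewrite genus_faces // fE.
Qed.

Lemma table_min_genus : a != 0%num -> d != 0%num -> min_genus G = 1.
Proof.
move=> a0 d0; have [|rho rP fE] := @exists_rotation 8; first by rewrite dist nat_of_bin_gt0.
apply: (bigminn_eq rP); rewrite ?table_max_genus // ?genus_faces ?fE // => r.
by case/genus_bounds/andP.
Qed.

Lemma table_genus_poly_coef : ((genus_poly G)`_2 = (c : nat)%:R)%R.
Proof.
transitivity (#|[set r : {ffun G -> {perm G}} | rotation_system r & num_faces r == 6]|%:R : int)%R.
  rewrite /genus_poly coef_sum -sum1_card natr_sum.
  rewrite [RHS](eq_bigl (fun rho => rotation_system rho && (num_faces rho == 6))).
    rewrite [RHS]big_mkcondr; apply: eq_bigr => r rP; rewrite coefXn genus_faces //.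
    by have := num_faces_cases rP; rewrite !inE => /or4P[] /eqP ->.
  by move=> rho; rewrite inE.
by rewrite (card_rotations_faces ok) dist.
Qed.

End Genera.

(** * Distances and automorphisms from walk counts *)

Lemma connected_from (H : sgraph) (x0 : H) : (forall y, connect (@adj H) x0 y) -> connected H.
Proof.
move=> cx0; apply/andP; split; first by apply/card_gt0P; exists x0.
have sym := sym_connect_sym (@adj_sym H).
apply/forallP => x; apply/forallP => y; apply: connect_trans (cx0 y).
by rewrite sym.
Qed.

Lemma walks_aut (H : sgraph) (s : {perm H}) k x y :
  (forall x y, adj (s x) (s y) = adj x y) -> walks k (s x) (s y) = walks k x y.
Proof.
move=> sadj; elim: k x => [|k IH] x /=; first by rewrite (inj_eq perm_inj).
rewrite (reindex_inj (@perm_inj _ s)) /=.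
by apply: eq_big => [z|z _]; rewrite ?sadj.
Qed.

Definition walk_count (M : seq (seq N)) (i j : nat) : N := nth 0%num (nth [::] M i) j.

Definition within (Ms : seq (seq (seq N))) (i j : nat) : bool :=
  has (fun M => if walk_count M i j is Npos _ then true else false) Ms.

Definition diam_check (t : table) (k : nat) : bool :=
  let V := iota 0 (size t) in
  let Ms := walk_tables t k (walk_id t) in let Ms' := walk_tables t k.+1 (walk_id t) in
  all (fun i => all (within Ms' i) V) V && has (fun i => has (fun j => ~~ within Ms i j) V) V.

(** An automorphism preserves the number of closed walks of each length at a vertex;
    when these numbers tell all vertices apart, it is the identity. *)
Definition asymmetry_check (t : table) (K : nat) : bool :=
  let Ms := walk_tables t K (walk_id t) in
  uniq [seq [seq walk_count M i i | M <- Ms] | i <- iota 0 (size t)].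

Section TableWalks.
Variables (n : nat) (t : table).
Hypothesis ok : table_ok n t.
Local Notation G := (table_graph n t).

Lemma table_walksE K k (i j : G) : k < K ->
  walks k i j = walk_count (nth [::] (walk_tables t K (walk_id t)) k) i j.
Proof.
move=> ltk.
have [sM MP] := walk_tables_count (table_cubic ok) (table_labels ok)
  (counts_walks0 (table_cubic ok) (table_labels ok)) ltk.
have lti (x : G) : x < size t by rewrite (table_size ok).
have [sr ->] := MP i (lti i); rewrite ?lti // addn0.
by rewrite !nth_ord_enum.
Qed.

Lemma withinE K (i j : G) :
  within (walk_tables t K (walk_id t)) i j = [exists k : 'I_K, walk k i j].
Proof.
rewrite /within; apply/hasP/existsP => [[M /(nthP [::])[k]]|[k]].
  rewrite size_walk_tables => ltk <- w; exists (Ordinal ltk) => /=.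
  by rewrite walk_walks (table_walksE _ _ ltk) nat_of_bin_gt0; case: (walk_count _ _ _) w.
rewrite walk_walks (table_walksE _ _ (ltn_ord k)) nat_of_bin_gt0 => w.
exists (nth [::] (walk_tables t K (walk_id t)) k); first by rewrite mem_nth ?size_walk_tables.
by case: (walk_count _ _ _) w.
Qed.

Lemma within_dist K (i j : G) : K <= n.+1 ->
  within (walk_tables t K.+1 (walk_id t)) i j = (dist i j <= K).
Proof.
move=> leK; rewrite withinE; apply/existsP/dist_leP => [|[k w]|[k leKk w]].
- by rewrite card_table_graph.
- by exists k; rewrite // -ltnS.
by exists (Ordinal (leKk : k < K.+1)).
Qed.

Lemma table_diam K : 0 < K <= n.+1 -> diam_check t K -> diam G = K.
Proof.
case: K => // K leK /andP[/allP near /hasP[i iV /hasP[j jV far]]].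
have mV (x : G) : val x \in iota 0 (size t) by rewrite mem_iota (table_size ok) /=.
move: iV jV; rewrite !mem_iota (table_size ok) /= => lti ltj.
apply/eqP; rewrite eqn_leq; apply/andP; split.
  apply/bigmax_leqP => x _; apply/bigmax_leqP => y _.
  by rewrite -within_dist //; apply: (allP (near _ (mV x)) _ (mV y)).
apply: (bigmax_sup (Ordinal lti : G)) => //; apply: (bigmax_sup (Ordinal ltj : G)) => //.
by rewrite ltnNge -within_dist // ltnW.
Qed.

Lemma table_connected K : K <= n.+1 -> diam_check t K -> connected G.
Proof.
move=> leK /andP[/allP near _]; apply: (@connected_from G ord0) => y.
have mV (x : G) : val x \in iota 0 (size t) by rewrite mem_iota (table_size ok) /=.
have := allP (near _ (mV ord0)) _ (mV y); rewrite withinE => /existsP[k].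
by case/existsP => p /andP[pth /eqP <-]; apply/connectP; exists p.
Qed.

Lemma table_asymmetric K : asymmetry_check t K -> #|Aut_graph G| = 1.
Proof.
move=> u; apply/eqP/cards1P; exists 1%g; apply/setP => s; rewrite !inE.
apply/idP/eqP => [/forallP sA|->]; last first.
  by apply/forallP => x; apply/forallP => y; rewrite !perm1.
have {}sA x y : adj (s x) (s y) = adj x y by apply/eqP; have /forallP := sA x; apply.
apply/permP => x; rewrite perm1; apply: val_inj.
have lt_t (z : G) : z < size t by rewrite (table_size ok).
apply/eqP; rewrite -(nth_uniq [::] _ _ u) ?size_map ?size_iota ?lt_t //.
rewrite !(nth_map 0) ?size_iota ?lt_t // !nth_iota ?lt_t // !add0n; apply/eqP.
apply: (@eq_from_nth _ 0%num); rewrite !size_map ?size_walk_tables // => k ltk.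
rewrite !(nth_map [::]) ?size_walk_tables //; apply: (can_inj nat_of_binK).
by rewrite -!table_walksE // walks_aut.
Qed.

Lemma table_closed_walks K k : k < K ->
  closed_walks G k = nth 0%num (closed_walk_counts t K) k.
Proof. exact/closed_walk_countsE/(table_labels ok)/(table_cubic ok). Qed.

End TableWalks.

Lemma table_cospectral n t u : table_ok n t -> table_ok n u ->
  eq_counts (closed_walk_counts t (n.+1 + n.+1).+1) (closed_walk_counts u (n.+1 + n.+1).+1) ->
  cospectral (table_graph n t) (table_graph n u).
Proof.
move=> okt oku; rewrite eq_countsE => /eqP E.
apply: closed_walks_cospectral => k; rewrite !card_table_graph -ltnS => ltk.
by rewrite (table_closed_walks okt ltk) (table_closed_walks oku ltk) E.
Qed.

(** * Connectivity *)

Fixpoint dfs (nb : nat -> seq nat) (fuel : nat) (seen todo : seq nat) : seq nat :=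
  match fuel, todo with
  | fuel'.+1, x :: todo' =>
    if memn x seen then dfs nb fuel' seen todo' else dfs nb fuel' (x :: seen) (nb x ++ todo')
  | _, _ => seen
  end.

Lemma dfs_sound (P : nat -> Prop) nb fuel seen todo :
  (forall x y, P x -> y \in nb x -> P y) ->
  (forall x, x \in seen -> P x) -> (forall x, x \in todo -> P x) ->
  forall x, x \in dfs nb fuel seen todo -> P x.
Proof.
move=> step; elim: fuel seen todo => [|fuel IH] seen [|x todo] //= sP tP.
have Px : P x by apply: tP; rewrite mem_head.
case: ifP => _; apply: IH => // y.
- by move=> yt; apply: tP; rewrite inE yt orbT.
- by rewrite inE => /predU1P[->|/sP].
by rewrite mem_cat => /orP[/step|yt]; [apply|apply: tP; rewrite inE yt orbT].
Qed.

(** 64 steps suffice for the at most 48 darts of a cubic graph on 16 vertices. *)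
Definition reached (nb : nat -> seq nat) (x0 : nat) : seq nat := dfs nb 64 [::] [:: x0].

Lemma reached_connect n (e : rel 'I_n) (S : pred 'I_n) (nb : nat -> seq nat) (x0 y : 'I_n) :
  S x0 -> (forall (x : 'I_n) k, S x -> k \in nb x -> exists2 z : 'I_n, k = z & S z && e x z) ->
  val y \in reached nb x0 -> connect e x0 y.
Proof.
move=> S0 step; pose P (k : nat) := exists2 z : 'I_n, k = z & S z && connect e x0 z.
suff sound k : k \in reached nb x0 -> P k.
  by case/sound => z /val_inj -> /andP[].
apply: dfs_sound => // {k} [k l [z -> /andP[Sz cz]] /(step _ _ Sz)[w -> /andP[Sw zw]]|k].
  by exists w; rewrite // Sw (connect_trans cz) ?connect1.
by rewrite inE => /eqP ->; exists x0; rewrite // S0 connect0.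
Qed.

Definition delete_vertices (t : table) (s : seq nat) (x : nat) : seq nat :=
  [seq y <- row t x | ~~ memn y s].

Definition connected_without (t : table) (s : seq nat) : bool :=
  let V := [seq x <- iota 0 (size t) | ~~ memn x s] in
  if V is x0 :: _ then let R := reached (delete_vertices t s) x0 in
    all (fun y => memn y R) V else false.

(** [a = b] covers the deletion of a single vertex. *)
Definition vertex_check (t : table) : bool :=
  let V := iota 0 (size t) in
  connected_without t [::] &&
  all (fun a => all (fun b => connected_without t [:: a; b]) V) V.

Definition same_edge (e f : nat * nat) : bool :=
  (eqn e.1 f.1 && eqn e.2 f.2) || (eqn e.1 f.2 && eqn e.2 f.1).

Definition delete_edges (t : table) (s : seq (nat * nat)) (x : nat) : seq nat :=
  [seq y <- row t x | ~~ has (same_edge (x, y)) s].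

(** Deleting fewer than two edges leaves a larger graph. *)
Definition edge_check (t : table) : bool :=
  let V := iota 0 (size t) in let E := edge_list t in
  all (fun e => all (fun f => let R := reached (delete_edges t [:: e; f]) 0 in
    all (fun y => memn y R) V) E) E.

Lemma induced_connect (H : sgraph) (S : {set H}) (x y : {z | z \in S}) :
  connect (fun u v => [&& adj u v, u \in S & v \in S]) (val x) (val y) ->
  connect (@adj (induced S)) x y.
Proof.
case/connectP => p; elim: p x => [|z p IH] x /=; first by move=> _ /val_inj ->; exact: connect0.
move=> /andP[/and3P[xz _ zS] pth] l; apply: (@connect_trans _ _ (Sub z zS)).
  by apply: connect1.
exact: IH.
Qed.

(** Removing the neighbours of [v] isolates it. *)
Lemma neighbours_cut (H : sgraph) (v : H) : cubic H -> 4 < #|H| ->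
  ~~ connected (induced (~: nbhd v)).
Proof.
move=> /forallP/(_ v)/eqP n3 lt4.
have vS : v \in ~: nbhd v by rewrite !inE adj_irr.
have [w wS wv] : exists2 w, w \in ~: nbhd v & w != v.
  have : 1 < #|~: nbhd v| by rewrite cardsCs setCK n3; lia.
  rewrite (cardsD1 v) vS ltnS => /card_gt0P[w]; rewrite 2!inE => /andP[wv wS].
  by exists w.
apply/negP => /andP[_ /forallP/(_ (Sub v vS))/forallP/(_ (Sub w wS))].
case/connectP => -[|z p] /= => [_ [vw]|/andP[vz _] _]; first by rewrite vw eqxx in wv.
by have := valP z; rewrite !inE => /negP[].
Qed.

Lemma incident_edges_cut (H : sgraph) (v : H) : cubic H ->
  ~~ connected (spanning_subgraph (~: [set [set v; u] | u in nbhd v])).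
Proof.
move=> /forallP/(_ v)/eqP n3.
have /card_gt0P[w] : 0 < #|nbhd v| by rewrite n3.
rewrite inE => vw; apply/negP => /andP[_ /forallP/(_ v)/forallP/(_ w)].
case/connectP => -[|z p] /= => [_ E|/andP[/andP[vz]]]; first by rewrite E adj_irr in vw.
by rewrite inE => /negP[]; apply/imsetP; exists z; rewrite ?inE.
Qed.

Section TableCuts.
Variables (n : nat) (t : table).
Hypothesis ok : table_ok n t.
Local Notation G := (table_graph n t).

Lemma connected_withoutP s (S : {set G}) : (forall x : G, (x \in S) = (val x \in s)) ->
  connected_without t s -> connected (induced (~: S)).
Proof.
move=> sS; rewrite /connected_without.
have V (x : G) : (val x \in [seq x <- iota 0 (size t) | ~~ memn x s]) = (x \in ~: S).
  by rewrite mem_filter memnE mem_iota (table_size ok) /= ltn_ord andbT inE sS.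
case E: [seq _ <- _ | _] V => [|k V'] // V /allP R.
have : k \in [seq x <- iota 0 (size t) | ~~ memn x s] by rewrite E mem_head.
rewrite mem_filter mem_iota (table_size ok) /= => /andP[_ ltk].
have kS : (Ordinal ltk : G) \in ~: S by rewrite -V mem_head.
apply: (@connected_from (induced (~: S)) (Sub (Ordinal ltk : G) kS)) => y.
apply: induced_connect; have := R (val (val y)); rewrite V memnE (valP y) => /(_ isT).
rewrite -[k]/(nat_of_ord (Ordinal ltk)).
apply: (@reached_connect _ _ [pred x | x \in ~: S]) => // x j /= xS.
rewrite mem_filter memnE => /andP[js jx].
have [_ _ /(_ _ jx)[ltj _ _]] := table_rows ok x.
have jS : (Ordinal ltj : G) \in ~: S by rewrite inE sS.
have xj : adj (x : G) (Ordinal ltj : G) by rewrite (table_adjE ok).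
by exists (Ordinal ltj) => //; apply/andP; split=> //; apply/and3P; split.
Qed.

Lemma table_vertex_connectivity : 15 <= n -> vertex_check t -> vertex_connectivity G = 3.
Proof.
move=> len /andP[ch0 /allP ch2].
have mV (x : G) : val x \in iota 0 (size t) by rewrite mem_iota (table_size ok) /=.
have cG := table_cubic ok; have cardG := card_table_graph n t.
apply: (@bigminn_eq _ _ _ _ _ (nbhd (ord0 : G))).
- by rewrite neighbours_cut // cardG; lia.
- by apply/eqP; have /forallP := cG; apply.
- by rewrite cardG; lia.
move=> S; case: (leqP 3 #|S|) => // lt3.
have -> : (#|~: S| == 1) = false by rewrite cardsCs setCK cardG; apply/eqP; lia.
rewrite orbF => /negP[].
have : #|S| \in [:: 0; 1; 2] by case: #|S| lt3 => [|[|[]]].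
rewrite !inE => /or3P[|/cards1P[a ->]|/cards2P[a [b [_ ->]]]].
- rewrite cards_eq0 => /eqP ->; apply: connected_withoutP ch0 => x.
  by rewrite inE.
- apply: connected_withoutP (allP (ch2 _ (mV a)) _ (mV a)) => x.
  by rewrite !inE orbb.
apply: connected_withoutP (allP (ch2 _ (mV a)) _ (mV b)) => x.
by rewrite !inE.
Qed.

Lemma mem_table_edges (i j : G) :
  ((val i, val j) \in edge_list t) = adj i j && (i < j).
Proof. 
rewrite mem_edge_list.
by rewrite (table_size ok) ltn_ord (table_adjE ok).
Qed.

Lemma edge_listP (e : nat * nat) : e \in edge_list t ->
  exists i j : G, [/\ e = (val i, val j), adj i j & i < j].
Proof.
case: e => i j; rewrite mem_edge_list.
rewrite (table_size ok) => /and3P[lti jr ij].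
have [_ _ /(_ _ jr)[ltj _ _]] := table_rows ok (Ordinal lti).
by exists (Ordinal lti), (Ordinal ltj); rewrite (table_adjE ok).
Qed.

Definition graph_edge (e : nat * nat) : {set G} := [set inord e.1; inord e.2].

Lemma same_edgeE (x y i j : G) :
  same_edge (val x, val y) (val i, val j) = ([set x; y] == [set i; j]).
Proof.
rewrite /same_edge /=; apply/orP/eqP => [[] /andP[/eqP/val_inj-> /eqP/val_inj->] //|].
  by rewrite setUC.
by case/set2_eq => -[-> ->]; [left|right]; apply/andP; split; apply/eqP.
Qed.

Lemma mem_edges : edges G =i map graph_edge (edge_list t).
Proof.
move=> X; apply/imsetP/mapP => -[].
  move=> [i j]; rewrite inE => ij ->; have {}ij : adj i j := ij.
  have : (i != j :> nat) by rewrite (inj_eq val_inj); apply: contraTneq ij => ->; rewrite adj_irr.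
  rewrite neq_ltn => /orP[lt|lt].
    by exists (val i, val j); rewrite ?mem_table_edges ?ij // /graph_edge /= !inord_val.
  exists (val j, val i); rewrite ?mem_table_edges 1?adj_sym ?ij // /graph_edge /= !inord_val.
  by rewrite setUC.
move=> e /edge_listP[i [j [-> ij _]]] ->; exists (i, j); rewrite ?inE //.
by rewrite /graph_edge /= !inord_val.
Qed.

Lemma graph_edge_inj : {in edge_list t &, injective graph_edge}.
Proof.
move=> e f /edge_listP[i [j [-> _ ij]]] /edge_listP[k [l [-> _ kl]]].
rewrite /graph_edge /= !inord_val => /set2_eq[[-> ->] //|[il jk]].
by move: ij; rewrite il jk ltnNge ltnW.
Qed.

Lemma edge_list_uniq : uniq (edge_list t).
Proof.
apply: (@allpairs_uniq_dep _ (fun=> _) _ (fun i j : nat => (i, j)) (iota 0 (size t))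
  (fun i => [seq j <- row t i | ltn i j])).
- exact: iota_uniq.
- move=> i; rewrite mem_iota (table_size ok) /= => lti; apply: filter_uniq.
  by have [_ u _] := table_rows ok (Ordinal lti).
by move=> [i j] [k l] _ _ /= [-> ->].
Qed.

Lemma card_edges : #|edges G| = size (edge_list t).
Proof.
rewrite (eq_card mem_edges) -(size_map graph_edge); apply/card_uniqP.
by rewrite (map_inj_in_uniq graph_edge_inj) edge_list_uniq.
Qed.

Lemma connected_without_edges (e f : nat * nat) (F : {set {set G}}) :
  (forall X, X \in F -> (X == graph_edge e) || (X == graph_edge f)) ->
  e \in edge_list t -> f \in edge_list t ->
  all (fun y => memn y (reached (delete_edges t [:: e; f]) 0)) (iota 0 (size t)) ->
  connected (spanning_subgraph (~: F)).
Proof.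
move=> Fef /edge_listP[i [j [eE _ _]]] /edge_listP[k [l [fE _ _]]] /allP R; subst e f.
apply: (@connected_from (spanning_subgraph (~: F)) (ord0 : G)) => y.
have := R (val y); rewrite mem_iota (table_size ok) ltn_ord memnE => /(_ isT).
apply: (@reached_connect _ _ predT _ ord0) => // x m _.
rewrite mem_filter => /andP[/= + mx].
have [_ _ /(_ _ mx)[ltm _ _]] := table_rows ok x.
set z : G := Ordinal ltm; rewrite -[m]/(val z) !same_edgeE orbF => out.
exists z => //; apply/andP; split; first by rewrite (table_adjE ok).
rewrite inE; apply: contra out => /Fef; rewrite /graph_edge /= !inord_val.
by [].
Qed.

Lemma table_edge_connectivity : 2 < size (edge_list t) -> edge_check t ->
  edge_connectivity G = 3.
Proof.
move=> szE /allP ch; have cG := table_cubic ok.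
have in_edges (v : G) : [set [set v; u] | u in nbhd v] \subset edges G.
  apply/subsetP => X /imsetP[u]; rewrite inE => vu ->; apply/imsetP.
  by exists (v, u); rewrite ?inE.
apply: (@bigminn_eq _ _ _ _ _ [set [set (ord0 : G); u] | u in nbhd (ord0 : G)]).
- by rewrite in_edges incident_edges_cut.
- rewrite card_in_imset; first by apply/eqP; have /forallP := cG; apply.
  move=> u w; rewrite !inE => _ aw /set2_eq[[_ //]|[E _]].
  by rewrite -E adj_irr in aw.
- by rewrite card_edges.
move=> F /andP[/subsetP sub]; case: (leqP 3 #|F|) => // lt3 /negP[].
have [e0 e0E] : exists e, e \in edge_list t.
  by case: (edge_list t) szE => // e s _; exists e; rewrite mem_head.
have : #|F| \in [:: 0; 1; 2] by case: #|F| lt3 => [|[|[]]].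
have edgeP X : X \in F -> exists2 e, e \in edge_list t & X = graph_edge e.
  by move=> /sub; rewrite mem_edges => /mapP.
rewrite !inE => /or3P[|/cards1P[X FE]|/cards2P[X [Y [_ FE]]]].
- rewrite cards_eq0 => /eqP FE; have := allP (ch _ e0E) _ e0E.
  by apply: connected_without_edges => // X; rewrite FE inE.
- have [|e eE XE] := edgeP X; first by rewrite FE set11.
  have := allP (ch _ eE) _ eE; apply: connected_without_edges => // Y.
  by rewrite FE inE XE orbb.
have [|e eE XE] := edgeP X; first by rewrite FE set21.
have [|f fE YE] := edgeP Y; first by rewrite FE set22.
have := allP (ch _ eE) _ fE; apply: connected_without_edges => // Z.
by rewrite FE !inE XE YE.
Qed.

End TableCuts.

(** * Cycle counts *)

Definition prolong (t : table) (p : seq nat) : seq (seq nat) :=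
  if p is y :: _ then [seq x :: p | x <- row t y & ~~ memn x p]
  else [seq [:: x] | x <- iota 0 (size t)].

Fixpoint simple_paths (t : table) (k : nat) : seq (seq nat) :=
  if k is k'.+1 then flatten [seq prolong t p | p <- simple_paths t k'] else [:: [::]].

Definition cycle_mask (t : table) (s : seq nat) : seq bool :=
  let l := [seq (x, next s x) | x <- s] in [seq has (same_edge e) l | e <- edge_list t].

Definition cycle_masks (t : table) (k : nat) : seq (seq bool) :=
  undup [seq cycle_mask t s | s <- simple_paths t k & adjb t (last 0 s) (head 0 s)].

Section TableCycles.
Variables (n : nat) (t : table).
Hypothesis ok : table_ok n t.
Local Notation G := (table_graph n t).

Lemma simple_pathsP k s :
  reflect (exists c : seq G, [/\ s = map val c, size c = k, uniq c & sorted (@adj G) c])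
    (s \in simple_paths t k).
Proof.
elim: k s => [|k IH] s /=.
  rewrite inE; apply: (iffP eqP) => [->|[c [-> /size0nil ->]]] //.
  by exists [::].
apply: (iffP flatten_mapP) => [[p /IH[c [-> sc uc pc]]]|[[|x c] [-> //= [sc]]]].
  case: c sc uc pc => [|y c] /= sc uc pc.
    case/mapP => x; rewrite mem_iota (table_size ok) /= => ltx ->.
    by exists [:: Ordinal ltx]; rewrite -sc.
  case/mapP => x; rewrite mem_filter memnE => /andP[xp xy] ->.
  have [_ _ /(_ _ xy)[ltx _ _]] := table_rows ok y.
  exists [:: Ordinal ltx, y & c]; split=> //=; first by rewrite -sc.
    by rewrite uc -(mem_map val_inj) xp.
  rewrite pc andbT -[table_adj _ _ _]/(adj (Ordinal ltx : G) y) adj_sym.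
  by rewrite (table_adjE ok).
move=> /andP[xc uc] xpc; exists (map val c).
  by apply/IH; exists c; split=> //; case: c xpc {sc xc uc} => //= y c /andP[].
case: c xpc xc {sc uc} => [|y c] /=.
  by move=> _ _; apply/mapP; exists (val x); rewrite // mem_iota (table_size ok) /=.
move=> /andP[xy _] xyc; apply/mapP; exists (val x) => //.
have {}xy : adj (x : G) (y : G) := xy.
rewrite mem_filter -(table_adjE ok) adj_sym xy andbT.
have : ~~ memn (val x) (map val (y :: c)) by rewrite memnE (mem_map val_inj).
by [].
Qed.

Definition edge_mask (X : {set {set G}}) : seq bool :=
  [seq graph_edge n t e \in X | e <- edge_list t].

Lemma edge_mask_inj : {in [pred X : {set {set G}} | X \subset edges G] &, injective edge_mask}.
Proof.
move=> X Y /subsetP XE /subsetP YE /eq_in_map XY; apply/setP => e.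
case: (boolP (e \in edges G)) => [|eE]; first by rewrite (mem_edges ok) => /mapP[f /XY E ->].
by rewrite (contraNF (XE e)) // (contraNF (YE e)).
Qed.

Lemma cycle_edges_sub (c : seq G) : ucycle (@adj G) c -> cycle_edges c \subset edges G.
Proof.
case/andP => cc _; apply/subsetP => X /imsetP[x xc ->]; apply/imsetP.
by exists (x, next c x); rewrite // inE; apply: next_cycle cc xc.
Qed.

Lemma cycle_maskE (c : seq G) : uniq c -> edge_mask (cycle_edges c) = cycle_mask t (map val c).
Proof.
move=> uc; apply/eq_in_map => e /(edge_listP ok)[i [j [-> _ _]]].
rewrite -map_comp has_map; apply/imsetP/hasP => -[x xc] E; exists x => //=.
  by rewrite (next_map val_inj) // same_edgeE; apply/eqP; rewrite -E /graph_edge /= !inord_val.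
by move: E; rewrite /= (next_map val_inj) // same_edgeE /graph_edge /= !inord_val => /eqP.
Qed.

(** Each cycle occurs in the list of closed paths [2 * k] times, once for each start
    and direction; counting distinct masks counts it once. *)
Lemma table_num_cycles k : 0 < k -> num_cycles G k = size (cycle_masks t k).
Proof.
move=> k0; pose L := [seq map (fun x => inord x : G) s
  | s <- simple_paths t k & adjb t (last 0 s) (head 0 s)].
have inordK (c : seq G) : map (fun x => inord x : G) (map val c) = c.
  by rewrite -map_comp map_id_in // => x _; apply: inord_val.
have LP c : (c \in L) = (size c == k) && ucycleb (@adj G) c.
  apply/mapP/idP => [[s]|/and3P[/eqP sc cc uc]].
    rewrite mem_filter => /andP[a /simple_pathsP[d [E sd ud pd]]] ->.
    rewrite E inordK sd eqxx /ucycleb ud andbT /=; move: a.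
    case: d E sd pd {ud} => [|x d] ->; first by move=> sd; rewrite -sd in k0.
    move=> _ /= pd; rewrite rcons_path pd last_map adjbE -(table_adjE ok).
    exact.
  exists (map val c); last by rewrite inordK.
  rewrite mem_filter; apply/andP; split; last first.
    apply/simple_pathsP; exists c; split=> //.
    by case: c cc {sc uc} => //= x c; rewrite rcons_path => /andP[].
  case: c sc cc {uc} => [|x c] sc; first by rewrite -sc in k0.
  rewrite /= rcons_path => /andP[_ lx]; rewrite last_map adjbE -(table_adjE ok).
  exact: lx.
have kE : kcycles G k =i undup [seq cycle_edges c | c <- L].
  move=> X; rewrite mem_undup; apply/imsetP/mapP => [[c]|[c]].
    by rewrite inE => uc ->; exists (val c); rewrite // LP size_tuple eqxx.
  by rewrite LP => /andP[sc uc] ->; exists (Tuple sc); rewrite ?inE.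
rewrite /num_cycles (eq_card kE) (card_uniqP (undup_uniq _)).
rewrite -(size_map edge_mask); apply/perm_size/uniq_perm.
- rewrite map_inj_in_uniq ?undup_uniq // => X Y.
  rewrite !mem_undup => /mapP[c + ->] /mapP[d + ->].
  rewrite !LP => /andP[_ uc] /andP[_ ud]; apply: edge_mask_inj; exact: cycle_edges_sub.
- exact: undup_uniq.
move=> m; rewrite (eq_mem_map edge_mask (mem_undup _)) mem_undup /L -!map_comp.
congr (m \in _); apply/eq_in_map => s; rewrite mem_filter => /andP[_ /simple_pathsP[c [-> _ uc _]]].
by rewrite /= inordK cycle_maskE.
Qed.

Lemma table_girth : 1 < n -> 0 < size (cycle_masks t 3) -> girth G = Some 3.
Proof.
by case: n ok (@table_num_cycles) => [|[|m]] // _ nc _ c3; rewrite /girth card_ord /= nc // c3.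
Qed.

End TableCycles.

(** * The three graphs *)

(** The labels are chosen so that few edges join the first [i] vertices to the
    others for every [i], which keeps the number of states small in the face
    count. *)
Definition table1 : table :=
  [:: [:: 1; 2; 9]; [:: 0; 2; 3]; [:: 0; 1; 5]; [:: 1; 4; 6]; [:: 3; 5; 10]; [:: 2; 4; 7];
      [:: 3; 8; 13]; [:: 5; 8; 11]; [:: 6; 7; 9]; [:: 0; 8; 15]; [:: 4; 11; 12];
      [:: 7; 10; 14]; [:: 10; 13; 15]; [:: 6; 12; 14]; [:: 11; 13; 15]; [:: 9; 12; 14]].

Definition table2 : table :=
  [:: [:: 1; 2; 5]; [:: 0; 2; 7]; [:: 0; 1; 3]; [:: 2; 4; 9]; [:: 3; 5; 6]; [:: 0; 4; 15];
      [:: 4; 7; 11]; [:: 1; 6; 8]; [:: 7; 10; 12]; [:: 3; 10; 13]; [:: 8; 9; 11];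
      [:: 6; 10; 14]; [:: 8; 13; 14]; [:: 9; 12; 15]; [:: 11; 12; 15]; [:: 5; 13; 14]].

Definition table3 : table :=
  [:: [:: 1; 2; 3]; [:: 0; 2; 4]; [:: 0; 1; 6]; [:: 0; 5; 7]; [:: 1; 5; 9]; [:: 3; 4; 15];
      [:: 2; 8; 11]; [:: 3; 8; 13]; [:: 6; 7; 9]; [:: 4; 8; 10]; [:: 9; 11; 14];
      [:: 6; 10; 12]; [:: 11; 13; 15]; [:: 7; 12; 14]; [:: 10; 13; 15]; [:: 5; 12; 14]].

Definition cycle_counts (t : table) : seq nat := [seq size (cycle_masks t k) | k <- iota 3 8].

(** All three graphs have diameter 4, connectivities 3, 24 edges and the listed
    numbers of cycles of lengths 3 to 10; closed walks of at most eight steps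
    distinguish their vertices. *)
Definition checked_invariants (t : table) : bool :=
  [&& table_ok 15 t, diam_check t 4, asymmetry_check t 9, vertex_check t, edge_check t,
      size (edge_list t) == 24 & cycle_counts t == [:: 1; 1; 4; 9; 7; 18; 24; 32]].

(** The spectra have 16 entries each, so that closed walks of lengths up to 32
    determine them. *)
Lemma checked_same_invariants t1 t2 :
  checked_invariants t1 -> checked_invariants t2 ->
  min_genus (table_graph 15 t1) = 1 -> min_genus (table_graph 15 t2) = 1 ->
  max_genus (table_graph 15 t1) = 4 -> max_genus (table_graph 15 t2) = 4 ->
  eq_counts (closed_walk_counts t1 33) (closed_walk_counts t2 33) ->
  same_invariants (table_graph 15 t1) (table_graph 15 t2).
Proof.
case/and5P=> ok1 d1 a1 v1 /and3P[e1 /eqP s1 /eqP c1].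
case/and5P=> ok2 d2 a2 v2 /and3P[e2 /eqP s2 /eqP c2] m1 m2 M1 M2 w.
have cycE k : 2 < k <= 10 ->
    num_cycles (table_graph 15 t1) k = num_cycles (table_graph 15 t2) k.
  move=> /andP[lt2 le10]; have k0 : 0 < k by apply: leq_trans lt2.
  have ltk : k - 3 < 8 by rewrite ltn_subLR.
  have kE t : size (cycle_masks t k) = nth 0 (cycle_counts t) (k - 3).
    by rewrite (nth_map 0) ?size_iota // nth_iota // subnKC.
  by rewrite !table_num_cycles // !kE c1 c2.
have girth3 t : cycle_counts t = [:: 1; 1; 4; 9; 7; 18; 24; 32] -> 0 < size (cycle_masks t 3).
  by move=> /(congr1 (nth 0 ^~ 0)) /= ->.
split; last exact: table_cospectral ok1 ok2 w.
- by rewrite !card_edges // s1 s2 !card_table_graph !table_girth ?girth3.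
- by split; [rewrite m1 m2|rewrite M1 M2].
- split; first by rewrite (table_diam ok1 _ d1) // (table_diam ok2 _ d2).
  - by rewrite !table_vertex_connectivity.
  - by rewrite !table_edge_connectivity ?s1 ?s2.
  by rewrite (table_asymmetric ok1 a1) (table_asymmetric ok2 a2).
exact: cycE.
Qed.

Lemma table1_checked : checked_invariants table1.
Proof. by vm_compute. Qed.

Lemma table2_checked : checked_invariants table2.
Proof. by vm_compute. Qed.

Lemma table3_checked : checked_invariants table3.
Proof. by vm_compute. Qed.

Lemma table1_faces : face_distribution table1 = [:: 0; 0; 37184; 0; 26304; 0; 2028; 0; 20]%num.
Proof. by vm_compute. Qed.

Lemma table2_faces : face_distribution table2 = [:: 0; 0; 37504; 0; 25872; 0; 2148; 0; 12]%num.
Proof. by vm_compute. Qed.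

Lemma table3_faces : face_distribution table3 = [:: 0; 0; 37056; 0; 26432; 0; 2036; 0; 12]%num.
Proof. by vm_compute. Qed.

Lemma table_genus_polys_differ t1 t2 (a1 b1 c1 d1 a2 b2 c2 d2 : N) :
  checked_invariants t1 -> checked_invariants t2 ->
  face_distribution t1 = [:: 0; 0; a1; 0; b1; 0; c1; 0; d1]%num ->
  face_distribution t2 = [:: 0; 0; a2; 0; b2; 0; c2; 0; d2]%num ->
  c1 != c2 -> genus_poly (table_graph 15 t1) <> genus_poly (table_graph 15 t2).
Proof.
move=> /andP[ok1 _] /andP[ok2 _] f1 f2 cc E; case/eqP: cc; apply: (can_inj nat_of_binK).
apply/eqP; rewrite -(eqr_nat int); apply/eqP.
by rewrite -(table_genus_poly_coef ok1 f1) -(table_genus_poly_coef ok2 f2) E.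
Qed.

Theorem theorem7p1 :
  (exists G1 G2 G3 : sgraph,
     [/\ genus_triple 16 G1 G2 G3,
         [/\ laplacian_cospectral G1 G2, laplacian_cospectral G1 G3
           & laplacian_cospectral G2 G3]
       & [/\ #|spanning_trees G1| = #|spanning_trees G2|,
             #|spanning_trees G1| = #|spanning_trees G3|
           & #|spanning_trees G2| = #|spanning_trees G3|]]) /\
  (forall n : nat, n < 16 ->
     ~ exists G1 G2 G3 : sgraph, genus_triple n G1 G2 G3).
Proof.
split; last exact: no_small_genus_triple.
exists (table_graph 15 table1), (table_graph 15 table2), (table_graph 15 table3).
have ck1 := table1_checked; have ck2 := table2_checked; have ck3 := table3_checked.
have ok t : checked_invariants t -> table_ok 15 t by case/andP.
have conn t : checked_invariants t ->
    connected (table_graph 15 t) && cubic (table_graph 15 t).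
  case/and3P=> okt dt _; apply/andP; split; last exact: table_cubic okt.
  exact: (table_connected okt (isT : 4 <= 16) dt).
have genera t a b c d : checked_invariants t ->
    face_distribution t = [:: 0; 0; a; 0; b; 0; c; 0; d]%num -> a != 0%num -> d != 0%num ->
    min_genus (table_graph 15 t) = 1 /\ max_genus (table_graph 15 t) = 4.
  move=> /ok okt ft a0 d0.
  split; [exact: table_min_genus okt ft a0 d0|exact: table_max_genus okt ft a0].
have [m1 M1] := genera _ _ _ _ _ ck1 table1_faces isT isT.
have [m2 M2] := genera _ _ _ _ _ ck2 table2_faces isT isT.
have [m3 M3] := genera _ _ _ _ _ ck3 table3_faces isT isT.
have w12 : eq_counts (closed_walk_counts table1 33) (closed_walk_counts table2 33).
  by vm_compute.
have w13 : eq_counts (closed_walk_counts table1 33) (closed_walk_counts table3 33).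
  by vm_compute.
have w23 : eq_counts (closed_walk_counts table2 33) (closed_walk_counts table3 33).
  by vm_compute.
have same12 := checked_same_invariants ck1 ck2 m1 m2 M1 M2 w12.
have same13 := checked_same_invariants ck1 ck3 m1 m3 M1 M3 w13.
have same23 := checked_same_invariants ck2 ck3 m2 m3 M2 M3 w23.
have lap t u : checked_invariants t -> checked_invariants u ->
    same_invariants (table_graph 15 t) (table_graph 15 u) ->
    laplacian_cospectral (table_graph 15 t) (table_graph 15 u).
  move=> /ok okt /ok oku [_ _ _ _ cs].
  exact: cospectral_laplacian (table_cubic okt) (table_cubic oku) cs.
have trees t u : laplacian_cospectral (table_graph 15 t) (table_graph 15 u) ->
    #|spanning_trees (table_graph 15 t)| = #|spanning_trees (table_graph 15 u)|.
  by apply: laplacian_cospectral_trees; rewrite !card_table_graph.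
have [l12 l13 l23] : [/\ laplacian_cospectral (table_graph 15 table1) (table_graph 15 table2),
    laplacian_cospectral (table_graph 15 table1) (table_graph 15 table3)
    & laplacian_cospectral (table_graph 15 table2) (table_graph 15 table3)].
  by split; [exact: lap ck1 ck2 same12|exact: lap ck1 ck3 same13|exact: lap ck2 ck3 same23].
split; [split|exact: And3 l12 l13 l23|].
- split; [exact: conn ck1|exact: conn ck2|exact: conn ck3].
- split; exact: card_table_graph.
- exact: And3 same12 same13 same23.
- split.
  - exact: table_genus_polys_differ ck1 ck2 table1_faces table2_faces _.
  - exact: table_genus_polys_differ ck1 ck3 table1_faces table3_faces _.
  exact: table_genus_polys_differ ck2 ck3 table2_faces table3_faces _.
exact: And3 (trees _ _ l12) (trees _ _ l13) (trees _ _ l23).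
Qed.
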